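(* There exists an absolute constant $c>0$ such that the following holds for every $n\ge 1$. For any natural number $k\geq 2$ and any two bounded convex domains $\Omega,\Omega'$ in $\mathbb{R}^n$ with piecewise smooth boundaries such that $\Omega\subseteq\Omega'$, we have $$\lambda^N_k(\Omega')\leq c\,(n\log k)^2\,\lambda^N_{k-1}(\Omega).$$
   Context: For a bounded domain $\Omega\subset\mathbb{R}^n$ with piecewise smooth boundary, $0=\lambda_0^N(\Omega)<\lambda_1^N(\Omega)\leq\lambda_2^N(\Omega)\leq\cdots\leq\lambda_k^N(\Omega)\leq\cdots$ denote the Neumann eigenvalues of the (positive) Laplacian on $\Omega$, listed in increasing order, counted with multiplicity, and indexed from $0$. ''Absolute constant'' means a constant independent of everything (of $n$, $k$, $\Omega$, $\Omega'$). $\log$ is the natural logarithm. *)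

(* Defs.v *)
From HB Require Import structures.
From mathcomp Require Import all_boot all_order all_algebra.
From mathcomp Require Import all_classical all_reals all_analysis.

Set Implicit Arguments.
Unset Strict Implicit.
Unset Printing Implicit Defensive.

Import Order.TTheory GRing.Theory Num.Theory.
Import numFieldNormedType.Exports.

Local Open Scope classical_set_scope.
Local Open Scope ring_scope.

(** Points of R^n are row vectors. The sigma-algebra on ['rV[R]_n] is the one
    generated by the coordinates, i.e. the Borel one. *)

Definition rV_display : measure_display.
Proof. exact (measure_tuple_display default_measure_display). Qed.

Section measurable_rV.
Context {R : realType} (n : nat).

Definition rV_coord (i : 'I_n) (x : 'rV[R]_n) : measurableTypeR R := x ord0 i.

Let rV_set0 : g_sigma_preimage rV_coord set0.
Proof. exact: sigma_algebra0. Qed.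

Let rV_setC A : g_sigma_preimage rV_coord A -> g_sigma_preimage rV_coord (~` A).
Proof. exact: sigma_algebraC. Qed.

Let rV_bigcup (F : _^nat) : (forall i, g_sigma_preimage rV_coord (F i)) ->
  g_sigma_preimage rV_coord (\bigcup_i (F i)).
Proof. exact: sigma_algebra_bigcup. Qed.

HB.instance Definition _ := @isMeasurable.Build rV_display
  'rV[R]_n (g_sigma_preimage rV_coord) rV_set0 rV_setC rV_bigcup.

Lemma measurable_rV_coord (i : 'I_n) :
  measurable_fun [set: 'rV[R]_n] (@rV_coord i).
Proof.
move=> _ Y mY; rewrite setTI; apply: sub_sigma_algebra => /=.
rewrite -bigcup_seq/=; exists i => /=; first by rewrite mem_index_enum.
by exists Y => //; rewrite setTI.
Qed.

Lemma measurable_fun_rV d (T : measurableType d) (f : T -> 'rV[R]_n) :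
  (forall i, measurable_fun [set: T] (@rV_coord i \o f)) ->
  measurable_fun [set: T] f.
Proof.
move=> mf.
have H : g_sigma_preimage (fun i => @rV_coord i \o f) `<=` measurable.
  apply: smallest_sub; first exact: sigma_algebra_measurable.
  move=> A; rewrite -bigcup_seq/= => -[i _ [B mB <-]]; exact: mf.
by rewrite g_sigma_preimage_comp in H => _ A mA; apply: H; exists A.
Qed.

End measurable_rV.

Section rV_cons.
Context {R : realType} (n : nat).

Definition rV_cons (p : measurableTypeR R * 'rV[R]_n) : 'rV[R]_n.+1 :=
  \row_i (if unlift ord0 i is Some j then p.2 ord0 j else p.1).

Lemma rV_cons0 p : rV_cons p ord0 ord0 = p.1.
Proof. by rewrite mxE unlift_none. Qed.

Lemma rV_consS p (j : 'I_n) : rV_cons p ord0 (lift ord0 j) = p.2 ord0 j.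
Proof. by rewrite mxE liftK. Qed.

Lemma measurable_rV_cons : measurable_fun setT rV_cons.
Proof.
apply: measurable_fun_rV => i; case: (unliftP ord0 i) => [j|] ->.
  rewrite (_ : _ \o _ = @rV_coord R n j \o snd); last first.
    by apply/funext => p; rewrite /rV_coord/= rV_consS.
  by apply: measurableT_comp => //; exact: measurable_rV_coord.
rewrite (_ : _ \o _ = fst)//.
by apply/funext => p; rewrite /rV_coord/= rV_cons0.
Qed.

Definition rV_split (x : 'rV[R]_n.+1) : measurableTypeR R * 'rV[R]_n :=
  (x ord0 ord0, \row_j x ord0 (lift ord0 j)).

Lemma rV_consK : cancel rV_cons rV_split.
Proof.
move=> [a x]; rewrite /rV_split rV_cons0; congr (_, _).
by apply/rowP => j; rewrite mxE rV_consS.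
Qed.

Lemma measurable_rV_split : measurable_fun setT rV_split.
Proof.
apply: measurable_fun_pair; first exact: (@measurable_rV_coord R n.+1 ord0).
apply: measurable_fun_rV => j.
rewrite (_ : _ \o _ = @rV_coord R n.+1 (lift ord0 j)).
  exact: measurable_rV_coord.
by apply/funext => x; rewrite /rV_coord/= mxE.
Qed.

Variable mu : {sigma_finite_measure set 'rV[R]_n -> \bar R}.

Definition rV_product : set 'rV[R]_n.+1 -> \bar R :=
  pushforward (lebesgue_measure \x mu)%E rV_cons.

Let rV_product0 : rV_product set0 = 0%E.
Proof. by rewrite /rV_product /pushforward preimage_set0 measure0. Qed.

Let rV_product_ge0 A : (0 <= rV_product A)%E.
Proof. by rewrite /rV_product /pushforward measure_ge0. Qed.

Let rV_product_sigma_additive : semi_sigma_additive rV_product.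
Proof.
pose nu := measure_function_pushforward__canonical__measure_function_Measure
  (lebesgue_measure \x mu)%E measurable_rV_cons.
exact: (@measure_semi_sigma_additive _ _ _ nu).
Qed.

HB.instance Definition _ := isMeasure.Build _ _ _ rV_product
  rV_product0 rV_product_ge0 rV_product_sigma_additive.

Let rV_product_sigma_finite : sigma_finite setT rV_product.
Proof.
have /sigma_finiteP[F [FT ndF Foo]] := sigma_finiteT (@lebesgue_measure R).
have /sigma_finiteP[G [GT ndG Goo]] := sigma_finiteT mu.
exists (fun k => rV_split @^-1` (F k `*` G k)).
  rewrite -preimage_bigcup -[LHS](preimage_setT rV_split) -setXTT FT GT.
  congr (_ @^-1` _); apply/seteqP; split=> -[x y]/=.
    move=> [[k _ Fkx] [l _ Gly]]; exists (maxn k l) => //; split.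
    - by move: x Fkx; exact/subsetPset/ndF/leq_maxl.
    - by move: y Gly; exact/subsetPset/ndG/leq_maxr.
  by move=> [k _ []/= ? ?]; split; exists k.
move=> k; have [mF Fk] := Foo k; have [mG Gk] := Goo k; split.
  rewrite -[X in measurable X]setTI.
  by apply: measurable_rV_split => //; exact: measurableX.
rewrite /rV_product /pushforward -comp_preimage (_ : _ \o _ = id); last first.
  by apply/funext; exact: rV_consK.
by rewrite preimage_id product_measure1E// lte_mul_pinfty// ge0_fin_numE.
Qed.

HB.instance Definition _ := Measure_isSigmaFinite.Build _ _ _ rV_product
  rV_product_sigma_finite.

End rV_cons.

Fixpoint lebesgue_rV {R : realType} (n : nat) :
    {sigma_finite_measure set 'rV[R]_n -> \bar R} :=
  if n is m.+1 then rV_product (lebesgue_rV m) else \d_(0 : 'rV[R]_0).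

Lemma lebesgue_rV_box {R : realType} (n : nat) (A : 'I_n -> set (measurableTypeR R)) :
  (forall i, measurable (A i)) ->
  lebesgue_rV n [set x | forall i, A i (x ord0 i)] =
  (\prod_(i < n) lebesgue_measure (A i))%E.
Proof.
elim: n A => [|n IHn] A mA /=.
  by rewrite big_ord0 diracE mem_set// => -[].
pose B := [set x : 'rV[R]_n | forall i, A (lift ord0 i) (x ord0 i)].
have mB : measurable B.
  rewrite (_ : B = \bigcap_(i in [set: 'I_n]) (@rV_coord R n i @^-1` A (lift ord0 i))).
    apply: fin_bigcap_measurable => // i _.
    have := @measurable_rV_coord R n i measurableT _ (mA (lift ord0 i)).
    by rewrite setTI.
  by apply/seteqP; split => [x Bx i _|x Bx i]; [exact: Bx | exact: (Bx i)].
rewrite /rV_product /pushforward big_ord_recl -IHn//= -product_measure1E//.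
congr (_ _); apply/seteqP; split => -[a x]/=.
  move=> Ax; split; first by have := Ax ord0; rewrite rV_cons0.
  by move=> i; have := Ax (lift ord0 i); rewrite rV_consS.
move=> [Aa Bx] i; case: (unliftP ord0 i) => [j|] ->.
  by rewrite rV_consS; exact: Bx.
by rewrite rV_cons0.
Qed.

Section euclidean.
Context {R : realType} {n : nat}.
Implicit Types (Omega U A : set 'rV[R]_n) (f u v phi : 'rV[R]_n -> R).

Definition partial (i : 'I_n) f : 'rV[R]_n -> R := 'D_(delta_mx 0 i) f.

Definition iter_partial (s : seq 'I_n) f : 'rV[R]_n -> R := foldr partial f s.

(** Meant for open [U]. *)
Definition smooth_on U f := forall (s : seq 'I_n) x, U x ->
  {for x, continuous (iter_partial s f)} /\
  forall i : 'I_n, derivable (iter_partial s f) x (delta_mx 0 i).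

Definition domain Omega := [/\ open Omega, Omega !=set0 & connected Omega].

Definition boundary A := closure A `\` interior A.

Definition smooth_boundary_point Omega (p : 'rV[R]_n) :=
  boundary Omega p /\
  exists U f, [/\ open U, U p, smooth_on U f,
    exists i, partial i f p != 0 &
    Omega `&` U = [set x | U x /\ f x < 0]].

(** [A] is negligible for the [s]-dimensional Hausdorff measure. Balls are
    those of the sup norm, which does not affect negligibility. Covers are
    indexed by an arbitrary [J] so that for [s = 0] (each ball weighs 1) only
    the empty set is negligible. *)
Definition hausdorff_negligible (s : nat) A :=
  forall e : R, 0 < e ->
  exists (J : set nat) (x : nat -> 'rV[R]_n) (r : nat -> R),
    [/\ forall j, J j -> 0 < r j,
        A `<=` \bigcup_(j in J) ball (x j) (r j) &
        (\esum_(j in J) (r j ^+ s)%:E < e%:E)%E].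

(** The boundary is made of finitely many connected smooth pieces, up to a set
    of vanishing (n-1)-dimensional measure (edges, corners, conical points). *)
Definition piecewise_smooth_boundary Omega :=
  hausdorff_negligible n.-1
    (boundary Omega `\` smooth_boundary_point Omega) /\
  exists (m : nat) (P : 'I_m -> set 'rV[R]_n),
    (forall j, connected (P j)) /\
    smooth_boundary_point Omega = \bigcup_j P j.

Local Notation mu := (@lebesgue_rV R n).

Definition L2_on Omega u := u \_ Omega \in Lfun mu 2%:E.

Definition test_function Omega phi := smooth_on setT phi /\
  exists K, [/\ compact K, K `<=` Omega & forall x, ~ K x -> phi x = 0].

Definition weak_gradient Omega u (g : 'I_n -> 'rV[R]_n -> R) :=
  forall i phi, test_function Omega phi ->
  \int[mu]_(x in Omega) (u x * partial i phi x) =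
  - \int[mu]_(x in Omega) (g i x * phi x).

(** [u] belongs to H^1(Omega), with weak gradient [g]. *)
Definition H1 Omega u (g : 'I_n -> 'rV[R]_n -> R) :=
  [/\ L2_on Omega u, forall i, L2_on Omega (g i) & weak_gradient Omega u g].

(** The eigenvalue problem [- Delta u = lambda u] in [Omega] with vanishing
    normal derivative on the boundary, in its weak form on H^1(Omega). The
    condition that [u] be nonzero is put in [neumann_eigenvalue]. *)
Definition neumann_solution Omega (lambda : R) u :=
  exists g, H1 Omega u g /\
  forall v h, H1 Omega v h ->
    \int[mu]_(x in Omega) (\sum_(i < n) g i x * h i x) =
    lambda * \int[mu]_(x in Omega) (u x * v x).

Definition neumann_eigenvalue Omega (lambda : R) :=
  exists u, neumann_solution Omega lambda u /\
    ~ {ae mu, forall x, Omega x -> u x = 0}.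

Definition free_on Omega (m : nat) (u : 'I_m -> 'rV[R]_n -> R) :=
  forall a : 'I_m -> R,
  {ae mu, forall x, Omega x -> \sum_(j < m) a j * u j x = 0} ->
  forall j, a j = 0.

(** At least [m] Neumann eigenvalues, counted with multiplicity, are at most
    [lambda]: eigenspaces being in direct sum, this says that their dimensions,
    over the eigenvalues that are at most [lambda], add up to at least [m]. *)
Definition neumann_count_ge Omega (lambda : R) (m : nat) :=
  exists (l : 'I_m -> R) (u : 'I_m -> 'rV[R]_n -> R),
    (forall j, l j <= lambda /\ neumann_solution Omega (l j) (u j)) /\
    free_on Omega u.

(** The [k]-th Neumann eigenvalue (from 0, with multiplicity) is the least
    eigenvalue [lambda] such that at least [k + 1] eigenvalues are at most
    [lambda]. Being [+oo] in the absence of such an eigenvalue, it never takes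
    a junk finite value. *)
Definition neumann_lambda Omega (k : nat) : \bar R :=
  ereal_inf [set lambda%:E | lambda in
    [set lambda | neumann_eigenvalue Omega lambda /\
                  neumann_count_ge Omega lambda k.+1]].

End euclidean.

(* Main.v *)
From HB Require Import structures.
Require Import Defs.
From mathcomp Require Import all_boot all_order all_algebra.
From mathcomp Require Import all_classical all_reals all_analysis.
From mathcomp Require Import measurable_realfun.
From mathcomp Require Import ring lra.

Set Implicit Arguments.
Unset Strict Implicit.
Unset Printing Implicit Defensive.

Import Order.TTheory GRing.Theory Num.Theory.
Import numFieldNormedType.Exports.
Import HBNNSimple.

Local Open Scope classical_set_scope.
Local Open Scope ring_scope.

(* The factor n^2 alone suffices. By doubling, choose r such that [Omega] has k points at
   mutual Euclidean distance >= r, but no k points at distance >= 2 r. A maximal family of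
   points of [Omega] at distance >= 2 r then has at most k - 1 elements, and its Voronoi cells
   are convex of diameter O(r). Some combination of k eigenfunctions of [Omega] has mean zero
   on every cell, so that the Poincare inequality on the cells, whose constant does not depend
   on the dimension, bounds the largest of the k eigenvalues below by a multiple of r^-2.
   On the other hand, k points at distance >= r and the midpoint of a closest pair are k + 1
   points of [Omega'] at distance >= r/2. Radial bumps of radius r/4 about them have disjoint
   supports, and Rayleigh quotients O(n^2 r^-2) in [Omega'], since [Omega'] is star-shaped about
   each of them. The min-max principle bounds the k-th eigenvalue of [Omega'] above.
   The Poincare inequality on a convex cell follows from the Prekopa-Leindler inequality for
   functions that satisfy a second-order Taylor bound, and extends to H^1 by averaging. *)

(** * Lebesgue measure on row vectors *)

(** Eigenfunctions of [Omega] are never transported to [Omega']: only points pass from one domain to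
    the other, and inclusion keeps them separated. Both eigenvalues are thus compared with the same
    r^-2, and doubling makes the radii of separation and of covering differ by a fixed factor. The
    indices match because lambda_{k-1} comes with k independent eigenfunctions, more than there are
    cells, while lambda_k asks for k + 1 bumps, one more than the k points at hand; the midpoint
    supplies it. Since [neumann_lambda] is an infimum over actual eigenvalues, the min-max bound has
    to produce eigenfunctions. The compactness that this takes comes again from the Poincare
    inequality on Voronoi cells, now of small radius; it holds up to the boundary, so that no
    extension operator appears. The same concern shapes the averages: contracting a convex set
    towards a cube inside it keeps the averaged points in the set. The logarithm enters only through
    ln k >= ln 2, which goes into the constant. *)

(** The sigma-algebra is the one generated by the coordinates, so an open set is written as the
    countable union of the sup-norm cubes [B] with rational centre and radius 1/(j + 1) that it
    contains. *)
Lemma open_measurable_rV (R : realType) n (A : set 'rV[R]_n) :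
  open A -> measurable A.
Proof.
move=> oA.
pose B (q : 'rV[rat]_n * nat) : set 'rV[R]_n :=
  \bigcap_(i in [set: 'I_n])
    (@rV_coord R n i @^-1` (ball (ratr (q.1 ord0 i) : R) q.2.+1%:R^-1)).
have mB q : measurable (B q).
  apply: fin_bigcap_measurable => // i _.
  rewrite -[X in measurable X]setTI; apply: measurable_rV_coord => //.
  exact: measurable_ball.
have -> : A = \bigcup_q (if q \in [set q | B q `<=` A] then B q else set0).
  rewrite -bigcup_mkcond; apply/seteqP; split; last by move=> x [q Pq qx]; exact: Pq.
  move=> x Ax.
  have /nbhs_ballP[e /= e0 xeA] : nbhs x A by exact: open_nbhs_nbhs.
  (* A cube of radius 1/(k + 1) that contains [x] lies within 2/(k + 1) of [x]. *)
  have [k ke] : exists k, 2 * k.+1%:R^-1 < e.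
    have [k] : exists k, 0 + k.+1%:R^-1 < e / 2 by apply: ltr_add_invr; rewrite divr_gt0.
    by rewrite add0r ltr_pdivlMr// mulrC => ?; exists k.
  have /choice[q hq] : forall i : 'I_n, exists q : rat, `|x ord0 i - ratr q| < k.+1%:R^-1.
    move=> i; have : x ord0 i - k.+1%:R^-1 < x ord0 i + k.+1%:R^-1.
      by rewrite ltrD2l (@lt_trans _ _ 0)// ?oppr_lt0 invr_gt0.
    by move=> /rat_in_itvoo[q]; rewrite in_itv/= => /andP[h1 h2]; exists q; rewrite distrC ltr_distl; apply/andP; split.
  exists (\row_i q i, k) => /=; last by move=> i _ /=; rewrite /ball/= mxE distrC hq.
  move=> y By; apply: xeA; split => // i j; rewrite ord1.
  have := By j I; rewrite /= /ball/= mxE => h.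
  apply: le_lt_trans ke; rewrite mulr_natl mulr2n.
  rewrite (le_trans (ler_distD (ratr (q j)) _ _))//.
  by apply/ltW/ltrD.
apply: countable_bigcupT_measurable => [|q]; first exact: countableP.
by case: ifP.
Qed.

Lemma continuous_measurable_fun_rV (R : realType) n (f : 'rV[R]_n -> R) :
  continuous f -> measurable_fun [set: 'rV[R]_n] f.
Proof.
move=> /continuousP cf; apply: (measurability _ (RGenOpens.measurableE R)).
move=> _ [_ [a [b ->] <-]]; rewrite setTI; apply: open_measurable_rV.
exact/cf/interval_open.
Qed.

Lemma measurable_coord_rV (R : realType) n (i : 'I_n) :
  measurable_fun [set: 'rV[R]_n] (fun x : 'rV[R]_n => x ord0 i).
Proof. exact: measurable_rV_coord. Qed.

Lemma measurable_ball_rV (R : realType) n (c : 'rV[R]_n) (r : R) : measurable (ball c r).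
Proof. by apply: open_measurable_rV; exact: ball_open. Qed.

Definition convex_rV (R : realType) n (A : set 'rV[R]_n) :=
  forall (s : R) (x y : 'rV[R]_n), 0 <= s <= 1 -> A x -> A y -> A ((1 - s) *: x + s *: y).

Lemma coord_le_norm (R : realType) n (x : 'rV[R]_n) j : `|x ord0 j| <= `|x|.
Proof. by rewrite [leRHS]mx_normrE; exact: (le_bigmax _ (fun ij => `|x ij.1 ij.2|) (ord0, j)). Qed.

Section integral_rV.
Variable R : realType.
Local Open Scope ereal_scope.

Lemma integral_rVS n (f : 'rV[R]_n.+1 -> \bar R) :
  measurable_fun setT f -> (forall x, 0 <= f x) ->
  \int[lebesgue_rV n.+1]_x f x =
  \int[lebesgue_measure]_a \int[lebesgue_rV n]_x f (rV_cons (a, x)).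
Proof.
move=> mf f0 /=.
rewrite /rV_product ge0_integral_pushforward//; last exact: measurable_rV_cons.
rewrite preimage_setT (@fubini_tonelli1 _ _ _ _ _ _ _ (f \o @rV_cons R n))//.
  by apply: measurableT_comp => //; exact: measurable_rV_cons.
by move=> x; exact: f0.
Qed.

Lemma measurable_integral_rV_cons n (f : 'rV[R]_n.+1 -> \bar R) :
  measurable_fun setT f -> (forall x, 0 <= f x) ->
  measurable_fun setT
    (fun a : measurableTypeR R => \int[lebesgue_rV n]_x f (rV_cons (a, x))).
Proof.
move=> mf f0.
apply: (@measurable_fun_fubini_tonelli_F _ _ _ _ _ (lebesgue_rV n) (f \o @rV_cons R n)) => //.
  by apply: measurableT_comp => //; exact: measurable_rV_cons.
by move=> x; exact: f0.
Qed.

Lemma measurable_rV_cons_curry n (a : measurableTypeR R) :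
  measurable_fun setT (fun x : 'rV[R]_n => rV_cons (a, x)).
Proof.
apply: (@measurableT_comp _ _ _ _ _ _ (@rV_cons R n)); first exact: measurable_rV_cons.
exact: measurable_fun_pair.
Qed.

(** Uniqueness of Lebesgue measure: the right-hand side is a measure in [A] that has the right value
    on half-open intervals. *)
Lemma lebesgue_measure_affine (a b : R) (A : set R) : (0 < a)%R -> measurable A ->
  lebesgue_measure A =
  a%:E * lebesgue_measure ((fun t : R => a * t + b)%R @^-1` A).
Proof.
move=> a0 mA.
have mphi : measurable_fun setT (fun t : measurableTypeR R => (a * t + b)%R : measurableTypeR R).
  by apply: measurable_funD => //; exact: measurable_funM.
pose nu := mscale (NngNum (ltW a0)) (measure_function_pushforward__canonical__measure_function_Measure
  (@lebesgue_measure R) mphi).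
apply: (@lebesgue_measure_unique _ nu) => // _ [[c d]] _ <-.
transitivity (a%:E * lebesgue_measure ((fun t : R => a * t + b)%R @^-1` `]c, d])); last by [].
have -> : (fun t : R => a * t + b)%R @^-1` `]c, d] = `]((c - b) / a)%R, ((d - b) / a)%R]%classic.
  apply/seteqP; split => t /=; rewrite !in_itv/= ltr_pdivrMr// ler_pdivlMr// ltrBlDr lerBrDr; by rewrite mulrC.
rewrite !lebesgue_measure_itv/= !lte_fin ltr_pM2r ?invr_gt0// ltrD2r.
case: ifP => _; last by rewrite mule0.
rewrite -!EFinB -EFinM -mulrBl; congr (_%:E).
by field; rewrite gt_eqF.
Qed.

Lemma integral_affine1 (a b : R) (f : R -> \bar R) : (0 < a)%R ->
  measurable_fun setT f -> (forall x, 0 <= f x) ->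
  \int[lebesgue_measure]_t f t = a%:E * \int[lebesgue_measure]_t f (a * t + b)%R.
Proof.
move=> a0 mf f0.
have mphi : measurable_fun setT (fun t : measurableTypeR R => (a * t + b)%R : measurableTypeR R).
  by apply: measurable_funD => //; exact: measurable_funM.
transitivity (\int[mscale (NngNum (ltW a0)) (measure_function_pushforward__canonical__measure_function_Measure
  (@lebesgue_measure R) mphi)]_t f t).
  by apply: eq_measure_integral => A mA _; exact: lebesgue_measure_affine.
rewrite ge0_integral_mscale//; congr (_ * _).
by rewrite [LHS]ge0_integral_pushforward.
Qed.

Lemma measurable_affine_rV n (a : R) (b : 'rV[R]_n) :
  measurable_fun setT (fun x : 'rV[R]_n => a *: x + b)%R.
Proof.
apply: measurable_fun_rV => i.
rewrite (_ : _ \o _ = fun x : 'rV[R]_n => (a * x ord0 i + b ord0 i)%R); last first.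
  by apply/funext => x; rewrite /rV_coord/= !mxE.
apply: measurable_funD => //; apply: measurable_funM => //.
exact: measurable_coord_rV.
Qed.

(** The Jacobian a^n is what brings the dimension into the final bound: a contraction by 1 - d costs
    (1 - d)^-n, which stays bounded uniformly in n only for d of order 1/n. *)
Lemma integral_affine_rV n (a : R) (b : 'rV[R]_n) (f : 'rV[R]_n -> \bar R) :
  (0 < a)%R -> measurable_fun setT f -> (forall x, 0 <= f x) ->
  \int[lebesgue_rV n]_x f x = (a ^+ n)%:E * \int[lebesgue_rV n]_x f (a *: x + b)%R.
Proof.
move=> a0; elim: n b f => [|n IHn] b f mf f0.
  rewrite expr0 mul1e; apply: eq_integral => x _; congr (f _).
  by apply/rowP => -[].
rewrite integral_rVS// (@integral_rVS n (fun x => f (a *: x + b)%R))//; last first.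
  by apply: measurableT_comp => //; exact: measurable_affine_rV.
pose F t := \int[lebesgue_rV n]_x f (rV_cons (t, x)).
have F0 t : 0 <= F t by exact: integral_ge0.
have mF : measurable_fun setT F by exact: measurable_integral_rV_cons.
rewrite (@integral_affine1 a (b ord0 ord0) F a0 mF F0).
pose b' : 'rV[R]_n := (\row_j b ord0 (lift ord0 j))%R.
rewrite exprS EFinM -muleA; congr (_ * _).
rewrite -ge0_integralZl//; first last.
  - by rewrite lee_fin exprn_ge0// ltW.
  - by move=> x _; apply: integral_ge0.
  - apply: (@measurable_integral_rV_cons n (fun x => f (a *: x + b)%R)) => //.
    by apply: measurableT_comp => //; exact: measurable_affine_rV.
apply: eq_integral => t _.
have mfc u : measurable_fun setT (fun x : 'rV[R]_n => f (rV_cons (u, x))).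
  by apply: measurableT_comp => //; exact: measurable_rV_cons_curry.
rewrite /F (IHn b' _ (mfc _))//.
congr (_ * _); apply: eq_integral => x _; congr (f _).
by apply/rowP => j; rewrite /rV_cons !mxE; case: unliftP => [i|] -> /=; rewrite ?mxE.
Qed.

End integral_rV.

(** * The Prekopa-Leindler inequality *)

Section measure_of_sets.
Variable R : realType.

Lemma lebesgue_rV_ball n (c : 'rV[R]_n) (r : R) : 0 < r ->
  lebesgue_rV n (ball c r) = ((r *+ 2) ^+ n)%:E.
Proof.
move=> r0.
have -> : ball c r = [set x : 'rV[R]_n | forall i, ball (c ord0 i) r (x ord0 i)].
  apply/seteqP; split => x /=; first by move=> [_ h] i; exact: h.
  by move=> h; split => // i j; rewrite ord1; exact: h.
rewrite (@lebesgue_rV_box R n (fun i => ball (c ord0 i) r)); last first.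
  by move=> i; exact: measurable_ball.
under eq_bigr do rewrite lebesgue_measure_ball ?ltW//.
by rewrite prodEFin prodr_const card_ord.
Qed.

Lemma bounded_set_ball n (A : set 'rV[R]_n) : bounded_set A ->
  exists2 M, 0 < M & A `<=` ball 0 M.
Proof.
move=> /pinfty_ex_gt0[M M0 AM]; exists (M + 1); first exact: addr_gt0.
move=> x /AM xM; rewrite -ball_normE /ball_/= sub0r normrN.
by rewrite (le_lt_trans xM)// ltrDl.
Qed.

Lemma bounded_lebesgue_rV_lty n (A : set 'rV[R]_n) : measurable A ->
  bounded_set A -> (lebesgue_rV n A < +oo)%E.
Proof.
move=> mA /bounded_set_ball[M M0 AM].
apply: (@le_lt_trans _ _ (lebesgue_rV n (ball (0 : 'rV[R]_n) M))).
  apply: le_measure => //; rewrite ?inE//.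
  exact: measurable_ball_rV.
by rewrite lebesgue_rV_ball// ltry.
Qed.

End measure_of_sets.

Section prekopa_leindler.
Variable R : realType.
Local Open Scope ereal_scope.
Local Notation mu := (@lebesgue_measure R).

(** Layer-cake formula: by Tonelli, both sides measure the part of the subgraph of [F] with heights
    in (0, 1). Heights stop at 1 because superlevel sets of functions with supremum 1 are nonempty
    only below that level. *)
Lemma integral_superlevel d (T : measurableType d)
    (m : {sigma_finite_measure set T -> \bar R}) (F : T -> \bar R) :
  measurable_fun setT F -> (forall x, 0 <= F x) ->
  \int[mu]_(s in `]0%R, 1%R[) m [set x | s%:E < F x] = \int[m]_x mine (F x) 1.
Proof.
move=> mF F0.
pose E := [set p : T * measurableTypeR R | 0 < p.2%:E /\ p.2%:E < 1] `&` [set p : T * measurableTypeR R | p.2%:E < F p.1].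
have m2 : measurable_fun setT (fun p : T * measurableTypeR R => p.2%:E).
  by apply/measurable_EFinP; exact: measurable_snd.
have mE : measurable E.
  apply: measurableI.
    rewrite [X in measurable X](_ : _ = [set p : T * measurableTypeR R | 0 < p.2%:E] `&` [set p : T * measurableTypeR R | p.2%:E < 1])//.
    apply: measurableI; rewrite -[X in measurable X]setTI; apply: emeasurable_fun_lt => //.
  rewrite -[X in measurable X]setTI; apply: emeasurable_fun_lt => //.
  by apply: measurableT_comp => //; exact: measurable_fst.
pose W (p : T * measurableTypeR R) : \bar R := (\1_E p)%:E.
have mW : measurable_fun setT W by apply/measurable_EFinP; exact: measurable_indic.
have W0 p : 0 <= W p by rewrite lee_fin.
have := @fubini_tonelli _ _ _ _ _ m (@lebesgue_measure R) W mW W0.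
rewrite /fubini_F /fubini_G => /esym.
have -> : \int[m]_x \int[mu]_y W (x, y) = \int[m]_x mine (F x) 1.
  apply: eq_integral => x _.
  pose I : set (measurableTypeR R) := `]0%R, fine (mine (F x) 1)[%classic.
  rewrite (_ : (fun y => _) = (fun y => (\1_I y)%:E)); last first.
    apply/funext => y; rewrite /W /E /I !indicE; congr (((nat_of_bool _)%:R)%:E).
    apply/idP/idP; rewrite !inE/= in_itv/= !lte_fin.
      move=> [[y0 y1] yF]; rewrite y0/=; move: (F0 x) yF; case: (F x) => [r| |]//=.
      by rewrite lte_fin => r0 yr; rewrite /mine lte_fin; case: ifP.
    move=> /andP[y0]; have := F0 x; case: (F x) => [r| |]//=.
      rewrite !lte_fin lee_fin /mine lte_fin => r0; case: ifPn => /= [r1 yr|].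
        by rewrite (lt_trans yr).
      by rewrite -leNgt => r1 y1; rewrite y1 (lt_le_trans y1).
    by rewrite /mine/= => _ y1; rewrite y1 ltry.
  have mI : measurable I by rewrite /I; exact: measurable_itv.
  rewrite (integral_indic _ measurableT mI) setIT; apply: (eq_trans (lebesgue_measure_itv _)); rewrite /= lte_fin.
  have : 0 <= mine (F x) 1 by rewrite le_min F0 lee01.
  have : mine (F x) 1 < +oo by rewrite gt_min ltry orbT.
  case: (mine (F x) 1) => [r| |]//= _; rewrite lee_fin => r0.
  case: ifPn => [_|]; first by rewrite oppr0 adde0.
  by rewrite -leNgt => r0'; congr (_%:E); apply/eqP; rewrite eq_le r0 r0'.
move=> <-; rewrite integral_mkcond; apply: eq_integral => s _.
rewrite patchE; case: ifPn => s01.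
  pose Fs := [set x : T | s%:E < F x].
  have mFs : measurable Fs by rewrite -[X in measurable X]setTI; exact: emeasurable_fun_lt.
  transitivity (\int[m]_x (\1_Fs x)%:E).
    by rewrite (integral_indic _ measurableT mFs) setIT.
  apply: eq_integral => x _; rewrite /W /E /Fs !indicE; congr (((nat_of_bool _)%:R)%:E).
  move: s01; rewrite inE/= in_itv/= => /andP[s0 s1].
  by apply/idP/idP; rewrite !inE/= ?lte_fin; [|case].
rewrite (_ : (fun x => _) = cst 0) ?integral_cst ?mul0e//.
apply/funext => x; rewrite /W /E !indicE memNset//= => -[] /=; rewrite !lte_fin => -[s0 s1 _].
by move: s01; rewrite notin_setE/= in_itv/= s0 s1; apply.
Qed.

(** One-dimensional Brunn-Minkowski inequality. With a close to sup A and b close to inf B, the sets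
    (A' + b)/2 and (a + B')/2 both lie in C, on either side of c = (a + b)/2, and have half the
    measures of A' and B'. Cutting A at a and B at b loses at most e/2 each. Keeping [C] abstract
    avoids measuring a Minkowski sum. *)
Lemma lebesgue_measure_midpoint (A B C : set R) (M : R) :
  measurable A -> measurable B -> measurable C ->
  A !=set0 -> B !=set0 -> A `<=` `[(- M)%R, M]%classic -> B `<=` `[(- M)%R, M]%classic ->
  (forall x y, A x -> B y -> C (2^-1 * (x + y))%R) ->
  mu A + mu B <= 2%:E * mu C.
Proof.
move=> mA mB mC A0 B0 AM BM ABC.
have hsA : has_sup A by split => //; exists M => x /AM; rewrite /= in_itv/= => /andP[].
have hiB : has_inf B by split => //; exists (- M)%R => x /BM; rewrite /= in_itv/= => /andP[].
apply/lee_addgt0Pr => _/posnumP[e].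
have e20 : (0 < e%:num / 2)%R by [].
have [a Aa sa] := sup_adherent e20 hsA.
have [b Bb ib] := inf_adherent e20 hiB.
pose A' := A `&` `]-oo, a]%classic; pose B' := B `&` `]b, +oo[%classic.
have mA' : measurable A' by exact: measurableI.
have mB' : measurable B' by exact: measurableI.
have hA : mu A <= mu A' + (e%:num / 2)%:E.
  have -> : (e%:num / 2)%:E = mu `](sup A - e%:num / 2)%R, sup A].
    rewrite lebesgue_measure_itv/= lte_fin ltrBlDr ltrDl e20 -EFinB.
    by congr (_%:E); rewrite opprB addrC subrK.
  apply: (@le_trans _ _ (mu (A' `|` `](sup A - e%:num / 2)%R, sup A]))).
    apply: le_measure; rewrite ?inE//; first exact: measurableU.
    move=> x Ax; have [xa|xa] := leP x a; [left|right]; first by split => //=; rewrite in_itv.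
    by rewrite /= in_itv/= (lt_trans sa)//=; apply: ub_le_sup => //; case: hsA.
  exact: measureU2.
have hB : mu B <= mu B' + (e%:num / 2)%:E.
  have -> : (e%:num / 2)%:E = mu `[inf B, (inf B + e%:num / 2)%R[.
    by rewrite lebesgue_measure_itv/= lte_fin ltrDl e20 -EFinB addrAC subrr add0r.
  apply: (@le_trans _ _ (mu (B' `|` `[inf B, (inf B + e%:num / 2)%R[))).
    apply: le_measure; rewrite ?inE//; first exact: measurableU.
    move=> x Bx; have [xb|xb] := leP x b; [right|left]; last by split => //=; rewrite in_itv/= xb.
    by rewrite /= in_itv/= (le_lt_trans xb)//= andbT; apply: ge_inf => //; case: hiB.
  exact: measureU2.
pose c := (2^-1 * (a + b))%R.
pose C1 := C `&` `]-oo, c]%classic; pose C2 := C `&` `]c, +oo[%classic.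
have mC1 : measurable C1 by exact: measurableI.
have mC2 : measurable C2 by exact: measurableI.
have i2 : (0 < 2^-1 :> R)%R by rewrite invr_gt0.
have hC1 : mu A' <= 2%:E * mu C1.
  rewrite (@lebesgue_measure_affine R (2^-1)%R (2^-1 * b)%R C1)// muleA -EFinM divff// mul1e.
  apply: le_measure; rewrite ?inE//.
    rewrite -[X in measurable X]setTI; apply: (_ : measurable_fun setT _) => //.
    by apply: measurable_funD => //; exact: measurable_funM.
  move=> x [Ax]; rewrite /= in_itv/= => xa; split; first by rewrite /= -mulrDr; exact: ABC.
  by rewrite /= in_itv/= -mulrDr ler_pM2l// lerD2r.
have hC2 : mu B' <= 2%:E * mu C2.
  rewrite (@lebesgue_measure_affine R (2^-1)%R (2^-1 * a)%R C2)// muleA -EFinM divff// mul1e.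
  apply: le_measure; rewrite ?inE//.
    rewrite -[X in measurable X]setTI; apply: (_ : measurable_fun setT _) => //.
    by apply: measurable_funD => //; exact: measurable_funM.
  move=> x [Bx]; rewrite /= in_itv/= andbT => xb; split; first by rewrite /= -mulrDr addrC; exact: ABC.
  by rewrite /= in_itv/= andbT -mulrDr ltr_pM2l// addrC ltrD2r.
have hC : mu C = mu C1 + mu C2.
  rewrite -measureU//; last first.
    apply/seteqP; split => // x [[_ xc] [_ cx]]; move: xc cx; rewrite /= !in_itv/= andbT => xc.
    by rewrite ltNge xc.
  congr (mu _); rewrite -setIUr; apply/seteqP; split => [x Cx|x []//]; split => //=.
  by rewrite !in_itv/= andbT; case: leP; [left|right].
apply: (le_trans (leeD hA hB)).
rewrite addeACA -EFinD -splitr leeD2r// hC ge0_muleDr//.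
exact: leeD.
Qed.

(** When both suprema are 1, the sets where f > s and g > s are nonempty for all s < 1, so the
    one-dimensional Brunn-Minkowski inequality applies at each level and integrates to an additive
    inequality, from which the product form follows. *)
Let prekopa_leindler1_norm (f g : R -> R) (h : R -> \bar R) (M : R) :
  measurable_fun setT f -> measurable_fun setT g -> measurable_fun setT h ->
  (forall x, (0 <= f x <= 1)%R) -> (forall x, (0 <= g x <= 1)%R) ->
  (forall x, 0 <= h x) ->
  (forall x, ~ `[(- M)%R, M]%classic x -> f x = 0%R) ->
  (forall x, ~ `[(- M)%R, M]%classic x -> g x = 0%R) ->
  (forall s, (s < 1)%R -> exists x, (s < f x)%R) ->
  (forall s, (s < 1)%R -> exists x, (s < g x)%R) ->
  (forall s x y, (0 < s)%R -> (s < f x)%R -> (s < g y)%R -> s%:E < h (2^-1 * (x + y))%R) ->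
  \int[mu]_x (f x)%:E + \int[mu]_x (g x)%:E <= 2%:E * \int[mu]_x h x.
Proof.
move=> mf mg mh f01 g01 h0 fM gM f1 g1 fgh.
have mf' : measurable_fun setT (EFin \o f) by exact/measurable_EFinP.
have mg' : measurable_fun setT (EFin \o g) by exact/measurable_EFinP.
have msup (F : R -> \bar R) : measurable_fun setT F -> (forall x, 0 <= F x) ->
    measurable_fun (`]0%R, 1%R[%classic : set R) (fun s : R => mu [set x | s%:E < F x]).
  move=> mF F0; apply: measurable_funTS.
  pose E := [set p : measurableTypeR R * measurableTypeR R | p.1%:E < F p.2].
  have mE : measurable E.
    rewrite -[X in measurable X]setTI; apply: emeasurable_fun_lt => //.
      by apply/measurable_EFinP; exact: measurable_fst.
    by apply: measurableT_comp => //; exact: measurable_snd.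
  have := @measurable_fun_xsection _ _ _ _ _ mu E mE.
  congr (measurable_fun _ _); apply/funext => s; congr (mu _).
  by apply/seteqP; split => x; rewrite /xsection/= inE.
have int1 (F : R -> R) : (forall x, (0 <= F x <= 1)%R) -> measurable_fun setT F ->
    \int[mu]_x (F x)%:E = \int[mu]_(s in `]0%R, 1%R[) mu [set x | s%:E < (F x)%:E].
  move=> F01 mF; rewrite integral_superlevel//; first last.
  - by move=> x; rewrite lee_fin; case/andP: (F01 x).
  - exact/measurable_EFinP.
  by apply: eq_integral => x _; rewrite min_l// lee_fin; case/andP: (F01 x).
rewrite !int1// -ge0_integralD//; first last.
- by apply: msup => // x; rewrite lee_fin; case/andP: (g01 x).
- by apply: msup => // x; rewrite lee_fin; case/andP: (f01 x).
apply: (@le_trans _ _ (\int[mu]_(s in `]0%R, 1%R[) (2%:E * mu [set x | s%:E < h x]))).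
  apply: ge0_le_integral => //.
  - by move=> s _; exact: adde_ge0.
  - apply: emeasurable_funD; apply: msup => // x; rewrite lee_fin.
      by case/andP: (f01 x).
    by case/andP: (g01 x).
  - by apply: measurable_funeM; exact: msup.
  move=> s; rewrite /= in_itv/= => /andP[s0 s1].
  apply: (@lebesgue_measure_midpoint _ _ _ M).
  - by rewrite -[X in measurable X]setTI; exact: emeasurable_fun_lt.
  - by rewrite -[X in measurable X]setTI; exact: emeasurable_fun_lt.
  - by rewrite -[X in measurable X]setTI; exact: emeasurable_fun_lt.
  - by have [x sx] := f1 s s1; exists x; rewrite /= lte_fin.
  - by have [x sx] := g1 s s1; exists x; rewrite /= lte_fin.
  - by move=> x /=; rewrite lte_fin => sf; apply: contrapT => /fM fx; rewrite fx ltNge ltW in sf.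
  - by move=> x /=; rewrite lte_fin => sf; apply: contrapT => /gM fx; rewrite fx ltNge ltW in sf.
  by move=> x y /=; rewrite !lte_fin; exact: fgh.
rewrite ge0_integralZl//; last exact: msup.
rewrite lee_pmul2l ?lte_fin// integral_superlevel//.
apply: ge0_le_integral => //.
- by move=> x _; rewrite le_min h0 lee01.
- exact: measurable_mine.
- by move=> x _; rewrite ge_min lexx.
Qed.

(** Dividing f and g by their suprema reduces to the normalized case, and the arithmetic-geometric
    mean inequality turns the sum into a product. A function with supremum 0 vanishes and is treated
    apart. *)
Let prekopa_leindler1 (f g : R -> R) (h : R -> \bar R) (K M : R) :
  measurable_fun setT f -> measurable_fun setT g -> measurable_fun setT h ->
  (forall x, (0 <= f x <= K)%R) -> (forall x, (0 <= g x <= K)%R) ->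
  (forall x, 0 <= h x) ->
  (forall x, ~ `[(- M)%R, M]%classic x -> f x = 0%R) ->
  (forall x, ~ `[(- M)%R, M]%classic x -> g x = 0%R) ->
  (forall x y, (f x * g y)%:E <= h (2^-1 * (x + y))%R * h (2^-1 * (x + y))%R) ->
  \int[mu]_x (f x)%:E * \int[mu]_x (g x)%:E <= \int[mu]_x h x * \int[mu]_x h x.
Proof.
move=> mf mg mh f0K g0K h0 fM gM fgh.
have [f0 fK] : (forall x, (0 <= f x)%R) /\ (forall x, (f x <= K)%R).
  by split => x; case/andP: (f0K x).
have [g0 gK] : (forall x, (0 <= g x)%R) /\ (forall x, (g x <= K)%R).
  by split => x; case/andP: (g0K x).
have Hsup (u : R -> R) : (forall x, (0 <= u x)%R) -> (forall x, (u x <= K)%R) ->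
  [\/ u = cst 0%R | exists2 a : R, (0 < a)%R & (forall x, (u x <= a)%R) /\
                     (forall s, (s < a)%R -> exists x, (s < u x)%R)].
  move=> u0 uK; have hu : has_sup (range u).
    by split; [exists (u 0%R); exists 0%R|exists K => _ [x _ <-]].
  have ub x : (u x <= sup (range u))%R by apply: ub_le_sup; [case: hu|exists x].
  have [sup0|sup0] := leP (sup (range u)) 0%R.
    left; apply/funext => x; apply/eqP; rewrite eq_le u0 andbT.
    exact: le_trans (ub x) sup0.
  right; exists (sup (range u)) => //; split => // s ssup.
  have e0 : (0 < sup (range u) - s)%R by rewrite subr_gt0.
  have [_ [x _ <-]] := sup_adherent e0 hu.
  by rewrite subKr => ?; exists x.
have HH : 0 <= \int[mu]_x h x * \int[mu]_x h x by rewrite mule_ge0//; exact: integral_ge0.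
have [f00|[a a0 [fa fsup]]] := Hsup f f0 fK.
  by rewrite f00 (_ : \int[mu]_x _ = 0) ?mul0e//; exact: integral0.
have [g00|[b b0 [gb gsup]]] := Hsup g g0 gK.
  by rewrite g00 [X in _ * X](_ : _ = 0) ?mule0//; exact: integral0.
(* Dividing f by a, g by b and h by c = sqrt (a b) preserves the hypothesis f g <= h^2. *)
pose c := Num.sqrt (a * b)%R.
have ab0 : (0 < a * b)%R by exact: mulr_gt0.
have c0 : (0 < c)%R by rewrite sqrtr_gt0.
have cc : (c * c = a * b)%R by rewrite -expr2 sqr_sqrtr// ltW.
have := @prekopa_leindler1_norm (fun x => a^-1 * f x)%R (fun x => b^-1 * g x)%R
  (fun x => c^-1%:E * h x) M.
have intZ (k : R) (u : R -> R) : (0 < k)%R -> measurable_fun setT u -> (forall x, (0 <= u x)%R) ->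
    \int[mu]_x (k^-1 * u x)%:E = k^-1%:E * \int[mu]_x (u x)%:E.
  move=> k0 mu' u0; rewrite -ge0_integralZl//.
  - exact/measurable_EFinP.
  - by move=> x _; rewrite lee_fin.
  - by rewrite lee_fin invr_ge0 ltW.
rewrite !intZ// ge0_integralZl//; last by rewrite lee_fin invr_ge0 ltW.
move=> H.
have {H} : a^-1%:E * \int[mu]_x (f x)%:E + b^-1%:E * \int[mu]_x (g x)%:E <= 2%:E * (c^-1%:E * \int[mu]_x h x).
  apply: H.
  - exact: measurable_funM.
  - exact: measurable_funM.
  - exact: measurable_funeM.
  - by move=> x; rewrite mulr_ge0 ?invr_ge0 ?(ltW a0)//= mulrC ler_pdivrMr// mul1r.
  - by move=> x; rewrite mulr_ge0 ?invr_ge0 ?(ltW b0)//= mulrC ler_pdivrMr// mul1r.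
  - by move=> x; rewrite mule_ge0// lee_fin invr_ge0 ltW.
  - by move=> x /fM ->; rewrite mulr0.
  - by move=> x /gM ->; rewrite mulr0.
  - move=> s s1; have [|x sx] := fsup (a * s)%R; first by rewrite gtr_pMr.
    by exists x; rewrite mulrC ltr_pdivlMr// mulrC.
  - move=> s s1; have [|x sx] := gsup (b * s)%R; first by rewrite gtr_pMr.
    by exists x; rewrite mulrC ltr_pdivlMr// mulrC.
  move=> s x y s0; rewrite mulrC ltr_pdivlMr// => sf; rewrite mulrC ltr_pdivlMr// => sg.
  have := fgh x y; have := h0 (2^-1 * (x + y))%R; case: (h _) => [r| |]//; last first.
    by move=> _ _; rewrite gt0_muley ?ltry// lte_fin invr_gt0.
  rewrite -!EFinM !(lee_fin, lte_fin) => r0 fgr.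
  rewrite mulrC ltr_pdivlMr//.
  have : (s * c * (s * c) < r * r)%R.
    apply: lt_le_trans fgr; rewrite mulrACA cc mulrACA.
    by apply: ltr_pM => //; rewrite ltW// mulr_gt0.
  by rewrite -!expr2 ltr_pXn2r// nnegrE// ltW// mulr_gt0.
have : 0 <= \int[mu]_x h x by exact: integral_ge0.
have If (u : R -> R) : measurable_fun setT u -> (forall x, (0 <= u x)%R) -> (forall x, (u x <= K)%R) ->
   (forall x, ~ `[(- M)%R, M]%classic x -> u x = 0%R) -> exists2 F : R, \int[mu]_x (u x)%:E = F%:E & (0 <= F)%R.
  move=> mu' u0 uK uM.
  have I0 : 0 <= \int[mu]_x (u x)%:E by apply: integral_ge0 => x _; rewrite lee_fin.
  have : \int[mu]_x (u x)%:E < +oo.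
    rewrite (_ : \int[mu]_x (u x)%:E = \int[mu]_(x in `[(- M)%R, M]) (u x)%:E); last first.
      rewrite [RHS]integral_mkcond; apply: eq_integral => x _; rewrite patchE; case: ifPn => //.
      by rewrite notin_setE => /uM ->.
    apply: (@le_lt_trans _ _ (\int[mu]_(x in `[(- M)%R, M]) (cst K%:E) x)).
      apply: ge0_le_integral => //.
      - by move=> x _; rewrite lee_fin.
      - by apply/measurable_EFinP; exact: measurable_funTS.
      - by move=> x _; rewrite lee_fin.
    rewrite integral_cst//; apply: lte_mul_pinfty => //.
      by rewrite lee_fin; exact: le_trans (u0 0%R) (uK 0%R).
    apply: (@le_lt_trans _ _ (lebesgue_measure `[(- M)%R, M]%classic)) => //.
    by rewrite lebesgue_measure_itv/=; case: ifP => _; rewrite ?ltry// -EFinD ltry.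
  move: I0; case: (\int[mu]_x (u x)%:E) => [r| |]//; rewrite lee_fin => r0 _.
  by exists r.
have [F -> F0] := If f mf f0 fK fM.
have [G -> G0] := If g mg g0 gK gM.
case: (\int[mu]_x h x) => [H| |]//; last by move=> _ _; rewrite mulyy leey.
rewrite -!EFinM -EFinD !lee_fin => H0.
rewrite -(ler_pM2l c0) [X in (_ <= X)%R -> _](_ : _ = 2 * H)%R; last by field; rewrite gt_eqF.
move=> HH'.
rewrite -[(F * G)%R](_ : (c * c * (a^-1 * F * (b^-1 * G)) = F * G)%R); last first.
  by rewrite cc; field; rewrite !gt_eqF.
have P0 : (0 <= c * (a^-1 * F))%R by rewrite !mulr_ge0// ?invr_ge0 ltW.
have Q0 : (0 <= c * (b^-1 * G))%R by rewrite !mulr_ge0// ?invr_ge0 ltW.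
move: HH' P0 Q0; rewrite mulrDr mulrACA.
move: (c * (a^-1 * F))%R (c * (b^-1 * G))%R => P Q HH' P0 Q0.
(* 4 P Q <= (P + Q)^2 <= (2 H)^2. *)
have : (0 <= (P - Q) ^+ 2)%R by exact: sqr_ge0.
have : ((P + Q) ^+ 2 <= (2 * H) ^+ 2)%R by rewrite lerXn2r// ?nnegrE ?addr_ge0// mulr_ge0.
by nra.
Qed.

(* One-dimensional marginals of f, g and h satisfy the same hypothesis by
   induction, which reduces the statement to dimension one. *)
Lemma prekopa_leindler n (f g : 'rV[R]_n -> R) (h : 'rV[R]_n -> \bar R) (K M : R) :
  (0 < M)%R ->
  measurable_fun setT f -> measurable_fun setT g -> measurable_fun setT h ->
  (forall x, (0 <= f x <= K)%R) -> (forall x, (0 <= g x <= K)%R) ->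
  (forall x, 0 <= h x) ->
  (forall x, ~ ball 0%R M x -> f x = 0%R) ->
  (forall x, ~ ball 0%R M x -> g x = 0%R) ->
  (forall x y, (f x * g y)%:E <= h (2^-1 *: (x + y))%R * h (2^-1 *: (x + y))%R) ->
  \int[lebesgue_rV n]_x (f x)%:E * \int[lebesgue_rV n]_x (g x)%:E <=
  \int[lebesgue_rV n]_x h x * \int[lebesgue_rV n]_x h x.
Proof.
move=> M0.
elim: n f g h => [|n IHn] f g h mf mg mh f0K g0K h0 fM gM fgh.
  rewrite /= !integral_dirac//; first last.
  - exact/measurable_EFinP.
  - exact/measurable_EFinP.
  rewrite !diracT !mul1e; apply: le_trans (fgh 0%R 0%R) _.
  by rewrite addr0 scaler0.
have B0 (u : 'rV[R]_n.+1 -> R) a : (forall x, ~ ball 0%R M x -> u x = 0%R) ->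
    (forall x, ~ ball 0%R M x -> u (rV_cons (a, x)) = 0%R).
  move=> uM x Mx; apply: uM => -[_ h']; apply: Mx; split => // i j.
  by have := h' i (lift ord0 j); rewrite [i]ord1 rV_consS !mxE.
have B1 (u : 'rV[R]_n.+1 -> R) a : (forall x, ~ ball 0%R M x -> u x = 0%R) ->
    ~ `[(- M)%R, M]%classic a -> (forall x, u (rV_cons (a, x)) = 0%R).
  move=> uM Ma x; apply: uM => -[_ h']; apply: Ma.
  have := h' ord0 ord0; rewrite rV_cons0 mxE /ball/= sub0r normrN => /ltW.
  by rewrite in_itv/= ler_norml.
pose I (u : 'rV[R]_n.+1 -> R) a := \int[lebesgue_rV n]_x (u (rV_cons (a, x)))%:E.
pose adm (u : 'rV[R]_n.+1 -> R) := [/\ measurable_fun setT u,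
  forall x, (0 <= u x <= K)%R & forall x, ~ ball 0%R M x -> u x = 0%R].
have af : adm f by [].
have ag : adm g by [].
(* The one-dimensional statement takes real-valued f and g with a uniform bound; for the marginals
   this bound is K (2 M)^n. The marginal of h may be infinite. *)
have IK u a : adm u -> 0 <= I u a <= (K * ((M *+ 2) ^+ n))%:E.
  move=> [mu' u0K uM]; apply/andP; split.
    by apply: integral_ge0 => x _; rewrite lee_fin; case/andP: (u0K (rV_cons (a, x))).
  rewrite /I (_ : \int[_]_x _ = \int[lebesgue_rV n]_(x in ball 0%R M) (u (rV_cons (a, x)))%:E); last first.
    rewrite [RHS]integral_mkcond; apply: eq_integral => x _; rewrite patchE; case: ifPn => //.
    by rewrite notin_setE => /(B0 u a uM) ->.
  have mB := @measurable_ball_rV R n 0%R M.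
  rewrite EFinM -(lebesgue_rV_ball 0%R M0) -integral_cst//.
  apply: ge0_le_integral => //.
  - by move=> x _; rewrite lee_fin; case/andP: (u0K (rV_cons (a, x))).
  - apply: measurable_funTS; apply/measurable_EFinP.
    by apply: measurableT_comp => //; exact: measurable_rV_cons_curry.
  - by move=> x _; rewrite lee_fin; case/andP: (u0K (rV_cons (a, x))).
pose J u a := fine (I u a).
have JE u (a : R) : adm u -> (J u a)%:E = I u a.
  move=> /(IK u a)/andP[I0 I1]; rewrite fineK// fin_numElt.
  by rewrite (lt_le_trans _ I0)// (le_lt_trans I1)// ltry.
have JK u (a : R) : adm u -> (0 <= J u a <= K * ((M *+ 2) ^+ n))%R.
  by move=> au; rewrite -!lee_fin JE//; exact: IK.
have mI u : adm u -> measurable_fun setT (I u).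
  move=> [mu' u0K _]; apply: (@measurable_integral_rV_cons _ _ (EFin \o u)).
    exact/measurable_EFinP.
  by move=> x; rewrite lee_fin; case/andP: (u0K x).
have IJ u : adm u -> \int[lebesgue_rV n.+1]_x (u x)%:E = \int[mu]_a (J u a)%:E.
  move=> au; have [mu' u0K _] := au.
  have mu2 : measurable_fun setT (EFin \o u) by exact/measurable_EFinP.
  have u0 x : 0 <= (EFin \o u) x by rewrite lee_fin; case/andP: (u0K x).
  by rewrite (integral_rVS mu2 u0); apply: eq_integral => a _; rewrite JE.
rewrite (IJ f af) (IJ g ag) (integral_rVS mh h0).
apply: (@prekopa_leindler1 _ _ _ (K * ((M *+ 2) ^+ n))%R M).
- by apply: measurableT_comp; [exact: fine_measurable|exact: mI].
- by apply: measurableT_comp; [exact: fine_measurable|exact: mI].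
- exact: measurable_integral_rV_cons.
- by move=> a; exact: JK.
- by move=> a; exact: JK.
- by move=> a; exact: integral_ge0.
- by move=> a /(B1 f a fM) fa; rewrite /J /I; under eq_integral do rewrite fa; rewrite integral0.
- by move=> a /(B1 g a gM) fa; rewrite /J /I; under eq_integral do rewrite fa; rewrite integral0.
move=> a b; rewrite EFinM !JE//.
apply: IHn.
- by apply: measurableT_comp => //; exact: measurable_rV_cons_curry.
- by apply: measurableT_comp => //; exact: measurable_rV_cons_curry.
- by apply: measurableT_comp => //; exact: measurable_rV_cons_curry.
- by [].
- by [].
- by [].
- exact: B0.
- exact: B0.
move=> x y; have := fgh (rV_cons (a, x)) (rV_cons (b, y)).
rewrite (_ : 2^-1 *: (rV_cons (a, x) + rV_cons (b, y)) = rV_cons ((2^-1 * (a + b))%R, (2^-1 *: (x + y))%R))%R//.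
by apply/rowP => j; rewrite /rV_cons !mxE; case: unliftP => [i|] _ /=; rewrite ?mxE.
Qed.

End prekopa_leindler.

(** * A dimension-free Poincare inequality *)

Section bounded_measurable.
Context d (T : measurableType d) (R : realType) (mu : {measure set T -> \bar R}).
Implicit Types (D : set T) (f g : T -> R).

Lemma EFin_Rintegral D f : measurable D -> mu.-integrable D (EFin \o f) ->
  (\int[mu]_(x in D) f x)%:E = (\int[mu]_(x in D) (f x)%:E)%E.
Proof. by move=> mD fi; rewrite fineK//; exact: integrable_fin_num. Qed.

Definition bounded_mfun D f :=
  measurable_fun D f /\ exists B : R, forall x, D x -> `|f x| <= B.

Lemma bounded_mfun_integrable D f : measurable D -> (mu D < +oo)%E ->
  bounded_mfun D f -> mu.-integrable D (EFin \o f).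
Proof.
move=> mD Doo [mf [B fB]]; apply: measurable_bounded_integrable => //.
exists B; split; first exact: num_real.
by move=> M BM x Dx /=; rewrite (le_trans (fB x Dx))// ltW.
Qed.

Lemma bounded_mfun_cst D c : bounded_mfun D (cst c).
Proof. by split => //; exists `|c|. Qed.

Lemma bounded_mfunD D f g : bounded_mfun D f -> bounded_mfun D g ->
  bounded_mfun D (fun x => f x + g x).
Proof.
move=> [mf [B fB]] [mg [C gC]]; split; first exact: measurable_funD.
exists (B + C) => x Dx; rewrite (le_trans (ler_normD _ _))//.
by rewrite lerD ?fB ?gC.
Qed.

Lemma bounded_mfunM D f g : bounded_mfun D f -> bounded_mfun D g ->
  bounded_mfun D (fun x => f x * g x).
Proof.
move=> [mf [B fB]] [mg [C gC]]; split; first exact: measurable_funM.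
by exists (B * C) => x Dx; rewrite normrM ler_pM ?fB ?gC.
Qed.

Lemma bounded_mfunZ D c f : bounded_mfun D f -> bounded_mfun D (fun x => c * f x).
Proof. by apply: bounded_mfunM; exact: bounded_mfun_cst. Qed.

Lemma bounded_mfunN D f : bounded_mfun D f -> bounded_mfun D (fun x => - f x).
Proof.
move=> /(bounded_mfunZ (-1)); congr (bounded_mfun _ _).
by apply/funext => x; rewrite mulN1r.
Qed.

Lemma bounded_mfunB D f g : bounded_mfun D f -> bounded_mfun D g ->
  bounded_mfun D (fun x => f x - g x).
Proof. by move=> bf /bounded_mfunN; exact: bounded_mfunD. Qed.

Lemma bounded_mfunX D f k : bounded_mfun D f -> bounded_mfun D (fun x => f x ^+ k).
Proof.
move=> bf; elim: k => [|k IHk]; first exact: bounded_mfun_cst.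
have := bounded_mfunM bf IHk; congr (bounded_mfun _ _).
by apply/funext => x; rewrite exprS.
Qed.

Lemma bounded_mfun_sum D (I : Type) (s : seq I) (F : I -> T -> R) :
  (forall i, bounded_mfun D (F i)) -> bounded_mfun D (fun x => \sum_(i <- s) F i x).
Proof.
move=> bF; elim: s => [|i s IHs].
  by under [X in bounded_mfun _ X]funext do rewrite big_nil; exact: bounded_mfun_cst.
by under [X in bounded_mfun _ X]funext do rewrite big_cons; exact: bounded_mfunD.
Qed.

Lemma bounded_mfun_expR D f : bounded_mfun D f -> bounded_mfun D (fun x => expR (f x)).
Proof.
move=> [mf [B fB]]; split; first exact: measurableT_comp.
exists (expR B) => x Dx; rewrite ger0_norm ?expR_ge0// ler_expR.
by rewrite (le_trans (ler_norm _))// fB.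
Qed.

End bounded_measurable.

(** Squaring exp (t/2) >= 1 + t/2, whose right-hand side is nonnegative here. The term t^2/4 is the
    source of the variance in [poincare_taylor]. *)
Lemma expR_ge_sqr (R : realType) (t : R) : `|t| <= 1 -> (1 + t / 2) ^+ 2 <= expR t.
Proof.
rewrite ler_norml => /andP[t1 t2].
rewrite (_ : expR t = expR (t / 2) ^+ 2); last by rewrite expr2 -expRD -splitr.
rewrite ler_pXn2r ?nnegrE ?expR_ge0// ?expR_ge1Dx//; lra.
Qed.

Lemma mulr_le_contra (R : realDomainType) (p x y : R) :
  0 < p -> p < x -> p <= y -> ~ x * y <= p * p.
Proof.
by move=> p0 px py; apply/negP; rewrite -ltNge; nra.
Qed.

Section sqnorm.
Variable R : realType.

Definition sqn n (x : 'rV[R]_n) : R := \sum_(i < n) x ord0 i ^+ 2.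

Lemma sqn_ge0 n (x : 'rV[R]_n) : 0 <= sqn x.
Proof. by apply: sumr_ge0 => i _; exact: sqr_ge0. Qed.

Lemma sqnN n (x : 'rV[R]_n) : sqn (- x) = sqn x.
Proof. by apply: eq_bigr => i _; rewrite mxE sqrrN. Qed.

Lemma sqn_sub_sym n (x y : 'rV[R]_n) : sqn (x - y) = sqn (y - x).
Proof. by rewrite -sqnN opprB. Qed.

Lemma sqn0 n : sqn (0 : 'rV[R]_n) = 0.
Proof. by rewrite /sqn big1// => i _; rewrite mxE expr0n. Qed.

Lemma sqnZ n (a : R) (x : 'rV[R]_n) : sqn (a *: x) = a ^+ 2 * sqn x.
Proof. by rewrite /sqn mulr_sumr; apply: eq_bigr => i _; rewrite mxE exprMn. Qed.

Lemma ler_sqn n (x : 'rV[R]_n) i : x ord0 i ^+ 2 <= sqn x.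
Proof.
rewrite /sqn (bigD1 i)//= lerDl; apply: sumr_ge0 => j _; exact: sqr_ge0.
Qed.

(** Parallelogram identity. The defect |x - y|^2/4 serves as the strong log-concavity of the
    Gaussian weight, and later locates the midpoint of a closest pair. *)
Lemma sqn_midpoint n (x y z : 'rV[R]_n) :
  sqn (2^-1 *: (x + y) - z) = (sqn (x - z) + sqn (y - z)) / 2 - sqn (x - y) / 4.
Proof.
rewrite /sqn -big_split/= !mulr_suml -sumrB; apply: eq_bigr => i _.
by rewrite !mxE; field.
Qed.

Lemma measurable_sqn n (z : 'rV[R]_n) : measurable_fun [set: 'rV[R]_n] (fun x => sqn (x - z)).
Proof.
rewrite /sqn; apply: measurable_sum => i; apply: measurable_funX.
rewrite (_ : (fun x => _) = fun x : 'rV[R]_n => x ord0 i - z ord0 i); last first.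
  by apply/funext => x; rewrite !mxE.
by apply: measurable_funB => //; exact: measurable_coord_rV.
Qed.

End sqnorm.

(* Prekopa-Leindler, applied to exp(eps f - 2 D^2 eps^2 |G|^2), exp(- eps f) and
   1 with respect to a Gaussian weight of variance D^2, which is bounded below
   on a set of diameter D. *)
Lemma poincare_taylor (R : realType) n (V : set 'rV[R]_n) (D M : R)
    (f : 'rV[R]_n -> R) (G : 'I_n -> 'rV[R]_n -> R) :
  measurable V -> bounded_set V -> (0 < lebesgue_rV n V)%E ->
  (forall x y, V x -> V y -> V (2^-1 *: (x + y))) ->
  0 < D -> (forall x y, V x -> V y -> sqn (x - y) <= D ^+ 2) ->
  bounded_mfun V f -> (forall i, bounded_mfun V (G i)) ->
  (forall x y, V x -> V y ->
    f x + \sum_i G i x * (y - x) ord0 i - M * sqn (y - x) <= f y) ->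
  exists c : R, \int[lebesgue_rV n]_(x in V) ((f x - c) ^+ 2) <=
    8 * expR 1 ^+ 2 * D ^+ 2 * \int[lebesgue_rV n]_(x in V) (\sum_i G i x ^+ 2).
Proof.
move=> mV /[dup] bV /bounded_set_ball[M0 M00 VM0] V0 Vmid D0 VD bf bG fT.
have Voo : (lebesgue_rV n V < +oo)%E by exact: bounded_lebesgue_rV_lty.
have [x0 Vx0] : V !=set0.
  by apply/set0P; apply: contraL V0 => /eqP ->; rewrite measure0 ltxx.
pose I (u : 'rV[R]_n -> R) := \int[lebesgue_rV n]_(x in V) u x.
have bint u : bounded_mfun V u -> (lebesgue_rV n).-integrable V (EFin \o u).
  exact: bounded_mfun_integrable.
have ID u v : bounded_mfun V u -> bounded_mfun V v -> I (fun x => u x + v x) = I u + I v.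
  by move=> bu bv; rewrite /I RintegralD//; exact: bint.
have IZ c u : bounded_mfun V u -> I (fun x => c * u x) = c * I u.
  by move=> bu; rewrite /I RintegralZl//; exact: bint.
have Ile u v : bounded_mfun V u -> bounded_mfun V v -> (forall x, V x -> u x <= v x) -> I u <= I v.
  by move=> bu bv uv; apply: le_Rintegral => //; exact: bint.
pose w (x : 'rV[R]_n) := expR (- (sqn (x - x0) / (2 * D ^+ 2))).
have D20 : 0 < 2 * D ^+ 2 by rewrite mulr_gt0 ?exprn_gt0.
have sD x : V x -> 0 <= sqn (x - x0) / (2 * D ^+ 2) <= 1.
  move=> Vx; rewrite divr_ge0 ?sqn_ge0 ?(ltW D20)//= ler_pdivrMr// mul1r.
  by rewrite (le_trans (VD _ _ Vx Vx0))// ler_peMl ?sqr_ge0// ler1n.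
have bw : bounded_mfun V w.
  apply: bounded_mfun_expR; split.
    apply: measurable_funTS; apply: measurable_funN; apply: measurable_funM => //.
    exact: measurable_sqn.
  by exists 1 => x /sD/andP[s0 s1]; rewrite normrN ger0_norm.
have w0 x : 0 < w x by exact: expR_gt0.
have w1 x : V x -> w x <= 1.
  by move=> /sD/andP[s0 s1]; rewrite /w -[leRHS]expR0 ler_expR oppr_le0.
have we x : V x -> expR (-1) <= w x.
  by move=> /sD/andP[s0 s1]; rewrite /w ler_expR lerN2.
pose P := I w.
have P0 : 0 < P.
  apply: (@lt_le_trans _ _ (I (cst (expR (-1))))).
    rewrite /I Rintegral_cst//= mulr_gt0 ?expR_gt0//.
    by rewrite fine_gt0// V0.
  by apply: Ile => //; exact: bounded_mfun_cst.
pose c := I (fun x => f x * w x) / P.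
pose g x := f x - c.
have bg : bounded_mfun V g by apply: bounded_mfunB => //; exact: bounded_mfun_cst.
have Ig0 : I (fun x => g x * w x) = 0.
  rewrite (_ : (fun x => _) = fun x => f x * w x + (- c) * w x); last first.
    by apply/funext => x; rewrite /g mulrBl mulNr.
  rewrite ID; last 2 first.
  - exact: bounded_mfunM.
  - exact: bounded_mfunZ.
  by rewrite IZ// -/P /c mulNr divfK ?gt_eqF// subrr.
have gT x y : V x -> V y ->
    g x - g y <= - \sum_i G i x * (y - x) ord0 i + M * sqn (y - x).
  by move=> Vx Vy; have := fT x y Vx Vy; rewrite /g; lra.
exists c; rewrite -/(I _).
pose S x := \sum_i G i x ^+ 2.
have bS : bounded_mfun V S by apply: bounded_mfun_sum => i; exact: bounded_mfunX.
have S0 x : 0 <= S x by apply: sumr_ge0 => i _; exact: sqr_ge0.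
rewrite -/(I _) -/S.
pose A := I (fun x => g x ^+ 2 * w x); pose B := I (fun x => S x * w x).
have bgw : bounded_mfun V (fun x => g x ^+ 2 * w x).
  by apply: bounded_mfunM => //; exact: bounded_mfunX.
have bSw : bounded_mfun V (fun x => S x * w x) by exact: bounded_mfunM.
have A0 : 0 <= A by apply: Rintegral_ge0 => x _; rewrite mulr_ge0 ?sqr_ge0// ltW.
have B0 : 0 <= B by apply: Rintegral_ge0 => x _; rewrite mulr_ge0// ltW.
(* Removing the weight, which lies between 1/e and 1, costs one of the two factors e of the
   constant; the other one comes from the bound exp (e g) <= exp 1 below. *)
suff AB : A <= 8 * expR 1 * D ^+ 2 * B.
  have e10 : 0 < expR (1 : R) by exact: expR_gt0.
  apply: (@le_trans _ _ (expR 1 * A)).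
    rewrite /A -IZ//; apply: Ile.
    - exact: bounded_mfunX.
    - exact: bounded_mfunZ.
    move=> x Vx; rewrite mulrCA ler_peMr ?sqr_ge0//.
    have := we x Vx; rewrite expRN -div1r ler_pdivrMr//; lra.
  have BS : B <= I S.
    apply: Ile => // x Vx.
    by rewrite ler_piMr// w1.
  rewrite (le_trans (ler_wpM2l (ltW e10) AB))// expr2.
  rewrite (_ : expR 1 * (8 * expR 1 * D ^+ 2 * B) = 8 * (expR 1 * expR 1) * D ^+ 2 * B); last by ring.
  by rewrite ler_wpM2l// !mulr_ge0// ?sqr_ge0// ltW.
(* If the weighted inequality failed, then for a small scale [e] the integrals of [u] and [v] would
   be at least [P], the first one strictly, against Prekopa-Leindler. *)
rewrite leNgt; apply/negP => AB.
have [mg [Bg gB]] := bg.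
have Bg0 : 0 <= Bg by exact: le_trans (gB x0 Vx0).
(* Small enough for both |e g| <= 1, as the lower bound of the exponential requires, and 8 D^2 e M
   <= 1, which absorbs the Taylor remainder. *)
pose e := (Bg + 8 * D ^+ 2 * `|M| + 1)^-1.
have Z0 : 0 <= 8 * D ^+ 2 * `|M| by rewrite !mulr_ge0 ?(ltW D0).
have e0 : 0 < e by rewrite invr_gt0; lra.
have eE : e * (Bg + 8 * D ^+ 2 * `|M| + 1) = 1 by rewrite mulVf// gt_eqF//; lra.
have eg x : V x -> `|e * g x| <= 1.
  move=> Vx; rewrite normrM gtr0_norm// (le_trans (ler_wpM2l (ltW e0) (gB x Vx)))//.
  by rewrite -[leRHS]eE ler_pM2l//; lra.
have eM : 8 * D ^+ 2 * (e * M) <= 1.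
  rewrite -[leRHS]eE (_ : 8 * D ^+ 2 * (e * M) = e * (8 * D ^+ 2 * M)); last by ring.
  rewrite ler_pM2l//.
  have : 8 * D ^+ 2 * M <= 8 * D ^+ 2 * `|M| by rewrite ler_wpM2l ?ler_norm// mulr_ge0// sqr_ge0.
  by lra.
pose u x := expR (e * g x - 2 * D ^+ 2 * e ^+ 2 * S x) * w x.
pose v x := expR (- (e * g x)) * w x.
have bu : bounded_mfun V u.
  apply: bounded_mfunM => //; apply: bounded_mfun_expR; apply: bounded_mfunB; exact: bounded_mfunZ.
have bv : bounded_mfun V v.
  by apply: bounded_mfunM => //; apply: bounded_mfun_expR; apply: bounded_mfunN; exact: bounded_mfunZ.
(* The weight gains |x - y|^2/(4 D^2) at the midpoint. One half of it absorbs the remainder e M |y -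
   x|^2; the other half, with the term 2 D^2 e^2 |G|^2 of [u], completes the square of y - x + 4 D^2
   e G(x). *)
have uvw x y : V x -> V y -> u x * v y <= w (2^-1 *: (x + y)) * w (2^-1 *: (x + y)).
  move=> Vx Vy; rewrite /u /v /w -!expRD ler_expR sqn_midpoint.
  have := gT x y Vx Vy.
  rewrite [sqn (x - y)]sqn_sub_sym.
  have : 0 <= \sum_i ((y - x) ord0 i + 4 * D ^+ 2 * e * G i x) ^+ 2.
    by apply: sumr_ge0 => i _; exact: sqr_ge0.
  rewrite (_ : \sum_i _ = sqn (y - x) + 8 * D ^+ 2 * e * (\sum_i G i x * (y - x) ord0 i) + 16 * (D ^+ 2) ^+ 2 * e ^+ 2 * S x); last first.
    rewrite /sqn /S !mulr_sumr -!big_split/=; apply: eq_bigr => i _; ring.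
  move: (sqn_ge0 (y - x)) (\sum_i _) (S x) eM.
  move: (sqn (y - x)) (sqn (x - x0)) (sqn (y - x0)) (g x) (g y) => a p q gx gy a0 s3 s2 eM h1 h2.
  have T0 : 0 < D ^+ 2 by rewrite exprn_gt0.
  move: (D ^+ 2) T0 eM h1 => T T0 eM h1.
  rewrite -subr_ge0 -(pmulr_rge0 _ (_ : 0 < 8 * T)) ?mulr_gt0//.
  have h3 : 0 <= 8 * T * e * (- s3 + M * a - (gx - gy)).
    by rewrite mulr_ge0 ?subr_ge0// !mulr_ge0// ltW.
  have h4 : 0 <= (1 - 8 * T * (e * M)) * a by rewrite mulr_ge0// subr_ge0.
  rewrite [leRHS](_ : _ = (a + 8 * T * e * s3 + 16 * T ^+ 2 * e ^+ 2 * s2) +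
     8 * T * e * (- s3 + M * a - (gx - gy)) + (1 - 8 * T * (e * M)) * a).
    by apply: addr_ge0 => //; exact: addr_ge0.
  by field; rewrite gt_eqF.
have PL : I u * I v <= P * P.
  have res (h : 'rV[R]_n -> R) : bounded_mfun V h ->
     (\int[lebesgue_rV n]_x ((h \_ V) x)%:E = (I h)%:E)%E.
    move=> bh; rewrite /I EFin_Rintegral//; last exact: bint.
    rewrite [RHS]integral_mkcond; apply: eq_integral => x _.
    by rewrite !patchE; case: ifP.
  have mres (h : 'rV[R]_n -> R) : bounded_mfun V h -> measurable_fun setT (h \_ V).
    by move=> [mh _]; exact/(measurable_restrictT _ mV).
  have [mu' [Bu uB]] := bu; have [mv' [Bv vB]] := bv.
  have u0 x : 0 <= u x by rewrite mulr_ge0 ?expR_ge0.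
  have v0 x : 0 <= v x by rewrite mulr_ge0 ?expR_ge0.
  have pt : (point : R) = 0 by [].
  have := @prekopa_leindler R n (u \_ V) (v \_ V) (EFin \o (w \_ V)) (Num.max Bu Bv) M0 M00
    (mres _ bu) (mres _ bv).
  rewrite !res// -!EFinM lee_fin; apply.
  - by apply/measurable_EFinP; exact: mres.
  - move=> x; rewrite patchE; case: ifPn => [/set_mem Vx|_].
      by rewrite u0 le_max -[u x]ger0_norm// uB.
    by rewrite pt lexx le_max (le_trans _ (uB _ Vx0)).
  - move=> x; rewrite patchE; case: ifPn => [/set_mem Vx|_].
      by rewrite v0 le_max -[v x]ger0_norm// vB// orbT.
    by rewrite pt lexx le_max (le_trans _ (uB _ Vx0)).
  - by move=> x; rewrite lee_fin patchE; case: ifP => // _; rewrite ltW.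
  - by move=> x; rewrite patchE; case: ifPn => // /set_mem /VM0.
  - by move=> x; rewrite patchE; case: ifPn => // /set_mem /VM0.
  move=> x y; rewrite lee_fin !patchE.
  case: ifPn => [/set_mem Vx|_]; last by rewrite pt mul0r mulr_ge0//; case: ifP => // _; rewrite ltW.
  case: ifPn => [/set_mem Vy|_]; last by rewrite pt mulr0 mulr_ge0//; case: ifP => // _; rewrite ltW.
  by rewrite mem_set; [exact: uvw|exact: Vmid].
have bgw1 : bounded_mfun V (fun x => g x * w x) by exact: bounded_mfunM.
(* Expansion to second order in [e]; the first-order term vanishes since g has weighted mean 0. The
   bracket is positive exactly when A > 8 exp(1) D^2 B. *)
have Iu : P + e ^+ 2 * (A / 4 - 2 * expR 1 * D ^+ 2 * B) <= I u.
  rewrite [leLHS](_ : _ = I (fun x => w x + (e * (g x * w x) + (e ^+ 2 / 4 * (g x ^+ 2 * w x) + (- (e ^+ 2 * (2 * expR 1 * D ^+ 2))) * (S x * w x))))); last first.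
    rewrite !ID ?IZ//; do ?[exact: bounded_mfunZ | apply: bounded_mfunD].
    by rewrite -/P -/A -/B Ig0; field.
  apply: Ile => //; first by do ?[exact: bounded_mfunZ | apply: bounded_mfunD].
  move=> x Vx; rewrite /u [leLHS](_ : _ = ((1 + (e * g x) / 2) ^+ 2 - (2 * D ^+ 2 * e ^+ 2 * S x) * expR 1) * w x); last by field.
  rewrite ler_pM2r// expRD.
  have q0 : 0 <= 2 * D ^+ 2 * e ^+ 2 * S x by rewrite !mulr_ge0 ?(ltW D0) ?(ltW e0).
  have := expR_ge_sqr (eg x Vx).
  have : expR (e * g x) <= expR 1 by rewrite ler_expR (le_trans (ler_norm _))// eg.
  have := expR_ge1Dx (- (2 * D ^+ 2 * e ^+ 2 * S x)).
  have := expR_gt0 (e * g x).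
  move: (2 * D ^+ 2 * e ^+ 2 * S x) q0 (expR (e * g x)) => q q0 E E0 h1 h2 h3.
  have h4 : E * (1 - q) <= E * expR (- q) by rewrite ler_pM2l.
  have h5 : q * E <= q * expR 1 by rewrite ler_wpM2l.
  clear -h1 h2 h3 h4 h5; move: h4; rewrite mulrBr mulr1; lra.
have Iv : P + e ^+ 2 * (A / 4) <= I v.
  rewrite [leLHS](_ : _ = I (fun x => w x + (- e * (g x * w x) + (e ^+ 2 / 4 * (g x ^+ 2 * w x))))); last first.
    rewrite !ID ?IZ//; do ?[exact: bounded_mfunZ | apply: bounded_mfunD].
    by rewrite -/P -/A -/B Ig0; field.
  apply: Ile => //; first by do ?[exact: bounded_mfunZ | apply: bounded_mfunD].
  move=> x Vx; rewrite /v [leLHS](_ : _ = (1 + (- (e * g x)) / 2) ^+ 2 * w x); last by field.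
  by rewrite ler_pM2r// expR_ge_sqr// normrN eg.
have e20 : 0 < e ^+ 2 by rewrite exprn_gt0.
have k1 : P < I u.
  by apply: lt_le_trans Iu; rewrite ltrDl mulr_gt0//; clear -AB; lra.
have k2 : P <= I v.
  apply: le_trans Iv; rewrite lerDl; apply: mulr_ge0; first exact: ltW.
  exact: divr_ge0.
exact: (mulr_le_contra P0 k1 k2 PL).
Qed.

(** * Spectral theorem for a pair of quadratic forms *)

(** Supplies a nontrivial combination of M vectors subject to m < M linear conditions: orthogonality
    to the eigenvectors already found, or zero integral over each cell. *)
Lemma left_kernel_neq0 (F : fieldType) (M m : nat) (A : 'M[F]_(M, m)) : (m < M)%N ->
  exists2 c : 'rV[F]_M, c != 0 & c *m A = 0.
Proof.
move=> mM; have kA : kermx A != 0.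
  by rewrite -mxrank_eq0 mxrank_ker subn_eq0 -ltnNge (leq_ltn_trans (rank_leq_col A)).
exists (nz_row (kermx A)); first by rewrite nz_row_eq0.
exact/sub_kermxP/nz_row_sub.
Qed.

Section spectral.
Context (R : realType) (E : lmodType R) (a b : E -> E -> R).
Hypothesis aP : forall t u v w, a (t *: u + v) w = t * a u w + a v w.
Hypothesis bP : forall t u v w, b (t *: u + v) w = t * b u w + b v w.
Hypothesis aC : forall u v, a u v = a v u.
Hypothesis bC : forall u v, b u v = b v u.
Hypothesis a_ge0 : forall u, 0 <= a u u.
Hypothesis b_ge0 : forall u, 0 <= b u u.

Let q u := a u u + b u u.

Hypothesis form_complete : forall u : nat -> E,
  (forall e, 0 < e -> exists N : nat, forall i j, (N <= i)%N -> (N <= j)%N -> q (u i - u j) <= e) ->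
  exists v, forall e, 0 < e -> exists N : nat, forall i, (N <= i)%N -> q (u i - v) <= e.

(** Compactness of the embedding of the energy space, in abstract form: up to finitely many
    functionals bounded for [b], the form [b] is dominated by a small multiple of [a]. In the
    application the functionals are normalized means over small cells. The forms are only
    semidefinite, as functions that agree almost everywhere are not identified. *)
Hypothesis form_compact : forall e, 0 < e -> exists (N : nat) (L : 'I_N -> E -> R),
  [/\ forall i t u v, L i (t *: u + v) = t * L i u + L i v,
      forall i, exists C, forall u, L i u ^+ 2 <= C * b u u &
      forall u, b u u <= e * a u u + \sum_i L i u ^+ 2].

Let form0 (f : E -> E -> R) (fP : forall t u v w, f (t *: u + v) w = t * f u w + f v w) w :
  f 0 w = 0.
Proof. by have := fP 1 0 0 w; rewrite scaler0 addr0 mul1r; lra. Qed.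

Let formD (f : E -> E -> R) (fP : forall t u v w, f (t *: u + v) w = t * f u w + f v w) u v w :
  f (u + v) w = f u w + f v w.
Proof. by have := fP 1 u v w; rewrite scale1r mul1r. Qed.

Let formZ (f : E -> E -> R) (fP : forall t u v w, f (t *: u + v) w = t * f u w + f v w) t u w :
  f (t *: u) w = t * f u w.
Proof. by have := fP t u 0 w; rewrite addr0 (form0 fP) addr0. Qed.

Let form_sum (f : E -> E -> R) (fP : forall t u v w, f (t *: u + v) w = t * f u w + f v w)
  (m : nat) (u : 'I_m -> E) w : f (\sum_i u i) w = \sum_i f (u i) w.
Proof.
apply: (big_morph (fun x => f x w)) => [x y|]; [exact: formD|exact: form0].
Qed.

Let form_sqr (f : E -> E -> R) (fP : forall t u v w, f (t *: u + v) w = t * f u w + f v w)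
  (fC : forall u v, f u v = f v u) t u v :
  f (u + t *: v) (u + t *: v) = f u u + 2 * t * f u v + t ^+ 2 * f v v.
Proof.
rewrite (formD fP) (fC u) (fC (t *: v)) !(formD fP) !(formZ fP) (fC u v) !(fC _ (t *: v)) !(formZ fP).
by ring.
Qed.

(** Young's inequality for the cross term in u = v + (u - v). It lets values of a form pass to the
    limit with no topology on [E]. *)
Let form_limit (f : E -> E -> R) (fP : forall t u v w, f (t *: u + v) w = t * f u w + f v w)
  (fC : forall u v, f u v = f v u) (f_ge0 : forall u, 0 <= f u u) t u v : 0 < t ->
  f u u <= (1 + t) * f v v + (1 + t^-1) * f (u - v) (u - v).
Proof.
move=> t0; have -> : f u u = f (v + 1 *: (u - v)) (v + 1 *: (u - v)).
  by rewrite scale1r addrC subrK.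
have := f_ge0 (v + (- t^-1) *: (u - v)).
rewrite !(form_sqr fP fC); move: (f v v) (f v (u - v)) (f (u - v) (u - v)) => x y z.
move=> /(ler_wpM2l (ltW t0)); rewrite mulr0.
rewrite [X in 0 <= X -> _](_ : _ = t * x - 2 * y + t^-1 * z); last by field; rewrite gt_eqF.
by lra.
Qed.

(** Cauchy-Schwarz with b y y + 1 in place of b y y, which spares the case where b y y vanishes. *)
Let b_CS x y : b x y ^+ 2 <= (b y y + 1) * b x x.
Proof.
have := b_ge0 (x + (- (b x y / (b y y + 1))) *: y).
rewrite (form_sqr bP bC); have := b_ge0 y.
move: (b x x) (b x y) (b y y) => X Z Y Y0.
have Y1 : 0 < Y + 1 by lra.
move=> /(ler_wpM2l (ltW Y1)); rewrite mulr0.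
rewrite [X in 0 <= X -> _](_ : _ = (Y + 1) * X - Z ^+ 2 - Z ^+ 2 / (Y + 1)); last by field; rewrite gt_eqF.
have : 0 <= Z ^+ 2 / (Y + 1) by rewrite divr_ge0 ?sqr_ge0// ltW.
by lra.
Qed.

(* By the parallelogram identity, a minimizing sequence satisfies a(w) <= mu b(w) + o(1) for
   its differences w, and b(w) <= eps a(w) + o(1) along a subsequence on which the finitely many
   functionals of [form_compact] converge; hence it is Cauchy if eps mu < 1. *)
Lemma rayleigh_attained (F : set E) (Lam : R) (w0 : E) :
  (forall t u v, F u -> F v -> F (t *: u + v)) ->
  (forall u v, (forall i : nat, F (u i)) ->
     (forall e, 0 < e -> exists N : nat, forall i, (N <= i)%N -> q (u i - v) <= e) -> F v) ->
  F w0 -> 0 < b w0 w0 -> a w0 w0 <= Lam * b w0 w0 ->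
  exists x l, [/\ F x, b x x = 1, l <= Lam & forall v, F v -> a x v = l * b x v].
Proof.
move=> Flin Fclosed Fw0 bw0 aw0.
have F0 : F 0 by have := Flin (-1) w0 w0 Fw0 Fw0; rewrite scaleN1r addNr.
have FZ t u : F u -> F (t *: u) by move=> Fu; have := Flin t u 0 Fu F0; rewrite addr0.
have FD u v : F u -> F v -> F (u + v) by move=> Fu Fv; have := Flin 1 u v Fu Fv; rewrite scale1r.
have FB u v : F u -> F v -> F (u - v).
  by move=> Fu Fv; apply: FD => //; rewrite -scaleN1r; exact: FZ.
have norm1 u : F u -> 0 < b u u -> exists2 v, F v /\ b v v = 1 & a v v = a u u / b u u.
  move=> Fu bu; exists ((Num.sqrt (b u u))^-1 *: u).
    split; first exact: FZ.
    rewrite (formZ bP) bC (formZ bP) mulrA -invfM -expr2 sqr_sqrtr ?ltW// mulVf// gt_eqF//.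
  by rewrite (formZ aP) aC (formZ aP) mulrA -invfM -expr2 sqr_sqrtr ?ltW// mulrC.
pose S := [set a u u | u in [set u | F u /\ b u u = 1]].
have S_inf : has_inf S.
  split; first by have [v Fv av] := norm1 _ Fw0 bw0; exists (a v v), v.
  by exists 0 => _ [u _ <-]; exact: a_ge0.
pose mu := inf S.
have muF u : F u -> mu * b u u <= a u u.
  move=> Fu; have := b_ge0 u; rewrite le_eqVlt => /orP[/eqP <-|bu].
    by rewrite mulr0 a_ge0.
  have [v Fv av] := norm1 _ Fu bu.
  rewrite -ler_pdivlMr// -av; apply: ge_inf; first by case: S_inf.
  by exists v.
have mu0 : 0 <= mu by apply: lb_le_inf; [case: S_inf|move=> _ [u _ <-]; exact: a_ge0].
have muL : mu <= Lam by have := le_trans (muF _ Fw0) aw0; rewrite ler_pM2r.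
have /choice[u uP] : forall k : nat, exists u, [/\ F u, b u u = 1 & a u u < mu + k.+1%:R^-1].
  move=> k; have k0 : 0 < (k.+1%:R^-1 : R) by rewrite invr_gt0.
  by have [_ [u [Fu bu] <-] ?] := inf_adherent k0 S_inf; exists u.
(* This epsilon satisfies eps mu <= 1/2, so that b <= eps (mu b + o(1)) + o(1) gives b = o(1). *)
have e0 : 0 < (2 * (mu + 1))^-1 by rewrite invr_gt0; lra.
have [N [L [LP LC Lb]]] := form_compact e0.
have L0 i : L i 0 = 0 by have := LP i 1 0 0; rewrite scaler0 addr0 mul1r; lra.
have LB i x y : L i (x - y) = L i x - L i y.
  by have := LP i (-1) y x; rewrite scaleN1r mulN1r addrC [RHS]addrC.
have /choice[C CP] := LC.
pose ell k : 'rV[R]_N := \row_i L i (u k).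
(* Since b = 1 along the minimizing sequence, the vectors of functional values stay in this compact
   box and have a cluster point [p]; [j] extracts a subsequence converging to it at rate 1/(k +
   1). *)
pose K := [set x : 'rV[R]_N | forall i, `[- (`|C i| + 1), `|C i| + 1]%classic (x ord0 i)].
have cK : compact K by apply: (@rV_compact R^o N (fun i => `[- (`|C i| + 1), `|C i| + 1]%classic)) => i; exact: segment_compact.
have ellK k : K (ell k).
  move=> i; rewrite /= in_itv/= mxE -ler_norml.
  have := CP i (u k); have [_ -> _] := uP k; rewrite mulr1 => h.
  have h1 : L i (u k) ^+ 2 <= (`|C i| + 1) ^+ 2.
    by rewrite (le_trans h)// (le_trans (ler_norm _))//; have := normr_ge0 (C i); nra.
  by rewrite -(@ler_pXn2r _ 2)// ?nnegrE ?addr_ge0// real_normK// num_real.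
have [p [_ pcl]] : K `&` cluster (ell @ \oo) !=set0.
  by apply: cK; exists 0%N => // k _; exact: ellK.
have /choice[j jP] : forall k : nat, exists j, (k <= j)%N /\ forall i, `|L i (u j) - p ord0 i| < k.+1%:R^-1.
  move=> k; have k0 : 0 < (k.+1%:R^-1 : R) by rewrite invr_gt0.
  have [_ [[j kj <-] [_ pj]]] : [set ell j | j in [set j | (k <= j)%N]] `&` ball p (k.+1%:R^-1) !=set0.
    apply: pcl; last exact: nbhsx_ballx.
    by exists k => // j kj; exists j.
  exists j; split => // i; have := pj ord0 i.
  by rewrite /ball/= mxE distrC.
pose v k := u (j k).
have Fv k : F (v k) by have [] := uP (j k).
have bv k : b (v k) (v k) = 1 by have [] := uP (j k).
have av k : a (v k) (v k) <= mu + k.+1%:R^-1.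
  have [_ _ /ltW h] := uP (j k); rewrite (le_trans h)// lerD2l lef_pV2 ?posrE// ler_nat ltnS.
  by case: (jP k).
pose d k l : R := k.+1%:R^-1 + l.+1%:R^-1.
have k1 (k : nat) : 0 < (k.+1%:R^-1 : R) <= 1 by rewrite invr_gt0 ltr0Sn/= invf_le1// ler1n.
have aw k l : a (v k - v l) (v k - v l) <= mu * b (v k - v l) (v k - v l) + 2 * d k l.
  have h f (fP : forall t u v w, f (t *: u + v) w = t * f u w + f v w)
     (fC : forall u v, f u v = f v u) : f (v k - v l) (v k - v l) =
      2 * f (v k) (v k) + 2 * f (v l) (v l) - f (v k + v l) (v k + v l).
    have := form_sqr fP fC 1 (v k) (v l); rewrite scale1r => ->.
    by have := form_sqr fP fC (-1) (v k) (v l); rewrite scaleN1r => ->; ring.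
  rewrite (h a)// (h b)// !bv; have := muF _ (FD _ _ (Fv k) (Fv l)).
  have := av k; have := av l; rewrite /d.
  move: (k.+1%:R^-1) (l.+1%:R^-1) (a (v k) _) (a (v l) _) (a (v k + v l) _) (b _ _) => p1 p2 a1 a2 a3 b1.
  by lra.
have sL k l : \sum_i L i (v k - v l) ^+ 2 <= N%:R * (2 * d k l).
  apply: (@le_trans _ _ (\sum_(i < N) (2 * d k l))); last first.
    by rewrite sumr_const card_ord [leRHS]mulr_natl.
  apply: ler_sum => i _; rewrite LB.
  have [_ /(_ i)/ltW hk] := jP k; have [_ /(_ i)/ltW hl] := jP l.
  have h : `|L i (v k) - L i (v l)| <= d k l.
    by rewrite (le_trans (ler_distD (p ord0 i) _ _))// lerD// distrC.
  rewrite -[_ ^+ 2]ger0_norm ?sqr_ge0// normrX.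
  have /andP[_ hk1] := k1 k; have /andP[_ hl1] := k1 l.
  have d2 : d k l <= 2 by apply: (le_trans (lerD hk1 hl1)); lra.
  have := normr_ge0 (L i (v k) - L i (v l)).
  by move: `|_| (d k l) h d2 => x D h d2 x0; nra.
have bw k l : b (v k - v l) (v k - v l) <= (4 + 4 * N%:R) * d k l.
  have := Lb (v k - v l); have := sL k l; have := aw k l.
  have := b_ge0 (v k - v l).
  have : 0 < d k l by rewrite /d addr_gt0.
  move: (d k l) (a _ _) (b _ _) (\sum_i _) => D A B Sg D0 B0 hA hS hB.
  have : (2 * (mu + 1))^-1 * A <= (2 * (mu + 1))^-1 * (mu * B + 2 * D) by rewrite ler_pM2l.
  have : (2 * (mu + 1))^-1 * (mu * B + 2 * D) <= B / 2 + D.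
    rewrite mulrC ler_pdivrMr; last by lra.
    by nra.
  by lra.
have qv k l : q (v k - v l) <= ((mu + 1) * (4 + 4 * N%:R) + 2) * d k l.
  rewrite /q; have h1 := aw k l; have h2 := bw k l.
  have : (mu + 1) * b (v k - v l) (v k - v l) <= (mu + 1) * ((4 + 4 * N%:R) * d k l).
    by rewrite ler_wpM2l//; lra.
  by lra.
have arch (c e : R) : 0 < c -> 0 < e -> exists n : nat, forall k, (n <= k)%N -> c * k.+1%:R^-1 <= e.
  move=> c0 ee0.
  have [n] : exists n : nat, 0 + n.+1%:R^-1 < e / c by apply: ltr_add_invr; rewrite divr_gt0.
  rewrite add0r => h; exists n => k nk.
  rewrite mulrC -ler_pdivlMr// (le_trans _ (ltW h))// lef_pV2 ?posrE// ler_nat ltnS//.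
have [x xP] : exists v', forall e, 0 < e -> exists N : nat, forall i, (N <= i)%N -> q (v i - v') <= e.
  apply: form_complete => e ee0.
  pose c := (mu + 1) * (4 + 4 * N%:R) + 2.
  have c0 : 0 < c.
    rewrite /c ltr_wpDl//; apply: mulr_ge0; first by lra.
    by apply: addr_ge0 => //; exact: mulr_ge0.
  have [n nP] := arch c (e / 2) c0 (divr_gt0 ee0 (ltr0n _ 2)).
  exists n => k l nk nl; rewrite (le_trans (qv k l))// -/c /d mulrDr [leRHS]splitr lerD ?nP//.
have Fx : F x by apply: (Fclosed v).
have hx t e : 0 < t -> 0 < e -> exists2 k : nat, k.+1%:R^-1 <= e & q (v k - x) * (1 + t^-1) <= e.
  move=> t0 ee0; have t1 : 0 < 1 + t^-1 by rewrite addr_gt0// invr_gt0.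
  have [n nP] := xP _ (divr_gt0 ee0 t1).
  have [m mP] := arch 1 e ltr01 ee0.
  exists (maxn n m); first by rewrite -[leLHS]mul1r mP// leq_maxr.
  by rewrite -ler_pdivlMr// nP// leq_maxl.
have qa y : a y y <= q y by rewrite /q lerDl.
have qb y : b y y <= q y by rewrite /q lerDr.
(* The inequalities b x x >= 1 and a x x <= mu suffice: mu b x x <= a x x <= mu <= mu b x x then
   forces equality. *)
have bx : 1 <= b x x.
  rewrite leNgt; apply/negP => b1.
  pose t := (1 - b x x) / 4.
  have t0 : 0 < t by rewrite /t; lra.
  have [k _ hk] := hx t t t0 t0.
  have := form_limit bP bC b_ge0 (v k) x t0; rewrite bv.
  have : (1 + t^-1) * b (v k - x) (v k - x) <= t.
    by rewrite (le_trans _ hk)// mulrC ler_wpM2r// addr_ge0// invr_ge0 ltW.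
  have : t * b x x <= t * 1 by rewrite ler_wpM2l// ltW.
  by rewrite /t; lra.
have ax : a x x <= mu.
  rewrite leNgt; apply/negP => a1.
  pose t := (a x x - mu) / (4 * (mu + 2)).
  have m2 : 0 < 4 * (mu + 2) by lra.
  have t0 : 0 < t by rewrite divr_gt0// subr_gt0.
  have tE : t * (4 * (mu + 2)) = a x x - mu by rewrite /t divfK// gt_eqF.
  pose e := Num.min t 1.
  have ee0 : 0 < e by rewrite lt_min t0 ltr01.
  have [k ke hk] := hx t e t0 ee0.
  have := form_limit aP aC a_ge0 x (v k) t0.
  have : (1 + t^-1) * a (x - v k) (x - v k) <= t.
    rewrite -opprB -[- (v k - x)]scaleN1r (formZ aP) aC (formZ aP) mulrA mulrNN mulr1 mul1r.
    apply: (@le_trans _ _ e); last by rewrite ge_min lexx.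
    apply: (le_trans _ hk); rewrite mulrC; apply: ler_wpM2r; last exact: qa.
    by rewrite addr_ge0// invr_ge0 ltW.
  have e1 : e <= 1 by rewrite ge_min lexx orbT.
  have et : e <= t by rewrite ge_min lexx.
  have : (1 + t) * a (v k) (v k) <= (1 + t) * (mu + e).
    by rewrite ler_wpM2l//; [lra|rewrite (le_trans (av k))// lerD2l].
  have : t * e <= t * 1 by rewrite ler_wpM2l// ltW.
  nra.
have axE : a x x = mu * b x x.
  apply/eqP; rewrite eq_le muF// andbT (le_trans ax)// ler_peMr//.
(* Euler-Lagrange equation, by minimality at x - s y with s = X/(Y + 1); the 1 in the denominator
   covers Y = 0. *)
have EL y : F y -> a x y = mu * b x y.
  move=> Fy; have hY := muF _ Fy.
  pose X := a x y - mu * b x y; pose Y := a y y - mu * b y y.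
  have Y0 : 0 <= Y by rewrite subr_ge0.
  have := muF _ (FD _ _ Fx (FZ (- (X / (Y + 1))) _ Fy)).
  rewrite (form_sqr aP aC) (form_sqr bP bC) -subr_ge0.
  set s := X / (Y + 1).
  rewrite [X in 0 <= X -> _](_ : _ = - 2 * s * X + s ^+ 2 * Y); last by rewrite /X /Y axE; ring.
  have Y1 : 0 < Y + 1 by lra.
  have sX : X = s * (Y + 1) by rewrite /s divfK// gt_eqF.
  rewrite {1}sX => h.
  have : s ^+ 2 * (Y + 2) <= 0 by nra.
  rewrite pmulr_lle0; last by lra.
  rewrite le_eqVlt ltNge sqr_ge0 orbF sqrf_eq0 => /eqP s0.
  by apply/eqP; rewrite -subr_eq0 -/X sX s0 mul0r.
have bx0 : 0 < b x x by exact: lt_le_trans bx.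
pose s := (Num.sqrt (b x x))^-1.
exists (s *: x), mu; split => //; first exact: FZ.
  by rewrite (formZ bP) bC (formZ bP) mulrA -invfM -expr2 sqr_sqrtr ?ltW// mulVf// gt_eqF.
by move=> y Fy; rewrite (formZ aP) (formZ bP) EL// mulrCA.
Qed.

(** The upper half of the min-max principle, with existence. Given m < M eigenvectors, some
    combination of the [W i] is orthogonal to all of them and has Rayleigh quotient at most [Lam];
    the minimum over the orthogonal complement is therefore at most [Lam], and it is attained. *)
Lemma spectral_eigenvectors (M : nat) (W : 'I_M -> E) (Lam : R) :
  (forall c : 'I_M -> R, (exists i, c i != 0) ->
    0 < b (\sum_i c i *: W i) (\sum_i c i *: W i) /\
    a (\sum_i c i *: W i) (\sum_i c i *: W i) <= Lam * b (\sum_i c i *: W i) (\sum_i c i *: W i)) ->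
  exists (x : 'I_M -> E) (l : 'I_M -> R),
    [/\ forall i j, b (x i) (x j) = (i == j)%:R,
        forall i, l i <= Lam & forall i v, a (x i) v = l i * b (x i) v].
Proof.
move=> WP; suff: forall m, (m <= M)%N -> exists (x : 'I_m -> E) (l : 'I_m -> R),
    [/\ forall i j, b (x i) (x j) = (i == j)%:R,
        forall i, l i <= Lam & forall i v, a (x i) v = l i * b (x i) v] by exact.
elim=> [_|m IHm mM]; first by exists (fun=> 0), (fun=> 0); split=> -[].
have [x [l [xx lL xv]]] := IHm (ltnW mM).
have [c c0 cA] := @left_kernel_neq0 R M m (\matrix_(i, j) b (W i) (x j)) mM.
have [bw aw] : 0 < b (\sum_i c ord0 i *: W i) (\sum_i c ord0 i *: W i) /\
    a (\sum_i c ord0 i *: W i) (\sum_i c ord0 i *: W i) <= Lam * b (\sum_i c ord0 i *: W i) (\sum_i c ord0 i *: W i).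
  apply: WP; apply: contrapT => h; case/eqP: c0; apply/rowP => i; rewrite mxE.
  by apply/eqP; apply: contrapT => /negP ci; apply: h; exists i.
pose F := [set u | forall j, b u (x j) = 0].
have [y [k [Fy yy kL yv]]] : exists x l, [/\ F x, b x x = 1, l <= Lam & forall v, F v -> a x v = l * b x v].
  apply: (@rayleigh_attained F Lam (\sum_i c ord0 i *: W i)) => //.
  - by move=> t u v Fu Fv j; rewrite bP Fu Fv mulr0 addr0.
  - move=> u v Fu uv j; apply/eqP; rewrite -sqrf_eq0 eq_le sqr_ge0 andbT.
  apply/ler_addgt0Pl => e e0; rewrite addr0.
  have b1 : 0 < b (x j) (x j) + 1 by rewrite ltr_wpDl.
  have [N /(_ N (leqnn _)) h] := uv _ (divr_gt0 e0 b1).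
  have := b_CS (u N - v) (x j).
  rewrite -scaleN1r addrC bP Fu addr0 mulN1r sqrrN => /le_trans; apply.
  rewrite scaleN1r addrC mulrC -ler_pdivlMr// (le_trans _ h)// /q lerDr//.
  - move=> j; rewrite (form_sum bP); have /rowP/(_ j) := cA; rewrite !mxE => h.
  by rewrite -[RHS]h; apply: eq_bigr => i _; rewrite (formZ bP) mxE.
pose x' (i : 'I_m.+1) := if unlift ord0 i is Some j then x j else y.
pose l' (i : 'I_m.+1) := if unlift ord0 i is Some j then l j else k.
exists x', l'; split.
- move=> i j; rewrite /x'; case: (unliftP ord0 i) => [i' ->|->]; case: (unliftP ord0 j) => [j' ->|->].
  + by rewrite xx (inj_eq lift_inj).
  + by rewrite bC Fy eq_sym.
  + by rewrite Fy.
  + by rewrite yy.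
- by move=> i; rewrite /l'; case: (unlift ord0 i).
move=> i v; rewrite /l' /x'; case: (unlift ord0 i) => [i'|]; first exact: xv.
(* The equation for [y] is known on the complement [F] only. It extends to all [v] by projection,
   since both forms vanish between [y] and the earlier eigenvectors. *)
pose v' := v - \sum_j b v (x j) *: x j.
have Fv' : F v'.
  move=> j; rewrite /v' -scaleN1r addrC bP (form_sum bP) (bigD1 j)//= big1 ?addr0.
    by rewrite (formZ bP) xx eqxx mulr1 mulN1r addNr.
  by move=> i' ij; rewrite (formZ bP) xx (negbTE ij) mulr0.
have -> : v = v' + \sum_j b v (x j) *: x j by rewrite subrK.
rewrite aC (formD aP) aC (yv _ Fv') (form_sum aP) [b y (_ + _)]bC (formD bP) (form_sum bP) [b v' y]bC.
rewrite !big1 ?addr0// => j _.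
  by rewrite (formZ bP) [b (x j) y]bC Fy mulr0.
by rewrite (formZ aP) xv [b (x j) y]bC Fy !mulr0.
Qed.

End spectral.

(** * Smooth bump functions *)

Section derivative_criteria.
Context (R : realType).

(** Covers the functions for which the rules of calculus do not apply directly: a flat junction at
    0, an integral depending on a parameter, a truncated square. *)
Lemma is_derive_quadratic (V : normedModType R) (f : V -> R) (x v : V) (l C : R) :
  (forall h, `|h| <= 1 -> `|f (h *: v + x) - f x - h * l| <= C * h ^+ 2) ->
  is_derive x v f l.
Proof.
move=> H; have C0 : 0 <= C.
  by have := H 1; rewrite normr1 lexx expr1n mulr1 => /(_ isT); exact: le_trans.
suff fl : (fun h => h^-1 *: ((f \o shift x) (h *: v) - f x)) @ 0^' --> l.
  by apply: DeriveDef; [apply/cvg_ex; exists l|exact: cvg_lim].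
apply/cvgrPdist_le => /= e e0.
have C1 : 0 < C + 1 by rewrite ltr_wpDl.
near=> h.
have h0 : h != 0 by near: h; exact: nbhs_dnbhs_neq.
have h1 : `|h| <= 1.
  by near: h; apply: dnbhs0_le.
have h2 : `|h| <= e / (C + 1).
  by near: h; apply: dnbhs0_le; rewrite divr_gt0.
have hn0 : 0 < `|h| by rewrite normr_gt0.
rewrite distrC -[X in `|_ - X|](mulKf h0) -mulrBr normrM normfV.
rewrite mulrC ler_pdivrMr//; apply: (le_trans (H h h1)).
rewrite -(real_normK (num_real h)) expr2 mulrA ler_pM2r//.
rewrite (@le_trans _ _ ((C + 1) * `|h|))//; first by rewrite ler_wpM2r// lerDl.
by rewrite mulrC -ler_pdivlMr.
Unshelve. all: by end_near. Qed.

End derivative_criteria.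

Section cbump.
Context (R : realType).
Implicit Types (P Q : {poly R}) (t : R).

(* The functions P(1/t) exp(-1/t) of t > 0, extended by 0, are closed under derivation. *)
Definition theta P t : R := if 0 < t then P.[t^-1] * expR (- t^-1) else 0.

(** With y = 1/t one has d/dt = - y^2 d/dy, which sends P(y) exp(-y) to y^2 (P - P')(y) exp(-y). *)
Definition dtheta P : {poly R} := 'X^2 * (P - P^`()).

(** From exp y >= y^(N+2)/(N+2)! with N the size of P. The bound O(t^2) gives differentiability at
    0, and boundedness on (0, 1). *)
Lemma theta_bound P : exists2 C : R, 0 <= C & forall t, t <= 1 -> `|theta P t| <= C * t ^+ 2.
Proof.
pose N := size P; pose A : R := \sum_(i < N) `|P`_i|.
have A0 : 0 <= A by apply: sumr_ge0.
exists (A * (N.+2)`!%:R); first by rewrite mulr_ge0.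
move=> t t1; rewrite /theta; case: ifPn => [t0|_]; last first.
  by rewrite normr0; apply: mulr_ge0; [exact: mulr_ge0|exact: sqr_ge0].
have y1 : 1 <= t^-1 by rewrite invf_ge1.
have y0 : 0 < t^-1 by rewrite invr_gt0.
have tE : t = (t^-1)^-1 by rewrite invrK.
rewrite [in leRHS]tE; move: (t^-1) y1 y0 => y y1 y0.
have hP : `|P.[y]| <= A * y ^+ N.
  rewrite horner_coef (le_trans (ler_norm_sum _ _ _))// mulr_suml; apply: ler_sum => i _.
  rewrite normrM ler_wpM2l// ger0_norm ?exprn_ge0 ?(ltW y0)//.
  by apply: ler_weXn2l => //; exact: ltnW.
have he : y ^+ N.+2 / (N.+2)`!%:R <= expR y.
  by apply: le_trans (@expR_ge1Dxn _ y N.+1 (ltW y0)); rewrite lerDr.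
have f0 : 0 < (N.+2)`!%:R :> R by rewrite ltr0n fact_gt0.
rewrite normrM expRN (ger0_norm (_ : 0 <= (expR y)^-1)) ?invr_ge0 ?expR_ge0//.
rewrite ler_pdivrMr ?expR_gt0//; apply: (le_trans hP).
apply: (@le_trans _ _ (A * (N.+2)`!%:R * y^-1 ^+ 2 * (y ^+ N.+2 / (N.+2)`!%:R))).
  rewrite [leRHS](_ : _ = A * y ^+ N)//.
  by rewrite -addn2 exprD exprVn; field; rewrite !gt_eqF// exprn_gt0.
by rewrite ler_wpM2l// !mulr_ge0// ?exprn_ge0// invr_ge0 ltW.
Qed.

Lemma theta_le0 P t : t <= 0 -> theta P t = 0.
Proof. by rewrite /theta leNgt => /negbTE ->. Qed.

Lemma is_derive_theta P t : is_derive t 1 (theta P) (theta (dtheta P) t).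
Proof.
have [t0|t0|->] := ltgtP t 0.
- rewrite (theta_le0 _ (ltW t0)).
  apply: near_eq_is_derive (is_derive_cst (0 : R) t 1).
  near=> u; rewrite theta_le0//; apply: ltW; near: u; exact: lt_nbhsl.
- have tn0 : t != 0 by rewrite gt_eqF.
  have dV : is_derive t 1 (fun u : R => u^-1) (- t ^- 2 *: 1) by apply: is_deriveV.
  have dVN : is_derive t 1 (- (fun u : R => u^-1) : R -> R) (- (- t ^- 2 *: 1)) by exact: is_deriveN.
  have d1 := @is_derive1_comp R (horner P) (fun u => u^-1) t _ _ (is_derive_poly P _) dV.
  have d2 := @is_derive1_comp R expR (- (fun u => u^-1)) t _ _ (is_derive_expR _) dVN.
  have [dd dv] := @is_deriveM _ _ _ _ _ _ _ _ d1 d2.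
  have D : is_derive t 1 (fun u : R => P.[u^-1] * expR (- u^-1)) (theta (dtheta P) t).
    apply: DeriveDef; first exact: dd.
    apply: (eq_trans dv); rewrite /theta t0 /dtheta /= hornerM hornerXn hornerD hornerN.
    by rewrite /GRing.scale/= -exprVn !fctE/=; ring.
  apply: near_eq_is_derive D; near=> u.
  by rewrite /theta ifT//; near: u; exact: lt_nbhsr.
rewrite theta_le0//; have [C C0 HC] := theta_bound P.
apply: (@is_derive_quadratic _ _ _ _ _ _ C) => h h1.
rewrite addr0 [h *: _]mulr1 mulr0 subr0 (theta_le0 _ (lexx 0)) subr0.
by apply: HC; rewrite (le_trans (ler_norm h)).
Unshelve. all: by end_near. Qed.

(** A list of pairs of polynomials encodes a finite sum of products, so that derivation becomes the
    operation [dthetas] on lists, and iterating it gives derivatives of every order. *)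
Definition thetas (s : seq ({poly R} * {poly R})) t : R :=
  \sum_(pq <- s) theta pq.1 t * theta pq.2 (1 - t).

Definition dthetas (s : seq ({poly R} * {poly R})) :=
  flatten [seq [:: (dtheta pq.1, pq.2); (pq.1, - dtheta pq.2)] | pq <- s].

Lemma thetaN P t : theta (- P) t = - theta P t.
Proof. by rewrite /theta; case: ifP => _; rewrite ?oppr0// hornerN mulNr. Qed.

Lemma is_derive_thetas s t : is_derive t 1 (thetas s) (thetas (dthetas s) t).
Proof.
elim: s => [|[P Q] s IHs].
  rewrite (_ : thetas [::] = cst 0); last by apply/funext => u; rewrite /thetas big_nil.
  exact: is_derive_cst.
rewrite (_ : thetas ((P, Q) :: s) = (fun u => theta P u * theta Q (1 - u)) + thetas s); last first.
  by apply/funext => u; rewrite /thetas big_cons.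
have d1 : is_derive t 1 (cst 1 - id : R -> R) (0 - 1) by exact: is_deriveB.
have d2 := @is_derive1_comp R (theta Q) (cst 1 - id) t _ _ (is_derive_theta Q _) d1.
have d3 := @is_deriveM _ _ _ _ _ _ _ _ (is_derive_theta P t) d2.
have [dd dv] := @is_deriveD _ _ _ _ _ _ _ _ _ d3 IHs.
apply: DeriveDef; first exact: dd.
apply: (eq_trans dv); rewrite /thetas /dthetas/= !big_cons/= addrA; congr (_ + _).
by rewrite thetaN /GRing.scale/= !fctE/=; ring.
Qed.

Lemma thetas_bounded s : exists2 B : R, 0 <= B & forall t, `|thetas s t| <= B.
Proof.
elim: s => [|[P Q] s [B B0 HB]].
  by exists 0 => // t; rewrite /thetas big_nil normr0.
have [C C0 HC] := theta_bound P; have [C' C'0 HC'] := theta_bound Q.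
exists (C * C' + B) => [|t]; first by rewrite addr_ge0// mulr_ge0.
rewrite /thetas big_cons (le_trans (ler_normD _ _))// lerD//= ?HB// normrM.
have [t0|t0] := leP t 0; first by rewrite (theta_le0 _ t0) normr0 mul0r mulr_ge0.
have [t1|t1] := leP 1 t; first by rewrite (@theta_le0 Q) ?subr_le0// normr0 mulr0 mulr_ge0.
rewrite ler_pM//.
  rewrite (le_trans (HC _ (ltW t1)))// ler_piMr// expr_le1// ltW//.
rewrite (le_trans (HC' _ _)) ?gerBl ?(ltW t0)//.
by rewrite ler_piMr// expr_le1 ?subr_ge0 ?(ltW t1)// gerBl (ltW t0).
Qed.

(* The k-th derivative of the function exp(-1/t - 1/(1-t)) on the interval (0, 1), extended by 0. *)
Definition cbump (k : nat) : R -> R := thetas (iter k dthetas [:: (1, 1)]).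

Lemma is_derive_bump k t : is_derive t 1 (cbump k) (cbump k.+1 t).
Proof. exact: is_derive_thetas. Qed.

Lemma bump_bounded k : exists2 B : R, 0 <= B & forall t, `|cbump k t| <= B.
Proof. exact: thetas_bounded. Qed.

Lemma bump_out k t : ~~ (0 < t < 1) -> cbump k t = 0.
Proof.
move=> t01; rewrite /cbump /thetas big1// => -[P Q] _ /=.
have [t0|t0] := leP t 0; first by rewrite (theta_le0 _ t0) mul0r.
rewrite (@theta_le0 Q) ?mulr0// subr_le0 leNgt; apply: contra t01 => t1.
by rewrite t0.
Qed.

Lemma bump_ge0 t : 0 <= cbump 0 t.
Proof.
by rewrite /cbump /thetas big_seq1 /theta/= mulr_ge0//; case: ifP => // _; rewrite hornerC mul1r expR_ge0.
Qed.

End cbump.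

Section smooth_product.
Context (R : realType) (n : nat).
Variable F : 'I_n -> nat -> R -> R.
Hypothesis dF : forall i k (t : R), is_derive t 1 (F i k) (F i k.+1 t).

(** [F i k] is the k-th derivative of the i-th factor, so the multi-index [c] designates a mixed
    partial derivative of the product; differentiating only raises [c]. *)
Definition coord_prod (c : 'I_n -> nat) (x : 'rV[R]_n) : R := \prod_i F i (c i) (x ord0 i).

Lemma is_derive_coord_prod c j x :
  is_derive x (delta_mx 0 j) (coord_prod c) (coord_prod (fun i => (i == j) + c i)%N x).
Proof.
pose K := \prod_(i | i != j) F i (c i) (x ord0 i).
have E h : coord_prod c (h *: delta_mx 0 j + x) = F j (c j) (h + x ord0 j) * K.
  rewrite /coord_prod (bigD1 j)//= !mxE !eqxx mulr1; congr (_ * _).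
  by apply: eq_bigr => i ij; rewrite !mxE (negbTE ij) andbF mulr0 add0r.
have E0 : coord_prod c x = F j (c j) (x ord0 j) * K by rewrite /coord_prod (bigD1 j).
have E1 : coord_prod (fun i => (i == j) + c i)%N x = F j (c j).+1 (x ord0 j) * K.
  rewrite /coord_prod (bigD1 j)//= eqxx; congr (_ * _).
  by apply: eq_bigr => i /negbTE ->.
have [dFx dFE] := dF j (c j) (x ord0 j).
have cv : (fun h : R => h^-1 *: ((coord_prod c \o shift x) (h *: delta_mx 0 j) - coord_prod c x)) @ 0^' -->
    coord_prod (fun i => (i == j) + c i)%N x.
  rewrite E1 -dFE.
  rewrite (_ : (fun h : R => _) = (fun h : R => (h^-1 *: ((F j (c j) \o shift (x ord0 j)) (h *: 1) - F j (c j) (x ord0 j))) * K)); last first.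
    apply/funext => h /=; rewrite E E0 -mulrBl /GRing.scale/= mulr1 mulrA//.
  by apply: cvgMr_tmp; exact: dFx.
by apply: DeriveDef; [apply/cvg_ex; eexists; exact: cv|exact: cvg_lim].
Qed.

Lemma iter_partial_coord_prod s c :
  iter_partial s (coord_prod c) = coord_prod (fun i => count_mem i s + c i)%N.
Proof.
elim: s => [|j s IHs] //=; rewrite -/(iter_partial s _) IHs.
apply/funext => x; rewrite /partial; have [_ ->] := is_derive_coord_prod (fun i => count_mem i s + c i)%N j x.
by congr (coord_prod _ x); apply/funext => i; rewrite addnA eq_sym.
Qed.

Lemma continuous_coord_prod c : continuous (coord_prod c).
Proof.
rewrite /coord_prod => x; elim: (index_enum _) => [|i s IHs].
  by under [X in continuous_at _ X]funext do rewrite big_nil; exact: cst_continuous.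
under [X in continuous_at _ X]funext do rewrite big_cons.
have cF : F i (c i) y @[y --> x ord0 i] --> F i (c i) (x ord0 i).
  by apply/differentiable_continuous/derivable1_diffP; have [] := dF i (c i) (x ord0 i).
have cFx : (F i (c i) \o (fun z : 'rV[R]_n => z ord0 i)) z @[z --> x] --> F i (c i) (x ord0 i).
  by apply: cvg_comp cF; exact: coord_continuous.
exact: cvgM cFx IHs.
Qed.

Lemma smooth_on_coord_prod c : smooth_on setT (coord_prod c).
Proof.
move=> s x _; rewrite iter_partial_coord_prod; split; first exact: continuous_coord_prod.
by move=> i; have [] := is_derive_coord_prod (fun i => count_mem i s + c i)%N i x.
Qed.

End smooth_product.

(** * Square-integrable functions *)

Section L2.
Context d (T : measurableType d) (R : realType) (mu : {measure set T -> \bar R}).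
Context (D : set T) (mD : measurable D) (Doo : (mu D < +oo)%E).
Implicit Types (u v w : T -> R).

Definition L2 u := measurable_fun D u /\ mu.-integrable D (EFin \o (fun x => u x ^+ 2)).

Lemma L2M u v : L2 u -> L2 v -> mu.-integrable D (EFin \o (fun x => u x * v x)).
Proof.
move=> [mu' iu] [mv iv].
apply: (@le_integrable _ _ _ mu D mD _ (EFin \o (fun x => u x ^+ 2 + v x ^+ 2))).
- by apply/measurable_EFinP; exact: measurable_funM.
- move=> x Dx /=; rewrite lee_fin normrM [leRHS]ger0_norm; last first.
    by apply: addr_ge0; exact: sqr_ge0.
  have := sqr_ge0 (`|u x| - `|v x|); rewrite sqrrB !real_normK ?num_real//.
  have : 0 <= `|u x| * `|v x| by exact: mulr_ge0.
  by rewrite -mulr_natl; lra.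
- exact: (integrableD mD iu iv).
Qed.

Lemma L2Z c u : L2 u -> L2 (fun x => c * u x).
Proof.
move=> [mu' iu]; split; first exact: measurable_funM.
have := integrableZl mD (c ^+ 2) iu; apply: eq_integrable => // x _ /=.
by rewrite -EFinM exprMn.
Qed.

Lemma L2D u v : L2 u -> L2 v -> L2 (fun x => u x + v x).
Proof.
move=> Lu Lv; split; first by apply: measurable_funD; [exact: Lu.1|exact: Lv.1].
have := integrableD mD (integrableD mD Lu.2 Lv.2) (integrableZl mD 2 (L2M Lu Lv)).
apply: eq_integrable => // x _ /=; rewrite -!EFinD.
by congr (_%:E); ring.
Qed.

Lemma L2N u : L2 u -> L2 (fun x => - u x).
Proof.
move=> /(L2Z (-1)); congr L2; apply/funext => x; by rewrite mulN1r.
Qed.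

Lemma L2B u v : L2 u -> L2 v -> L2 (fun x => u x - v x).
Proof. by move=> Lu /L2N; exact: L2D. Qed.

Lemma L2_sum (I : Type) (s : seq I) (F : I -> T -> R) :
  (forall i, L2 (F i)) -> L2 (fun x => \sum_(i <- s) F i x).
Proof.
move=> LF; elim: s => [|i s IHs].
  under [X in L2 X]funext do rewrite big_nil.
  split => //; rewrite (_ : EFin \o _ = cst 0%E); first exact: integrable0.
  by apply/funext => x /=; rewrite expr0n.
by under [X in L2 X]funext do rewrite big_cons; exact: L2D.
Qed.

Lemma bounded_mfun_L2 u : bounded_mfun D u -> L2 u.
Proof.
move=> bu; split; first exact: bu.1.
by apply: bounded_mfun_integrable => //; exact: bounded_mfunX.
Qed.

Lemma L2_integrable u : L2 u -> mu.-integrable D (EFin \o u).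
Proof.
move=> Lu; have := L2M Lu (bounded_mfun_L2 (bounded_mfun_cst D 1)).
by apply: eq_integrable => // x _ /=; rewrite mulr1.
Qed.

Lemma eq_L2 u v : (forall x, D x -> u x = v x) -> L2 u -> L2 v.
Proof.
move=> uv [mu' iu]; split.
  by apply: eq_measurable_fun mu' => x /set_mem Dx; rewrite uv.
by apply: eq_integrable iu => // x /set_mem Dx /=; rewrite uv.
Qed.

Definition sqi u : R := \int[mu]_(x in D) (u x ^+ 2).

Lemma sqi_ge0 u : 0 <= sqi u.
Proof. by apply: Rintegral_ge0 => x _; exact: sqr_ge0. Qed.

Lemma eq_sqi u v : (forall x, D x -> u x = v x) -> sqi u = sqi v.
Proof. by move=> uv; apply: eq_Rintegral => x /set_mem Dx; rewrite uv. Qed.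

Lemma sqiZ c u : L2 u -> sqi (fun x => c * u x) = c ^+ 2 * sqi u.
Proof.
move=> Lu; rewrite /sqi -RintegralZl//; last exact: Lu.2.
by apply: eq_Rintegral => x _; rewrite exprMn.
Qed.

Lemma sqiN u : sqi (fun x => - u x) = sqi u.
Proof. by apply: eq_Rintegral => x _; rewrite sqrrN. Qed.

Lemma sqiD u v : L2 u -> L2 v -> sqi (fun x => u x + v x) <= 2 * sqi u + 2 * sqi v.
Proof.
move=> Lu Lv; rewrite /sqi -!RintegralZl//; [|exact: Lv.2|exact: Lu.2].
have i1 := integrableZl mD 2 Lu.2; have i2 := integrableZl mD 2 Lv.2.
rewrite -RintegralD//.
apply: le_Rintegral => //; first exact: (L2D Lu Lv).2.
  exact: (integrableD mD i1 i2).
by move=> x _; have := sqr_ge0 (u x - v x); rewrite -subr_ge0 => h; rewrite -subr_ge0; lra.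
Qed.

Lemma sqi_lty u (e : R) : measurable_fun D u -> (\int[mu]_(x in D) (u x ^+ 2)%:E <= e%:E)%E ->
  L2 u /\ sqi u <= e.
Proof.
move=> mu' ue; have iu : mu.-integrable D (EFin \o (fun x => u x ^+ 2)).
  apply/integrableP; split; first by apply/measurable_EFinP; exact: measurable_funX.
  under eq_integral do rewrite /= ger0_norm ?sqr_ge0//.
  by rewrite (le_lt_trans ue)// ltry.
by split; [split|rewrite -lee_fin /sqi EFin_Rintegral].
Qed.

(** Riesz-Fischer. A subsequence with increments at most 2^-k in L2 norm has absolutely summable
    increments almost everywhere, hence a pointwise limit, and Fatou's lemma gives convergence in
    L2. *)
Lemma L2_complete (u : nat -> T -> R) : (forall i, L2 (u i)) ->
  (forall e, 0 < e -> exists N : nat, forall i j, (N <= i)%N -> (N <= j)%N ->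
     sqi (fun x => u i x - u j x) <= e) ->
  exists v, L2 v /\ forall e, 0 < e -> exists N : nat, forall i, (N <= i)%N ->
     sqi (fun x => u i x - v x) <= e.
Proof.
move=> Lu Cu.
pose r k : R := 2^-1 ^+ k.
have r0 k : 0 < r k by rewrite exprn_gt0// invr_gt0.
have /choice[N NP] : forall k : nat, exists N : nat, forall i j, (N <= i)%N -> (N <= j)%N ->
    sqi (fun x => u i x - u j x) <= r k ^+ 2.
  by move=> k; apply: Cu; rewrite exprn_gt0.
(* As a sum, [n_] is nondecreasing and at least [N k]; the successors make it at least k as well. *)
pose n_ k := (\sum_(i < k.+1) (N i).+1)%N.
have nN k : (N k <= n_ k)%N by rewrite /n_ big_ord_recr/= (leq_trans (leqnSn _))// leq_addl.
have nS k : (n_ k <= n_ k.+1)%N by rewrite {2}/n_ big_ord_recr/= leq_addr.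
pose w k := u (n_ k).
have Lw k : L2 (w k) by exact: Lu.
pose g k x := `|w k.+1 x - w k x|.
have g0 k x : 0 <= g k x by rewrite /g.
have mg k : measurable_fun D (g k).
  by apply: measurableT_comp => //; apply: measurable_funB; [exact: (Lw _).1|exact: (Lw _).1].
(* From |d| <= r + d^2/r: a squared L2 norm at most r^2 gives an L1 norm at most (mu D + 1) r. *)
have ig k : (\int[mu]_(x in D) (g k x)%:E <= (fine (mu D) + 1)%:E * (r k)%:E)%E.
  have LB : L2 (fun x => w k.+1 x - w k x) by exact: L2B.
  have i1 := integrableZl mD (r k)^-1 LB.2.
  have i2 : mu.-integrable D (EFin \o cst (r k)).
    exact: bounded_mfun_integrable (bounded_mfun_cst D _).
  apply: (@le_trans _ _ (\int[mu]_(x in D) (r k + (r k)^-1 * (w k.+1 x - w k x) ^+ 2)%:E)%E).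
    apply: ge0_le_integral => //.
    - by move=> x _; rewrite lee_fin /g.
    - exact/measurable_EFinP.
    - apply/measurable_EFinP; apply: measurable_funD => //; apply: measurable_funM => //.
      by apply: measurable_funX; exact: LB.1.
    move=> x _; rewrite lee_fin -(ler_pM2l (r0 k)) mulrDr mulrA divff ?gt_eqF// mul1r /g.
    have := sqr_ge0 (r k - `|w k.+1 x - w k x|); rewrite sqrrB real_normK ?num_real//.
    have : 0 <= r k * `|w k.+1 x - w k x| by rewrite mulr_ge0// ltW.
    by rewrite -mulr_natl expr2; lra.
  rewrite -(@EFin_Rintegral _ _ _ _ _ (fun x => r k + (r k)^-1 * (w k.+1 x - w k x) ^+ 2))//; last first.
    exact: (integrableD mD i2 i1).
  rewrite RintegralD// RintegralZl//; last exact: LB.2.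
  rewrite Rintegral_cst// -EFinM lee_fin mulrDl mul1r mulrC lerD2l//.
  rewrite mulrC ler_pdivrMr// -expr2; apply: NP; last exact: nN.
  exact: leq_trans (nN k) (nS k).
have mgE k : measurable_fun D (fun x => (g k x)%:E) by exact/measurable_EFinP.
have g0E k x : D x -> (0 <= (g k x)%:E)%E by rewrite lee_fin g0.
pose S x := (\sum_(k <oo) (g k x)%:E)%E.
have mS : measurable_fun D S.
  apply: ge0_emeasurable_sum => [k x Dx _|k _]; first by rewrite lee_fin.
  exact/measurable_EFinP.
have iS : mu.-integrable D S.
  apply/integrableP; split => //.
  rewrite (_ : (\int[mu]_(x in D) `|S x|)%E = (\sum_(k <oo) \int[mu]_(x in D) (g k x)%:E)%E); last first.
    rewrite -(integral_nneseries mu mD mgE g0E).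
    apply: eq_integral => x _; rewrite gee0_abs//; apply: nneseries_ge0 => k _ _.
    by rewrite lee_fin ?g0.
  apply: (@le_lt_trans _ _ (\sum_(k <oo) ((fine (mu D) + 1)%:E * (r k)%:E))%E).
    apply: lee_nneseries => [k _|k _]; last exact: ig.
    by move=> _; apply: integral_ge0 => x _; rewrite lee_fin.
  rewrite nneseriesZl//; last by move=> k _; rewrite lee_fin ltW.
  apply: lte_mul_pinfty; [by rewrite lee_fin addr_ge0// fine_ge0|by []|].
  have := @cvg_geometric_series R 1 2^-1.
  rewrite ger0_norm// invf_lt1// ltr1n => /(_ isT) cg.
  rewrite (_ : (\sum_(k <oo) (r k)%:E)%E = (1 / (1 - 2^-1))%:E) ?ltry//.
  apply/cvg_lim => //.
  rewrite (_ : (fun k : nat => \sum_(0 <= i < k) (r i)%:E)%E = EFin \o series (geometric 1 2^-1)).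
    by apply: cvg_EFin; [exact: nearW|exact: cg].
  apply/funext => k; rewrite /series/= -sumEFin; apply: eq_bigr => i _.
  by rewrite /geometric/= mul1r.
(* The increments are summable on [A]; setting the subsequence to 0 elsewhere makes it converge
   everywhere, to a measurable limit. *)
pose A := D `&` [set x | S x \is a fin_num].
have mA : measurable A by exact: emeasurable_fin_num.
pose w' k x := w k x * \1_A x.
have cw' x : cvgn (fun k => w' k x).
  rewrite /w' indicE; case: (boolP (x \in A)) => [/set_mem[Dx Sx]|_]; last first.
    by under [X in cvgn X]funext do rewrite mulr0; exact: is_cvg_cst.
  under [X in cvgn X]funext do rewrite mulr1.
  have cgx : cvgn (series (fun k => g k x)).
    apply: nondecreasing_is_cvgn.
      by apply: nondecreasing_series => k *; rewrite /= g0.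
    exists (fine (S x)) => _ [k _ <-].
    rewrite -lee_fin fineK// /series/= -sumEFin.
    by apply: nneseries_lim_ge => j _ _; rewrite lee_fin.
  have cx : cvgn (series (fun k => w k.+1 x - w k x)) by exact: normed_cvg.
  rewrite (_ : (fun k => w k x) = (fun k => w 0%N x + series (fun k => w k.+1 x - w k x) k)).
    by apply: is_cvgD => //; exact: is_cvg_cst.
  by apply/funext => k; rewrite (eq_sum_telescope (w ^~ x) k).
pose v x := limn (fun k => w' k x).
have cv x : w' k x @[k --> \oo] --> v x by exact: cw'.
have mw' k : measurable_fun D (w' k).
  by apply: measurable_funM; [exact: (Lw k).1|exact: measurable_indic].
have mv : measurable_fun D v.
  by apply: (measurable_fun_cvg mw') => x _; exact: cv.
have aew' i k : (\int[mu]_(x in D) ((u i x - w' k x) ^+ 2)%:E = (sqi (fun x => u i x - w k x))%:E)%E.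
  rewrite /sqi EFin_Rintegral//; last by have [] := L2B (Lu i) (Lw k).
  apply: ge0_ae_eq_integral => //.
  - apply/measurable_EFinP; apply: measurable_funX; apply: measurable_funB => //; exact: (Lu i).1.
  - by apply/measurable_EFinP; apply: measurable_funX; apply: measurable_funB; [exact: (Lu i).1|exact: (Lw k).1].
  - by move=> x _; rewrite lee_fin sqr_ge0.
  - by move=> x _; rewrite lee_fin sqr_ge0.
  have := integrable_ae mD iS; apply: filterS => x Sx Dx.
  by rewrite /w' indicE mem_set ?mulr1//; split => //; exact: Sx.
(* Fatou's lemma applied to the squares of u i - w' k as k grows. It also yields that the limit is
   in L2. *)
have H i e : (exists K, forall k, (K <= k)%N -> sqi (fun x => u i x - w k x) <= e) ->
    L2 (fun x => u i x - v x) /\ sqi (fun x => u i x - v x) <= e.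
  move=> [K KP]; apply: sqi_lty.
    by apply: measurable_funB => //; exact: (Lu i).1.
  pose f k x := ((u i x - w' (k + K)%N x) ^+ 2)%:E.
  have mf k : measurable_fun D (f k).
    by apply/measurable_EFinP; apply: measurable_funX; apply: measurable_funB => //; exact: (Lu i).1.
  rewrite (_ : (\int[mu]_(x in D) ((u i x - v x) ^+ 2)%:E)%E = (\int[mu]_(x in D) limn_einf (f ^~ x))%E); last first.
    apply: eq_integral => x _; apply/esym.
    have : f k x @[k --> \oo] --> ((u i x - v x) ^+ 2)%:E.
      apply: cvg_EFin; first by near=> k.
      rewrite /comp/=.
      under [X in X k @[k --> \oo] --> _]funext do rewrite expr2.
      rewrite expr2.
      have c1 : w' (k + K)%N x @[k --> \oo] --> v x by rewrite (cvg_shiftn K (fun k => w' k x)).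
      have c2 : u i x - w' (k + K)%N x @[k --> \oo] --> u i x - v x by apply: cvgB => //; exact: cvg_cst.
      exact: cvgM.
    by move=> /cvg_limn_einf_sup[].
  have f0 k x : D x -> (0 <= f k x)%E by move=> _; rewrite lee_fin sqr_ge0.
  apply: (le_trans (fatou mu mD mf f0)).
  rewrite limn_einf_lim; apply: lime_le; first exact: is_cvg_einfs.
  apply: nearW => k; apply: (@le_trans _ _ (\int[mu]_(x in D) f k x)%E).
    by apply: ereal_inf_lbound; exists k => /=.
  by rewrite aew' lee_fin KP// leq_addl.
have Lv : L2 v.
  have [|Lv _] := H 0%N (2 * sqi (u 0%N) + 2 * (2 * sqi (w 0%N) + 2 * r 0%N ^+ 2)).
    exists 0%N => k _; rewrite (le_trans (sqiD (Lu 0%N) (L2N (Lw k))))// lerD2l sqiN ler_pM2l//.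
    have -> : sqi (w k) = sqi (fun x => w 0%N x + (w k x - w 0%N x)).
      by apply: eq_sqi => x _; rewrite addrC subrK.
    rewrite (le_trans (sqiD (Lw 0%N) (L2B (Lw k) (Lw 0%N))))// lerD2l ler_pM2l//.
    have nmono : (n_ 0 <= n_ k)%N by elim: k => // k IHk; exact: leq_trans IHk (nS k).
    by apply: NP; [exact: leq_trans (nN 0%N) nmono|exact: nN].
  by apply: eq_L2 (L2B (Lu 0%N) Lv) => x _; rewrite subKr.
exists v; split => // e e0.
have [N0 N0P] := Cu e e0; exists N0 => i Ni.
suff [] : L2 (fun x => u i x - v x) /\ sqi (fun x => u i x - v x) <= e by [].
apply: H.
exists N0 => k Nk; apply: N0P => //; apply: leq_trans Nk _.
elim: k => // k IHk; apply: leq_ltn_trans IHk _.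
by rewrite {2}/n_ big_ord_recr/= addnS ltnS leq_addr.
Unshelve. all: by end_near. Qed.

End L2.

Section L2_on.
Context (R : realType) (n : nat).

Lemma L2_onP (Omega : set 'rV[R]_n) (u : 'rV[R]_n -> R) : measurable Omega ->
  L2_on Omega u <-> L2 (lebesgue_rV n) Omega u.
Proof.
move=> mO; have sqE : EFin \o (fun x => (u \_ Omega) x ^+ 2) = (EFin \o (fun x => u x ^+ 2)) \_ Omega.
  apply/funext => x /=; rewrite !patchE; case: ifP => //= _.
  by rewrite (_ : point = 0)// expr0n.
split=> [uO|[mu' iu]].
  split.
    by move: uO; rewrite /L2_on inE => /andP[]; rewrite inE/= => /(measurable_restrictT _ mO).
  have := Lfun2_integrable_sqr uO; rewrite sqE => iu.
  by apply/(integrable_mkcond _ mO).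
have mr : measurable_fun setT (u \_ Omega) by exact/(measurable_restrictT _ mO).
rewrite /L2_on inE; apply/andP; split; rewrite inE//=.
rewrite /finite_norm unlock /=; apply: poweR_lty.
have /integrableP[_] : (lebesgue_rV n).-integrable setT ((EFin \o (fun x => u x ^+ 2)) \_ Omega).
  exact/(integrable_mkcond _ mO).
rewrite -sqE; apply: le_lt_trans; rewrite le_eqVlt; apply/orP; left; apply/eqP.
apply: eq_integral => x _ /=.
by rewrite powR_mulrn// real_normK ?num_real// ger0_norm ?sqr_ge0.
Qed.

End L2_on.

Section L2_limits.
Context d (T : measurableType d) (R : realType) (mu : {measure set T -> \bar R}).
Context (D : set T) (mD : measurable D) (Doo : (mu D < +oo)%E).
Implicit Types (u v : T -> R).

Lemma L2_le u v : measurable_fun D u -> L2 mu D v -> (forall x, D x -> `|u x| <= `|v x|) ->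
  L2 mu D u /\ sqi mu D u <= sqi mu D v.
Proof.
move=> mu' Lv uv.
have le x : D x -> u x ^+ 2 <= v x ^+ 2.
  by move=> Dx; rewrite -(real_normK (num_real (u x))) -(real_normK (num_real (v x))) lerXn2r ?nnegrE ?uv.
have iu : mu.-integrable D (EFin \o (fun x => u x ^+ 2)).
  apply: (le_integrable mD _ _ Lv.2).
    by apply/measurable_EFinP; exact: measurable_funX.
  by move=> x Dx /=; rewrite lee_fin !ger0_norm ?sqr_ge0// le.
split; first by split.
by apply: le_Rintegral => //; exact: Lv.2.
Qed.

Lemma L2_dominated (f : nat -> T -> R) u h : (forall m, measurable_fun D (f m)) ->
  measurable_fun D u -> L2 mu D h ->
  (forall x, D x -> f ^~ x @ \oo --> u x) -> (forall m x, D x -> `|f m x| <= h x) ->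
  forall e, 0 < e -> exists m, sqi mu D (fun x => u x - f m x) <= e.
Proof.
move=> mf mu' Lh fu fh e e0.
have uh x : D x -> `|u x| <= h x.
  move=> Dx; have c : `|f m x| @[m --> \oo] --> `|u x| by apply: cvg_norm; exact: fu.
  by rewrite -(cvg_lim _ c)//; apply: limr_le; [exact: cvgP c|apply: nearW => m; exact: fh].
have mg m : measurable_fun D (EFin \o (fun x => (u x - f m x) ^+ 2)).
  by apply/measurable_EFinP; apply: measurable_funX; exact: measurable_funB.
have i4 := integrableZl mD 4 Lh.2.
have := @dominated_cvg _ _ _ mu D mD (fun m => EFin \o (fun x => (u x - f m x) ^+ 2))
  (cst 0%E) (fun x => (4 * h x ^+ 2)%:E) mg.
have b m x : D x -> (u x - f m x) ^+ 2 <= 4 * h x ^+ 2.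
  move=> Dx; have := uh x Dx; have := fh m x Dx; rewrite !ler_norml => /andP[a1 a2] /andP[b1 b2].
  rewrite (_ : 4 * h x ^+ 2 = (2 * h x) ^+ 2); last by ring.
  rewrite -subr_ge0 subr_sqr mulr_ge0//; lra.
have [c1 c2 c3 c4] : [/\ forall x, D x -> ((u x - f m x) ^+ 2)%:E @[m --> \oo] --> 0%E,
   forall x, D x -> (4 * h x ^+ 2)%:E \is a fin_num,
   mu.-integrable D (fun x => (4 * h x ^+ 2)%:E) &
   forall m x, D x -> (`|((u x - f m x) ^+ 2)%:E| <= (4 * h x ^+ 2)%:E)%E].
  split => //.
  - move=> x Dx; apply: cvg_EFin; first exact: nearW.
    rewrite /comp/=.
    have c : u x - f m x @[m --> \oo] --> u x - u x by apply: cvgB; [exact: cvg_cst|exact: fu].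
    have := cvgM c c; rewrite subrr mul0r; exact.
  - by move=> m x Dx /=; rewrite lee_fin ger0_norm ?sqr_ge0// b.
move=> /(_ c1 c2 c3 c4); rewrite integral0 => /fine_cvgP[_ /cvgrPdist_le/(_ e e0)[m _ /(_ m (leqnn m))]].
rewrite /= sub0r normrN ger0_norm; first by exists m.
by rewrite fine_ge0// integral_ge0// => x _; rewrite lee_fin sqr_ge0.
Qed.

End L2_limits.

(** * Density of Lipschitz functions in L2 *)

Section lipschitz_density.
Context (R : realType) (n : nat).
Local Notation mu := (@lebesgue_rV R n).
Context (V : set 'rV[R]_n) (mV : measurable V) (Voo : (mu V < +oo)%E).
Implicit Types (u v phi : 'rV[R]_n -> R) (A B : set 'rV[R]_n).

Definition lip_bound phi (C : R) := forall x y : 'rV[R]_n, `|phi x - phi y| <= C * `|x - y|.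

Definition lip_approx u := forall e, 0 < e -> exists phi C,
  [/\ bounded_mfun V phi, lip_bound phi C & sqi mu V (fun x => u x - phi x) <= e].

(** Values in [0, 1] allow a product of approximants to approximate the indicator of an
    intersection. *)
Let ind_approx A := measurable A /\ forall e, 0 < e -> exists phi C,
  [/\ measurable_fun V phi, forall x, 0 <= phi x <= 1, lip_bound phi C &
      sqi mu V (fun x => \1_A x - phi x) <= e].

Let bounded01 phi : measurable_fun V phi -> (forall x, 0 <= phi x <= 1) -> bounded_mfun V phi.
Proof.
move=> mphi p01; split => //; exists 1 => x _.
by have /andP[p0 p1] := p01 x; rewrite ger0_norm.
Qed.

Let L2_ind A : measurable A -> L2 mu V \1_A.
Proof.
move=> mA; apply: bounded_mfun_L2 => //; apply: bounded01; first exact: measurable_indic.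
by move=> x; rewrite indicE; case: (_ \in _); rewrite !lexx ler01.
Qed.

Let ind_approx0 : ind_approx set0.
Proof.
split => // e e0; exists (cst 0), 0; split => //.
- by move=> x; rewrite lexx ler01.
- by move=> x y; rewrite subrr normr0 mul0r.
rewrite (@eq_sqi _ _ _ mu V _ (cst 0)) => [|x _]; last by rewrite indic0 subrr.
by rewrite /sqi/= expr0n/= Rintegral_cst// mul0r ltW.
Qed.

Let ind_approxC A : ind_approx A -> ind_approx (~` A).
Proof.
move=> [mA HA]; split; first exact: measurableC.
move=> e /HA[phi [C [mphi p01 lphi sphi]]]; exists (fun x => 1 - phi x), C; split.
- exact: measurable_funB.
- by move=> x; have /andP[p0 p1] := p01 x; rewrite subr_ge0 p1/= gerBl.
- by move=> x y; rewrite (_ : _ - _ = - (phi x - phi y)) ?normrN//; ring.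
rewrite -sqiN (@eq_sqi _ _ _ mu V _ (fun x => \1_A x - phi x))// => x _.
by rewrite indicC indicE/=; case: (x \in A) => /=; ring.
Qed.

Let ind_approxI A B : ind_approx A -> ind_approx B -> ind_approx (A `&` B).
Proof.
move=> [mA HA] [mB HB]; split; first exact: measurableI.
move=> e e0; have e4 : 0 < e / 4 by rewrite divr_gt0.
have [phi [C [mphi p01 lphi sphi]]] := HA _ e4.
have [psi [C' [mpsi q01 lpsi spsi]]] := HB _ e4.
exists (fun x => phi x * psi x), (C + C'); split.
- exact: measurable_funM.
- move=> x; have /andP[p0 p1] := p01 x; have /andP[q0 q1] := q01 x.
  by rewrite mulr_ge0// mulr_ile1.
- move=> x y; rewrite (_ : _ - _ = psi x * (phi x - phi y) + phi y * (psi x - psi y)); last by ring.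
  rewrite (le_trans (ler_normD _ _))// !normrM mulrDl lerD//.
    by have /andP[q0 q1] := q01 x; rewrite (ger0_norm q0) -[leRHS]mul1r ler_pM.
  by have /andP[q0 q1] := p01 y; rewrite (ger0_norm q0) -[leRHS]mul1r ler_pM.
have L1 : L2 mu V (fun x => \1_A x - phi x).
  by apply: L2B => //; [exact: L2_ind|exact: bounded_mfun_L2 (bounded01 mphi p01)].
have L2' : L2 mu V (fun x => \1_B x - psi x).
  by apply: L2B => //; [exact: L2_ind|exact: bounded_mfun_L2 (bounded01 mpsi q01)].
have [|x _|La Sa] := @L2_le _ _ _ mu V mV (fun x => \1_A x * (\1_B x - psi x)) _ _ L2'.
- by apply: measurable_funM; [exact: measurable_indic|exact: L2'.1].
- rewrite normrM indicE; case: (_ \in _); rewrite ?normr1 ?mul1r//.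
  by rewrite normr0 mul0r.
have [|x _|Lb Sb] := @L2_le _ _ _ mu V mV (fun x => psi x * (\1_A x - phi x)) _ _ L1.
- by apply: measurable_funM => //; exact: L1.1.
- by have /andP[q0 q1] := q01 x; rewrite normrM (ger0_norm q0) ler_piMl.
rewrite (@eq_sqi _ _ _ mu V _ (fun x => \1_A x * (\1_B x - psi x) + psi x * (\1_A x - phi x))) => [|x _]; last first.
  by rewrite indicI/=; ring.
rewrite (le_trans (sqiD mV La Lb))//; lra.
Qed.

Let ind_approx_bigcup (F : nat -> set 'rV[R]_n) : (forall i, ind_approx (F i)) ->
  ind_approx (\bigcup_i F i).
Proof.
move=> HF; split; first by apply: bigcup_measurable => i _; exact: (HF i).1.
pose G m := ~` \big[setI/setT]_(i < m) ~` F i.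
have HG m : ind_approx (G m).
  apply: ind_approxC; elim: m => [|m IHm].
    by rewrite big_ord0 -setC0; exact: ind_approxC.
  by rewrite big_ord_recr/=; apply: ind_approxI => //; exact: ind_approxC.
have GE m x : G m x <-> exists2 i, (i < m)%N & F i x.
  rewrite /G -(bigcap_mkord m (fun i => ~` F i)); split.
    move=> h; apply: contrapT => h'; apply: h => i /= im Fix; apply: h'.
    by exists i.
  by move=> [i im Fix] /(_ i im).
have c x : \1_(G m) x @[m --> \oo] --> (\1_(\bigcup_i F i) x : R).
  apply: cvg_near_cst; case: (pselect ((\bigcup_i F i) x)) => [[i _ Fix]|nF].
    exists i.+1 => // m /= im; rewrite !indicE !mem_set//; first by exists i.
    by apply/GE; exists i.
  apply: nearW => m; rewrite !indicE !memNset// => /GE[i _ Fix]; apply: nF.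
  by exists i.
move=> e e0; have e4 : 0 < e / 4 by rewrite divr_gt0.
have mU : measurable (\bigcup_i F i) by apply: bigcup_measurable => i _; exact: (HF i).1.
have [m Hm] : exists m, sqi mu V (fun x => \1_(\bigcup_i F i) x - \1_(G m) x) <= e / 4.
  apply: (@L2_dominated _ _ _ mu V mV (fun m => \1_(G m)) _ (cst 1)) => //.
  - by move=> m; apply: measurable_indic; exact: (HG m).1.
  - exact: bounded_mfun_L2 (bounded_mfun_cst _ _).
  - by move=> m x _; rewrite indicE/=; case: (_ \in _); rewrite ?normr1 ?normr0.
have [phi [C [mphi p01 lphi sphi]]] := (HG m).2 _ e4.
exists phi, C; split => //.
rewrite (@eq_sqi _ _ _ mu V _ (fun x => (\1_(\bigcup_i F i) x - \1_(G m) x) + (\1_(G m) x - phi x))) => [|x _]; last first.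
  by rewrite addrA subrK.
have LG := L2_ind (HG m).1.
rewrite (le_trans (sqiD mV (L2B mV (L2_ind mU) LG) (L2B mV LG (bounded_mfun_L2 mV Voo (bounded01 mphi p01)))))//.
lra.
Qed.

Let clip (t : R) : R := Num.max 0 (Num.min t 1).

Let clip01 t : 0 <= clip t <= 1.
Proof. by rewrite /clip le_max lexx ge_max ler01 ge_min lexx orbT. Qed.

Let clip_lip s t : `|clip s - clip t| <= `|s - t|.
Proof.
wlog st : s t / s <= t.
  by move=> h; case: (leP s t) => [/h//|/ltW/h]; rewrite distrC [leRHS]distrC.
suff [h1 h2] : clip s <= clip t /\ clip t - clip s <= t - s.
  by rewrite distrC ger0_norm ?subr_ge0// distrC ger0_norm ?subr_ge0.
rewrite /clip; have [t1|t1] := leP t 1; have [s1|s1] := leP s 1;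
  have [t0|t0] := leP 0 t; have [s0|s0] := leP 0 s; rewrite ?(max_r ler01) ?(max_r t0) ?(max_r s0) ?(max_l (ltW t0)) ?(max_l (ltW s0)); lra.
Qed.

(** Ramps of slope m in the i-th coordinate converge pointwise to the indicator as m grows. *)
Let ind_approx_ray i (c : R) : ind_approx [set x : 'rV[R]_n | x ord0 i \in `]c, +oo[].
Proof.
set A := [set x | _].
have mA : measurable A.
  have := @measurable_coord_rV R n i measurableT _ (measurable_itv `]c, +oo[).
  by rewrite setTI.
split => // e e0.
pose f m (x : 'rV[R]_n) := clip (m%:R * (x ord0 i - c)).
have mf m : measurable_fun setT (f m).
  apply: measurable_maxr => //; apply: measurable_minr => //.
  apply: measurable_funM => //; apply: measurable_funB => //; exact: measurable_coord_rV.
have [m Hm] : exists m, sqi mu V (fun x => \1_A x - f m x) <= e.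
  apply: (@L2_dominated _ _ _ mu V mV f _ (cst 1)) => //.
  - by move=> m; exact: measurable_funTS (mf m).
  - exact: bounded_mfun_L2 (bounded_mfun_cst _ _).
  - move=> x _; apply: cvg_near_cst; rewrite indicE.
    case: (boolP (x \in A)) => [|] xA.
      move: xA; rewrite inE /A/= in_itv/= andbT -subr_gt0 => xc.
      near=> m; rewrite /f /clip min_r ?max_r//.
      rewrite -ler_pdivrMr// div1r; near: m; exact: nbhs_infty_ger.
    apply: nearW => m; rewrite /f /clip max_l// ge_min; apply/orP; left.
    rewrite mulr_ge0_le0// subr_le0 leNgt; apply: contra xA => xc.
    by rewrite inE /A/= in_itv/= xc.
  - by move=> m x _; have /andP[p0 p1] := clip01 (m%:R * (x ord0 i - c)); rewrite /f ger0_norm.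
exists (f m), m%:R; split => //; first exact: measurable_funTS (mf m).
  by move=> x; exact: clip01.
move=> x y; rewrite (le_trans (clip_lip _ _))// -mulrBr opprB addrA subrK normrM ger0_norm//.
by rewrite ler_wpM2l//; have := coord_le_norm (x - y) i; rewrite !mxE.
Unshelve. all: by end_near. Qed.

Let ind_approx_all A : measurable A -> ind_approx A.
Proof.
have sa : sigma_algebra setT ind_approx.
  split; [exact: ind_approx0| |exact: ind_approx_bigcup].
  by move=> B; rewrite setTD; exact: ind_approxC.
suff : g_sigma_preimage (@rV_coord R n) `<=` ind_approx by apply.
apply: smallest_sub => //.
move=> B; rewrite -bigcup_seq/= => -[i _ [Y mY <-]]; rewrite setTI.
(* A second generation argument, on the line: the sets [Y] with approximable preimage form a
   sigma-algebra containing the rays, hence all Borel sets. *)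
have sY : sigma_algebra setT (fun Y => ind_approx (@rV_coord R n i @^-1` Y)).
  split.
  - by rewrite preimage_set0; exact: ind_approx0.
  - by move=> Z hZ; rewrite setTD preimage_setC; exact: ind_approxC.
  - by move=> F hF; rewrite preimage_bigcup; exact: ind_approx_bigcup.
have : <<s @RGenOInfty.G R >> `<=` (fun Y => ind_approx (@rV_coord R n i @^-1` Y)).
  apply: smallest_sub => // _ [c ->]; exact: ind_approx_ray.
apply; move: mY; rewrite /measurable/= -[X in X Y -> _]/((@ocitv R).-sigma.-measurable).
by rewrite RGenOInfty.measurableE.
Qed.

Let lip_approxD u v : L2 mu V u -> L2 mu V v -> lip_approx u -> lip_approx v ->
  lip_approx (fun x => u x + v x).
Proof.
move=> Lu Lv Hu Hv e e0; have e4 : 0 < e / 4 by rewrite divr_gt0.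
have [phi [C [bphi lphi sphi]]] := Hu _ e4.
have [psi [C' [bpsi lpsi spsi]]] := Hv _ e4.
exists (fun x => phi x + psi x), (C + C'); split.
- exact: bounded_mfunD.
- by move=> x y; rewrite opprD addrACA (le_trans (ler_normD _ _))// mulrDl lerD.
rewrite (@eq_sqi _ _ _ mu V _ (fun x => (u x - phi x) + (v x - psi x))) => [|x _]; last by ring.
rewrite (le_trans (sqiD mV (L2B mV Lu (bounded_mfun_L2 mV Voo bphi)) (L2B mV Lv (bounded_mfun_L2 mV Voo bpsi))))//.
lra.
Qed.

Let lip_approxZ c u : L2 mu V u -> lip_approx u -> lip_approx (fun x => c * u x).
Proof.
move=> Lu Hu e e0; have c1 : 0 < c ^+ 2 + 1 by rewrite ltr_wpDl ?sqr_ge0.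
have [phi [C [bphi lphi sphi]]] := Hu _ (divr_gt0 e0 c1).
exists (fun x => c * phi x), (`|c| * C); split.
- exact: bounded_mfunZ.
- by move=> x y; rewrite -mulrBr normrM -mulrA ler_wpM2l.
rewrite (@eq_sqi _ _ _ mu V _ (fun x => c * (u x - phi x))) => [|x _]; last by ring.
rewrite sqiZ//; last exact: L2B Lu (bounded_mfun_L2 mV Voo bphi).
apply: (@le_trans _ _ ((c ^+ 2 + 1) * sqi mu V (fun x => u x - phi x))).
  by rewrite ler_wpM2r ?sqi_ge0// lerDl.
by rewrite mulrC -ler_pdivlMr.
Qed.

Let lip_approx_lim u : L2 mu V u ->
  (forall e, 0 < e -> exists v, [/\ L2 mu V v, lip_approx v & sqi mu V (fun x => u x - v x) <= e]) ->
  lip_approx u.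
Proof.
move=> Lu H e e0; have e4 : 0 < e / 4 by rewrite divr_gt0.
have [v [Lv Hv uv]] := H _ e4; have [phi [C [bphi lphi sphi]]] := Hv _ e4.
exists phi, C; split => //.
rewrite (@eq_sqi _ _ _ mu V _ (fun x => (u x - v x) + (v x - phi x))) => [|x _]; last by ring.
rewrite (le_trans (sqiD mV (L2B mV Lu Lv) (L2B mV Lv (bounded_mfun_L2 mV Voo bphi))))//.
lra.
Qed.

Let lip_approx_ind A : measurable A -> lip_approx \1_A.
Proof.
move=> /ind_approx_all[mA HA] e /HA[phi [C [mphi p01 lphi sphi]]].
by exists phi, C; split => //; exact: bounded01.
Qed.

Let lip_approx_ge0 u : L2 mu V u -> (forall x, V x -> 0 <= u x) -> lip_approx u.
Proof.
move=> Lu u0.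
have mEu : measurable_fun V (EFin \o u) by apply/measurable_EFinP; exact: Lu.1.
have [|g [ndg cg]] := approximation mV mEu; first by move=> x Vx; rewrite lee_fin u0.
have cgr x : V x -> g ^~ x @ \oo --> u x by move=> Vx; have /fine_cvgP[_] := cg x Vx.
have gu m x : V x -> g m x <= u x.
  move=> Vx; have c := cgr x Vx; rewrite -(cvg_lim _ c)//.
  apply: (@nondecreasing_cvgn_le _ (fun k => g k x)); last exact: cvgP c.
  by move=> i j ij; exact/lefP/ndg.
have mg m : measurable_fun setT (g m) by exact: measurable_funP.
have Lg m : L2 mu V (g m).
  have [//|x Vx|//] := @L2_le _ _ _ mu V mV (g m) u _ Lu; first exact: measurable_funTS (mg m).
  by rewrite !ger0_norm ?u0// gu.
have gunorm m x : V x -> `|g m x| <= u x by move=> Vx; rewrite ger0_norm ?gu.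
apply: lip_approx_lim => // e e0.
have [m Hm] := @L2_dominated _ _ _ mu V mV (fun m => g m) u u
   (fun m => measurable_funTS (mg m)) Lu.1 Lu cgr gunorm e e0.
exists (g m); split => //.
have mpre r : measurable (g m @^-1` [set r]).
  by have := mg m measurableT [set r] (measurable_set1 r); rewrite setTI.
have [N [r [B [mB gE]]]] : exists (N : nat) (r : nat -> R) (B : nat -> set 'rV[R]_n),
    (forall i, measurable (B i)) /\ forall x, g m x = \sum_(i < N) r i * \1_(B i) x.
  eexists; exists (fun i => (finmap.enum_fset (fset_set (g m @` setT)))`_i).
  exists (fun i => g m @^-1` [set (finmap.enum_fset (fset_set (g m @` setT)))`_i]).
  by split; [move=> i; exact: mpre|exact: fimfunEord].
rewrite (_ : (g m : 'rV[R]_n -> R) = (fun x => \sum_(i < N) r i * \1_(B i) x)); last exact/funext.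
suff [//] : L2 mu V (fun x => \sum_(i < N) r i * \1_(B i) x) /\
  lip_approx (fun x => \sum_(i < N) r i * \1_(B i) x).
elim: (index_enum _) => [|i l [IH1 IH2]].
  under [X in L2 _ _ X /\ _]funext do rewrite big_nil.
  under [X in _ /\ lip_approx X]funext do rewrite big_nil.
  have := lip_approx_ind measurable0; rewrite indic0 => h.
  by split => //; exact: bounded_mfun_L2 (bounded_mfun_cst _ _).
under [X in L2 _ _ X /\ _]funext do rewrite big_cons.
under [X in _ /\ lip_approx X]funext do rewrite big_cons.
have L1 := L2Z mV (r i) (L2_ind (mB i)).
split; first exact: L2D.
apply: lip_approxD => //; apply: lip_approxZ; first exact: L2_ind.
exact: lip_approx_ind.
Qed.

(* The sets whose indicator is an L2 limit of [0, 1]-valued Lipschitz functions form a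
   sigma-algebra, which contains the half-spaces bounded by coordinate hyperplanes. *)
Lemma lipschitz_dense u : L2 mu V u -> lip_approx u.
Proof.
move=> Lu.
have [|x _|Lp _] := @L2_le _ _ _ mu V mV (fun x => Num.max (u x) 0) u _ Lu.
- by apply: measurable_maxr => //; exact: Lu.1.
- by have [u0|u0] := leP (u x) 0; rewrite ?normr0.
have [|x _|Ln _] := @L2_le _ _ _ mu V mV (fun x => Num.max (- u x) 0) u _ Lu.
- apply: measurable_maxr => //; apply: measurableT_comp => //; exact: Lu.1.
- by have [u0|u0] := leP (- u x) 0; rewrite ?normr0 ?normrN.
rewrite (_ : u = fun x => Num.max (u x) 0 + (-1) * Num.max (- u x) 0); last first.
  by apply/funext => x; have [u0|u0] := leP (u x) 0; have [u1|u1] := leP (- u x) 0; lra.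
apply: lip_approxD => //; first exact: L2Z.
  by apply: lip_approx_ge0 => // x _; rewrite le_max lexx orbT.
apply: lip_approxZ => //; apply: lip_approx_ge0 => // x _; by rewrite le_max lexx orbT.
Qed.

End lipschitz_density.

(** * Averaging over small cubes *)

Lemma Rintegral_sum d (T : measurableType d) (R : realType)
    (mu : {measure set T -> \bar R}) (D : set T) (I : Type) (s : seq I) (F : I -> T -> R) :
  measurable D -> (forall i, mu.-integrable D (EFin \o F i)) ->
  mu.-integrable D (EFin \o (fun x => \sum_(i <- s) F i x)) /\
  \int[mu]_(x in D) (\sum_(i <- s) F i x) = \sum_(i <- s) \int[mu]_(x in D) F i x.
Proof.
move=> mD iF; elim: s => [|i s [IHs1 IHs2]].
  rewrite big_nil; under [X in Rintegral _ _ X = _]funext do rewrite big_nil.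
  split; last by rewrite Rintegral_cst// mul0r.
  rewrite (_ : EFin \o _ = cst 0%E); first exact: integrable0.
  by apply/funext => x /=; rewrite big_nil.
have E : EFin \o (fun x => \sum_(j <- i :: s) F j x) =
    (EFin \o F i) \+ (EFin \o (fun x => \sum_(j <- s) F j x)).
  by apply/funext => x /=; rewrite big_cons EFinD.
split; first by rewrite E; exact: integrableD.
under [X in Rintegral _ _ X = _]funext do rewrite big_cons.
by rewrite RintegralD// big_cons IHs2.
Qed.

Lemma derive_bounded_lip (R : realType) (f f' : R -> R) (C : R) :
  (forall t, is_derive t (1:R) f (f' t)) -> (forall t, `|f' t| <= C) ->
  forall t h, `|f (t + h) - f t| <= C * `|h|.
Proof.
move=> df fC t h.
have cf a b : {within `[a, b], continuous f}.
  apply: continuous_subspaceT => x; apply/differentiable_continuous/derivable1_diffP.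
  by have [] := df x.
have [h0|h0] := leP 0 h.
  have [|c _ ->] := @MVT_segment R f f' t (t + h) _ (fun x _ => df x) (@cf _ _); first by rewrite lerDl.
  by rewrite addrAC subrr add0r normrM ler_wpM2r.
have [|c _ E] := @MVT_segment R f f' (t + h) t _ (fun x _ => df x) (@cf _ _); first by rewrite gerDl ltW.
by rewrite distrC E opprD addrA subrr sub0r normrM normrN ler_wpM2r.
Qed.

Lemma derive_bounded_taylor (R : realType) (f f' f'' : R -> R) (C : R) :
  (forall t, is_derive t (1:R) f (f' t)) -> (forall t, is_derive t (1:R) f' (f'' t)) ->
  (forall t, `|f'' t| <= C) ->
  forall t h, `|f (t + h) - f t - f' t * h| <= C * h ^+ 2.
Proof.
move=> df df' fC t h.
have C0 : 0 <= C by exact: le_trans (fC 0).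
have lip := derive_bounded_lip df' fC.
have cf a b : {within `[a, b], continuous f}.
  apply: continuous_subspaceT => x; apply/differentiable_continuous/derivable1_diffP.
  by have [] := df x.
have hh : C * h ^+ 2 = C * `|h| * `|h| by rewrite -mulrA -expr2 real_normK// num_real.
have K c : `|c - t| <= `|h| -> `|f' c * h - f' t * h| <= C * h ^+ 2.
  move=> ct; rewrite -mulrBl normrM hh ler_wpM2r//.
  have := lip t (c - t); rewrite (_ : t + (c - t) = c); last by ring.
  move=> /le_trans; apply.
  by rewrite ler_wpM2l.
have [h0|h0] := leP 0 h.
  have [|c] := @MVT_segment R f f' t (t + h) _ (fun x _ => df x) (@cf _ _); first by rewrite lerDl.
  rewrite in_itv/= => /andP[tc ch] ->.
  rewrite addrAC subrr add0r; apply: K.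
  by rewrite (ger0_norm h0) ger0_norm ?subr_ge0// lerBlDl.
have [|c] := @MVT_segment R f f' (t + h) t _ (fun x _ => df x) (@cf _ _); first by rewrite gerDl ltW.
rewrite in_itv/= => /andP[tc ch] E.
rewrite -[f (t + h) - f t]opprB E opprD addrA subrr sub0r mulrN opprK; apply: K.
by rewrite (ltr0_norm h0) ler0_norm ?subr_le0//; lra.
Qed.

Lemma lip_continuous (R : realType) (V : normedModType R) (f : V -> R) (y : V) (C : R) :
  (forall z, `|z - y| <= 1 -> `|f z - f y| <= C * `|z - y|) -> {for y, continuous f}.
Proof.
move=> H; apply/cvgrPdist_le => /= e e0.
have C1 : 0 < `|C| + 1 by rewrite ltr_wpDl.
near=> z.
have zy1 : `|z - y| <= 1 by rewrite distrC; near: z; exact: cvgr_dist_le.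
rewrite distrC (le_trans (H z zy1))//.
apply: (@le_trans _ _ ((`|C| + 1) * `|z - y|)).
  by rewrite ler_wpM2r// (le_trans (ler_norm C))// lerDl.
rewrite mulrC -ler_pdivlMr// distrC; near: z; apply: cvgr_dist_le => //.
by rewrite divr_gt0.
Unshelve. all: by end_near. Qed.

(** * Uniform second-order Taylor bounds for a product bump *)

Section taylor2.
Context (R : realType) (n : nat).
Implicit Types (F G : 'rV[R]_n -> R) (DF DG : 'I_n -> 'rV[R]_n -> R).

(** One constant controls the size, the Lipschitz constant, the linear part and the remainder,
    because this package is stable under products and passes from one-variable bumps to [eta].
    Squares keep the Euclidean norm free of square roots. *)
Definition taylor2 F DF (B : R) := [/\ 0 <= B,
  forall p, `|F p| <= B,
  forall p h : 'rV[R]_n, (F (h + p) - F p) ^+ 2 <= B * sqn h,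
  forall p h : 'rV[R]_n, (\sum_j DF j p * h ord0 j) ^+ 2 <= B * sqn h &
  forall p h : 'rV[R]_n, `|F (h + p) - F p - \sum_j DF j p * h ord0 j| <= B * sqn h].

Lemma taylor2M F DF B G DG C : taylor2 F DF B -> taylor2 G DG C ->
  exists B', taylor2 (fun p => F p * G p) (fun j p => F p * DG j p + G p * DF j p) B'.
Proof.
move=> [B0 FB FL FD FT] [C0 GC GL GD GT].
have BC0 : 0 <= B * C by exact: mulr_ge0.
have BBC0 : 0 <= B ^+ 2 * C by rewrite mulr_ge0// sqr_ge0.
have CCB0 : 0 <= C ^+ 2 * B by rewrite mulr_ge0// sqr_ge0.
have sumE (p h : 'rV[R]_n) : \sum_j (F p * DG j p + G p * DF j p) * h ord0 j =
   F p * (\sum_j DG j p * h ord0 j) + G p * (\sum_j DF j p * h ord0 j).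
  by rewrite !mulr_sumr -big_split/=; apply: eq_bigr => j _; ring.
exists (2 * (B ^+ 2 * C) + 2 * (C ^+ 2 * B) + 2 * (B * C) + B + C); split.
- lra.
- move=> p; rewrite normrM (le_trans (ler_pM _ _ (FB p) (GC p)))//; lra.
- move=> p h; have := FL p h; have := GL p h.
  have := FB (h + p); have := GC p; have := sqn_ge0 h.
  move: (F (h + p)) (F p) (G (h + p)) (G p) (sqn h) => f' f g' g s s0.
  rewrite -ler_sqr ?nnegrE// => g1; rewrite -ler_sqr ?nnegrE// => f1 h1 h2.
  rewrite !real_normK ?num_real// in g1 f1.
  rewrite (_ : f' * g' - f * g = f' * (g' - g) + g * (f' - f)); last by ring.
  have k1 : f' ^+ 2 * (g' - g) ^+ 2 <= B ^+ 2 * (C * s) by rewrite ler_pM ?sqr_ge0.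
  have k2 : g ^+ 2 * (f' - f) ^+ 2 <= C ^+ 2 * (B * s) by rewrite ler_pM ?sqr_ge0.
  have := sqr_ge0 (f' * (g' - g) - g * (f' - f)).
  have := mulr_ge0 BC0 s0; have := mulr_ge0 B0 s0; have := mulr_ge0 C0 s0.
  move: k1 k2; rewrite -!exprMn => k1 k2 j1 j2 j3 j4; clear -k1 k2 j1 j2 j3 j4; lra.
- move=> p h; rewrite sumE; have := FD p h; have := GD p h.
  have := FB p; have := GC p; have := sqn_ge0 h.
  move: (\sum_j _) (\sum_j _) (F p) (G p) (sqn h) => a b f g s s0.
  rewrite -ler_sqr ?nnegrE// => g1; rewrite -ler_sqr ?nnegrE// => f1 h1 h2.
  rewrite !real_normK ?num_real// in g1 f1.
  have k1 : f ^+ 2 * b ^+ 2 <= B ^+ 2 * (C * s) by rewrite ler_pM ?sqr_ge0.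
  have k2 : g ^+ 2 * a ^+ 2 <= C ^+ 2 * (B * s) by rewrite ler_pM ?sqr_ge0.
  have := sqr_ge0 (f * b - g * a).
  have := mulr_ge0 BC0 s0; have := mulr_ge0 B0 s0; have := mulr_ge0 C0 s0.
  move: k1 k2; rewrite -!exprMn => k1 k2 j1 j2 j3 j4; clear -k1 k2 j1 j2 j3 j4; lra.
move=> p h; rewrite sumE; have := FL p h; have := GD p h; have := FT p h; have := GT p h.
have := FB (h + p); have := GC p; have := sqn_ge0 h.
move: (\sum_j _) (\sum_j _) (F (h + p)) (F p) (G (h + p)) (G p) (sqn h) => a b f' f g' g s s0 g1 f1 h1 h2 h3 h4.
rewrite (_ : f' * g' - f * g - (f * b + g * a) = f' * (g' - g - b) + (f' - f) * b + g * (f' - f - a)); last by ring.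
rewrite (le_trans (ler_normD _ _))// (le_trans (lerD (ler_normD _ _) (lexx _)))//.
have k1 : `|f' * (g' - g - b)| <= B * (C * s) by rewrite normrM ler_pM.
have k2 : `|g * (f' - f - a)| <= C * (B * s) by rewrite normrM ler_pM.
have k3 : `|(f' - f) * b| <= (B * s + C * s).
  have := sqr_ge0 (`|f' - f| - `|b|); rewrite normrM sqrrB !real_normK ?num_real//.
  have : 0 <= `|f' - f| * `|b| by exact: mulr_ge0.
  move: (`|f' - f| * `|b|) => z; clear -h3 h4; rewrite -mulr_natl; lra.
have := mulr_ge0 BC0 s0; have := mulr_ge0 BBC0 s0; have := mulr_ge0 CCB0 s0.
move=> j1 j2 j3; clear -k1 k2 k3 j1 j2 j3; lra.
Qed.

Lemma taylor2_coord (b b' b'' : R -> R) (C : R) i : 0 <= C ->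
  (forall t, is_derive t (1:R) b (b' t)) -> (forall t, is_derive t (1:R) b' (b'' t)) ->
  (forall t, `|b t| <= C) -> (forall t, `|b' t| <= C) -> (forall t, `|b'' t| <= C) ->
  taylor2 (fun p => b (p ord0 i)) (fun j p => (j == i)%:R * b' (p ord0 i)) (C + C ^+ 2).
Proof.
move=> C0 db db' bC b'C b''C.
have CC : 0 <= C ^+ 2 by exact: sqr_ge0.
have sumE p (h : 'rV[R]_n) : \sum_j (j == i)%:R * b' (p ord0 i) * h ord0 j = b' (p ord0 i) * h ord0 i.
  rewrite (bigD1 i)//= eqxx mul1r big1 ?addr0// => j /negbTE ->.
  by rewrite !mul0r.
have sq (x y : R) (h : 'rV[R]_n) : `|x| <= C * `|y| -> y ^+ 2 <= sqn h -> x ^+ 2 <= (C + C ^+ 2) * sqn h.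
  move=> xy yh; have : `|x| ^+ 2 <= (C * `|y|) ^+ 2 by rewrite ler_sqr ?nnegrE// mulr_ge0.
  rewrite exprMn !real_normK ?num_real// => /le_trans; apply.
  rewrite ler_pM ?sqr_ge0//; lra.
split.
- exact: addr_ge0.
- move=> p; rewrite (le_trans (bC _))//; lra.
- move=> p h; apply: (sq _ (h ord0 i)); last exact: ler_sqn.
  by rewrite mxE addrC; exact: derive_bounded_lip db b'C _ _.
- move=> p h; rewrite sumE; apply: (sq _ (h ord0 i)); last exact: ler_sqn.
  by rewrite normrM ler_wpM2r.
move=> p h; rewrite sumE mxE [h ord0 i + _]addrC.
rewrite (le_trans (derive_bounded_taylor db db' b''C _ _))//.
rewrite ler_pM ?sqr_ge0// ?ler_sqn//; lra.
Qed.

Lemma taylor2_derive F DF B p j : taylor2 F DF B -> is_derive p (delta_mx 0 j) F (DF j p).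
Proof.
move=> [_ _ _ _ FT]; apply: (@is_derive_quadratic _ _ _ _ _ _ B) => t _.
have := FT p (t *: delta_mx 0 j).
have -> : \sum_i DF i p * (t *: delta_mx 0 j : 'rV[R]_n) ord0 i = t * DF j p.
  rewrite (bigD1 j)//= !mxE !eqxx mulr1 mulrC big1 ?addr0// => i /negbTE ij.
  by rewrite !mxE ij andbF !mulr0.
by rewrite sqnZ (_ : sqn (delta_mx 0 j) = 1) ?mulr1// /sqn (bigD1 j)//= !mxE !eqxx expr1n big1 ?addr0// => i /negbTE ij;
  rewrite !mxE ij andbF expr0n.
Qed.

Definition eta : 'rV[R]_n -> R := coord_prod (fun=> @cbump R) (fun=> 0%N).
Definition deta j : 'rV[R]_n -> R := coord_prod (fun=> @cbump R) (fun i => (i == j) + 0)%N.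

(** The induction over the coordinates yields some linear part [DF]; it equals [deta] because both
    are the partial derivatives of [eta]. *)
Lemma eta_taylor2 : exists B, taylor2 eta deta B.
Proof.
have [C0 C00 HC0] := bump_bounded R 0; have [C1 C10 HC1] := bump_bounded R 1.
have [C2 C20 HC2] := bump_bounded R 2.
have [DF [B T]] : exists DF B, taylor2 eta DF B.
  rewrite /eta /coord_prod; elim: (index_enum _) => [|i s [DF [B IHs]]].
    exists (fun _ _ => 0), 1; under [X in taylor2 X]funext do rewrite big_nil.
    have s0 (h : 'rV[R]_n) : \sum_j 0 * h ord0 j = 0 by rewrite big1// => j _; rewrite mul0r.
    by split => // [p|p h|p h|p h]; rewrite ?normr1 ?s0 ?subrr ?subr0 ?expr0n ?normr0 ?mul1r ?sqn_ge0.
  have h := @taylor2_coord (@cbump R 0) (@cbump R 1) (@cbump R 2) (C0 + C1 + C2) i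
     (addr_ge0 (addr_ge0 C00 C10) C20) (@is_derive_bump R 0) (@is_derive_bump R 1).
  have [B' TB] : exists B', taylor2 (fun p => cbump 0 (p ord0 i) * \prod_(j <- s) cbump 0 (p ord0 j))
      (fun j p => cbump 0 (p ord0 i) * DF j p + (\prod_(j <- s) cbump 0 (p ord0 j)) * ((j == i)%:R * cbump 1 (p ord0 i))) B'.
    apply: taylor2M IHs; apply: h.
    + by move=> t; rewrite (le_trans (HC0 t))//; lra.
    + by move=> t; rewrite (le_trans (HC1 t))//; lra.
    + by move=> t; rewrite (le_trans (HC2 t))//; lra.
  eexists; exists B'; under [X in taylor2 X]funext do rewrite big_cons.
  exact: TB.
exists B; rewrite (_ : deta = DF)//.
apply/funext => j; apply/funext => p.
have [_ <-] := taylor2_derive p j T.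
by have [_ ->] := is_derive_coord_prod (fun=> @is_derive_bump R) (fun=> 0%N) j p.
Qed.

Lemma taylor_continuous (f : 'rV[R]_n -> R) (c : 'I_n -> 'rV[R]_n -> R) (M : R) :
  (forall y y', `|f y' - f y - \sum_j c j y * (y' - y) ord0 j| <= M * sqn (y' - y)) ->
  continuous f.
Proof.
move=> fT y.
pose C := \sum_j `|c j y| + `|M| * n%:R.
apply: (@lip_continuous _ 'rV[R]_n f y C) => z zy.
rewrite (_ : f z - f y = (f z - f y - \sum_j c j y * (z - y) ord0 j) + \sum_j c j y * (z - y) ord0 j); last by rewrite subrK.
rewrite (le_trans (ler_normD _ _))// /C mulrDl addrC lerD//.
  rewrite (le_trans (ler_norm_sum _ _ _))// mulr_suml; apply: ler_sum => j _.
  by rewrite normrM ler_wpM2l// coord_le_norm.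
apply: (le_trans (fT y z)); apply: (@le_trans _ _ (`|M| * sqn (z - y))).
  by rewrite ler_wpM2r ?sqn_ge0// ler_norm.
rewrite -mulrA ler_wpM2l// mulr_natl -[X in _ *+ X]card_ord -sumr_const; apply: ler_sum => j _.
rewrite -[leLHS]ger0_norm ?sqr_ge0// normrX expr2.
have zj := coord_le_norm (z - y) j.
rewrite (le_trans (ler_pM _ _ zj zj))//.
by rewrite ler_piMr.
Qed.

End taylor2.

Lemma lebesgue_rV_ball_gt0 (R : realType) n (c : 'rV[R]_n) (r : R) : 0 < r ->
  (0 < lebesgue_rV n (ball c r))%E.
Proof. by move=> r0; rewrite lebesgue_rV_ball// lte_fin exprn_gt0// pmulrn_lgt0. Qed.

Lemma lebesgue_rV_ball_lty (R : realType) n (c : 'rV[R]_n) (r : R) : 0 < r ->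
  (lebesgue_rV n (ball c r) < +oo)%E.
Proof. by move=> r0; rewrite lebesgue_rV_ball// ltry. Qed.

(** * The averaging kernel *)

Section kernel.
Context (R : realType) (n : nat).
Local Notation mu := (@lebesgue_rV R n).
Implicit Types (Omega : set 'rV[R]_n) (u v : 'rV[R]_n -> R) (y w p : 'rV[R]_n).

Lemma eta_ge0 p : 0 <= eta p.
Proof. by apply: prodr_ge0 => i _; exact: bump_ge0. Qed.

Lemma bump_prod_out c p : ~ (forall i, 0 <= p ord0 i <= 1) ->
  coord_prod (fun=> @cbump R) c p = 0.
Proof.
move=> hp; have [i hi] : exists i, ~~ (0 <= p ord0 i <= 1).
  by apply: contrapT => h; apply: hp => i; apply: contrapT => /negP hi; apply: h; exists i.
rewrite /coord_prod (bigD1 i)//= bump_out ?mul0r//.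
by apply: contra hi => /andP[? ?]; rewrite !ltW.
Qed.

Lemma eta_out p : ~ (forall i, 0 <= p ord0 i <= 1) -> eta p = 0.
Proof. exact: bump_prod_out. Qed.

Lemma continuous_eta : continuous (@eta R n).
Proof. by apply: continuous_coord_prod => _ k t; exact: is_derive_bump. Qed.

Lemma continuous_deta j : continuous (@deta R n j).
Proof. by apply: continuous_coord_prod => _ k t; exact: is_derive_bump. Qed.

Lemma measurable_eta : measurable_fun setT (@eta R n).
Proof. apply: continuous_measurable_fun_rV; exact: continuous_eta. Qed.

Lemma measurable_deta j : measurable_fun setT (@deta R n j).
Proof. apply: continuous_measurable_fun_rV; exact: continuous_deta. Qed.

Definition Zeta : R := \int[mu]_p eta p.

Lemma EFin_Zeta : (Zeta%:E = \int[mu]_p (eta p)%:E)%E.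
Proof.
rewrite /Zeta EFin_Rintegral//.
pose Q : set 'rV[R]_n := ball 0 2.
have mQ : measurable Q by exact: measurable_ball_rV.
have [B [_ HB _ _ _]] := @eta_taylor2 R n.
have : mu.-integrable Q (EFin \o @eta R n).
  apply: bounded_mfun_integrable => //; first exact: lebesgue_rV_ball_lty.
  by split; [exact: measurable_funTS measurable_eta|exists B => x _].
move=> /(integrable_mkcond _ mQ); congr (integrable _ _ _); apply/funext => p /=.
rewrite patchE; case: ifPn => // /negP pQ; rewrite eta_out// => h; apply: pQ; rewrite inE.
split => // i j; rewrite ord1 mxE /ball/= sub0r normrN.
by have /andP[h0 h1] := h j; rewrite ger0_norm// (le_lt_trans h1)// ltr1n.
Qed.

Lemma Zeta_gt0 : 0 < Zeta.
Proof.
rewrite -lte_fin EFin_Zeta.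
pose c : 'rV[R]_n := const_mx 2^-1; pose Q := ball c 4^-1.
have mQ : measurable Q by exact: measurable_ball_rV.
have q0 : 0 < (4^-1 : R) by rewrite invr_gt0.
(* On the cube [Q] each coordinate t satisfies t >= 1/4 and 1 - t >= 1/4, so that exp (- 1/t - 1/(1
   - t)) >= exp (-8). *)
pose m : R := expR (- 8) ^+ n.
have etaQ p : Q p -> m <= eta p.
  move=> [_ Qp]; rewrite /eta /coord_prod /m -[X in expR _ ^+ X]card_ord -prodr_const.
  apply: ler_prod => i _; rewrite expR_ge0/=.
  have := Qp ord0 i; rewrite /ball/= mxE => /ltr_normlP[h1 h2].
  move: (p ord0 i) h1 h2 => t h1 h2.
  have t4 : 4^-1 <= t by lra.
  have t4' : 4^-1 <= 1 - t by lra.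
  have iv s : 4^-1 <= s -> s^-1 <= 4 :> R.
    by move=> s4; rewrite -[leRHS]invrK lef_pV2 ?posrE ?invr_gt0//; exact: lt_le_trans s4.
  rewrite /cbump /thetas big_seq1 /theta/= (lt_le_trans q0 t4) (lt_le_trans q0 t4').
  rewrite !hornerC !mul1r -expRD ler_expR.
  by have := iv _ t4; have := iv _ t4'; lra.
apply: (@lt_le_trans _ _ (\int[mu]_(p in Q) (m%:E))%E).
  rewrite integral_cst// mule_gt0 ?lte_fin ?exprn_gt0 ?expR_gt0//.
  exact: lebesgue_rV_ball_gt0.
apply: (@le_trans _ _ (\int[mu]_(p in Q) (eta p)%:E)%E).
  apply: ge0_le_integral => //.
  - by move=> p _; rewrite lee_fin exprn_ge0// expR_ge0.
  - by apply/measurable_EFinP; exact: measurable_funTS measurable_eta.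
apply: ge0_subset_integral => //.
- by apply/measurable_EFinP; exact: measurable_eta.
- by move=> p _; rewrite lee_fin eta_ge0.
Qed.

(* As a function of w, carried by the cube of points tau y + b + p / kap, p in the unit cube. *)
Definition ker (kap tau : R) (b y w : 'rV[R]_n) : R := eta (kap *: (w - tau *: y - b)).

Definition kerN (kap tau : R) b Omega u y : R := \int[mu]_(w in Omega) (u w * ker kap tau b y w).

Lemma ker_ge0 kap tau b y w : 0 <= ker kap tau b y w.
Proof. exact: eta_ge0. Qed.

Lemma ker_affineE kap tau b y w :
  kap *: (w - tau *: y - b) = kap *: w + (- kap *: (tau *: y + b)).
Proof. by rewrite -addrA -opprD scalerBr scaleNr. Qed.

Lemma bounded_ker (F : 'rV[R]_n -> R) kap tau b y D :
  measurable_fun setT F -> (exists B : R, forall p, `|F p| <= B) -> measurable D ->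
  bounded_mfun D (fun w => F (kap *: (w - tau *: y - b))).
Proof.
move=> mF [B FB] mD; split; last by exists B.
apply: measurable_funTS; under [X in measurable_fun _ X]funext do rewrite ker_affineE.
apply: (@measurableT_comp _ _ _ _ _ _ F) => //; exact: measurable_affine_rV.
Qed.

Lemma bounded_eta : exists B : R, forall p : 'rV[R]_n, `|eta p| <= B.
Proof. by have [B [_ HB _ _ _]] := @eta_taylor2 R n; exists B. Qed.

Lemma bounded_deta j : exists B : R, forall p : 'rV[R]_n, `|deta j p| <= B.
Proof.
have [B [B0 _ _ HB _]] := @eta_taylor2 R n; exists (B + 1) => p.
have := HB p (delta_mx 0 j).
rewrite (bigD1 j)//= !mxE !eqxx mulr1 big1 ?addr0; last first.
  by move=> i /negbTE ij; rewrite !mxE ij andbF mulr0.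
rewrite (_ : sqn (delta_mx 0 j) = 1); last first.
  rewrite /sqn (bigD1 j)//= !mxE !eqxx expr1n big1 ?addr0// => i /negbTE ij.
  by rewrite !mxE ij andbF expr0n.
rewrite mulr1 -real_normK ?num_real// => h.
rewrite -(@ler_pXn2r _ 2)// ?nnegrE ?addr_ge0//.
by rewrite (le_trans h)//; nra.
Qed.

Lemma integrable_mul_ker (F : 'rV[R]_n -> R) kap tau b y Omega u :
  measurable Omega -> mu.-integrable Omega (EFin \o u) ->
  measurable_fun setT F -> (exists B : R, forall p, `|F p| <= B) ->
  mu.-integrable Omega (EFin \o (fun w => u w * F (kap *: (w - tau *: y - b)))).
Proof.
move=> mO iu mF FB; have [mk [B kB]] := bounded_ker kap tau b y mF FB mO.
have := @integrableMl _ _ _ mu Omega mO _ (fun w => F (kap *: (w - tau *: y - b))) iu mk.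
by apply; exists B; split; [exact: num_real|move=> M BM x Ox /=; rewrite (le_trans (kB x Ox))// ltW].
Qed.

(** Passing from y to y' shifts the argument of [eta] by - kap tau (y' - y), so the Taylor bound of
    [eta], integrated against |u|, gives the estimate. It replaces differentiation under the
    integral sign. *)
Lemma kerN_taylor kap tau b Omega u : measurable Omega ->
  mu.-integrable Omega (EFin \o u) ->
  exists M, forall y y', `|kerN kap tau b Omega u y' - kerN kap tau b Omega u y -
    \sum_j (- kap * tau * \int[mu]_(w in Omega) (u w * deta j (kap *: (w - tau *: y - b)))) *
      (y' - y) ord0 j| <= M * sqn (y' - y).
Proof.
move=> mO iu; have [B [B0 _ _ _ HB]] := @eta_taylor2 R n.
exists (B * (kap * tau) ^+ 2 * \int[mu]_(w in Omega) `|u w|) => y y'.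
pose q y w := kap *: (w - tau *: y - b).
pose h := - (kap * tau) *: (y' - y).
have qE w : q y' w = h + q y w.
  by apply/rowP => j; rewrite /q /h !mxE; ring.
have i1 y0 := integrable_mul_ker kap tau b y0 mO iu measurable_eta bounded_eta.
have i2 j := integrable_mul_ker kap tau b y mO iu (measurable_deta j) (bounded_deta j).
have i3 j := integrableZl mO (h ord0 j) (i2 j).
have [i4 s4] := @Rintegral_sum _ _ _ mu Omega _ (index_enum 'I_n)
   (fun j w => h ord0 j * (u w * deta j (q y w))) mO i3.
have i5 := integrableB mO (i1 y') (i1 y).
have E : kerN kap tau b Omega u y' - kerN kap tau b Omega u y -
    \sum_j (- kap * tau * \int[mu]_(w in Omega) (u w * deta j (kap *: (w - tau *: y - b)))) * (y' - y) ord0 j =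
    \int[mu]_(w in Omega) ((u w * eta (q y' w) - u w * eta (q y w)) - \sum_j h ord0 j * (u w * deta j (q y w))).
  rewrite RintegralB// RintegralB ?i1//; congr (_ - _).
  rewrite s4; apply: eq_bigr => j _.
  rewrite (RintegralZl (h ord0 j) mO (i2 j)).
  by rewrite /h !mxE; ring.
rewrite E.
have i6 := integrableB mO i5 i4.
apply: (le_trans (le_normr_Rintegral mO i6)).
rewrite [leRHS](_ : _ = (B * (kap * tau) ^+ 2 * sqn (y' - y)) * \int[mu]_(w in Omega) `|u w|); last by ring.
have iau : mu.-integrable Omega (EFin \o (fun w => `|u w|)) by exact: integrable_norm.
rewrite -RintegralZl//.
apply: le_Rintegral => //.
- exact: (integrable_norm i6).
- exact: (integrableZl mO (B * (kap * tau) ^+ 2 * sqn (y' - y)) iau).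
move=> w Ow; rewrite -mulrBr.
rewrite (_ : \sum_j _ = u w * \sum_j deta j (q y w) * h ord0 j); last first.
  by rewrite mulr_sumr; apply: eq_bigr => j _; ring.
rewrite -mulrBr normrM -/(q y' w) -/(q y w) qE mulrC ler_wpM2r//.
rewrite (le_trans (HB (q y w) h))// /h sqnZ sqrrN.
by rewrite le_eqVlt; apply/orP; left; apply/eqP; ring.
Qed.

End kernel.

Lemma bernoulli_ge (R : realType) n (s : R) : 0 <= s <= 1 -> 1 - n%:R * s <= (1 - s) ^+ n.
Proof.
move=> /andP[s0 s1]; elim: n => [|n IHn]; first by rewrite mul0r subr0 expr0.
have h0 : 0 <= 1 - s by rewrite subr_ge0.
rewrite exprS; apply: (@le_trans _ _ ((1 - s) * (1 - n%:R * s))); last by rewrite ler_wpM2l.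
have : 0 <= n%:R * (s * s) by rewrite mulr_ge0// mulr_ge0.
by rewrite -natr1; lra.
Qed.

Lemma L2_subset d (T : measurableType d) (R : realType) (mu : {measure set T -> \bar R})
    (A B : set T) (u : T -> R) :
  measurable A -> measurable B -> A `<=` B -> L2 mu B u -> L2 mu A u.
Proof.
move=> mA mB AB [mu' iu]; split; first exact: measurable_funS mu'.
exact: integrableS iu.
Qed.

(** * Averages on a convex set, and its Poincare inequality *)

Section average.
Context (R : realType) (n : nat).
Local Notation mu := (@lebesgue_rV R n).
Context (V : set 'rV[R]_n) (a : 'rV[R]_n) (ell : R).
Hypothesis mV : measurable V.
Hypothesis Voo : (mu V < +oo)%E.
Hypothesis V_convex : convex_rV V.
Hypothesis ell_gt0 : 0 < ell.
Hypothesis V_cube : forall p : 'rV[R]_n, (forall i, 0 <= p ord0 i <= 1) -> V (a + ell *: p).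
Implicit Types (s : R) (u v f : 'rV[R]_n -> R) (x y w p : 'rV[R]_n).

Let K s y w : R := ker (s * ell)^-1 (1 - s) (s *: a) y w.
Let KN s u y : R := kerN (s * ell)^-1 (1 - s) (s *: a) V u y.
Let W s : R := (s * ell) ^+ n * Zeta R n.

(* A weighted average of [u] over (1 - s) y + s Q, where Q = a + [0, ell]^n; this cube lies
   in [V] whenever y does, so that averaging preserves L2(V). *)
Definition avg s u y : R := KN s u y / W s.

Lemma kernel_point s y w : 0 < s ->
  w = (1 - s) *: y + s *: (a + ell *: ((s * ell)^-1 *: (w - (1 - s) *: y - s *: a))).
Proof.
move=> s0; apply/rowP => i; rewrite !mxE; field.
by rewrite !gt_eqF.
Qed.

(** Where the bump does not vanish, w is a convex combination of y and a point of the cube, hence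
    lies in V. All multi-indices [c] are covered, as the derivatives of the kernel are integrated
    too. *)
Lemma kernel_support s y w c : 0 < s <= 1 -> V y -> ~ V w ->
  coord_prod (fun=> @cbump R) c ((s * ell)^-1 *: (w - (1 - s) *: y - s *: a)) = 0.
Proof.
move=> /andP[s0 s1] Vy Vw; apply: bump_prod_out => h; apply: Vw.
rewrite (kernel_point y w s0); apply: V_convex => //; first by rewrite ltW.
exact: V_cube.
Qed.

Lemma W_gt0 s : 0 < s -> 0 < W s.
Proof. by move=> s0; rewrite mulr_gt0 ?Zeta_gt0// exprn_gt0// mulr_gt0. Qed.

Lemma measurable_ker s y : measurable_fun setT (K s y).
Proof. by have [] := bounded_ker (s * ell)^-1 (1 - s) (s *: a) y (@measurable_eta R n) (@bounded_eta R n) measurableT. Qed.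

Lemma bounded_mfun_ker s y : bounded_mfun V (K s y).
Proof. exact: (bounded_ker (s * ell)^-1 (1 - s) (s *: a) y (@measurable_eta R n) (@bounded_eta R n) mV). Qed.

Lemma integral_ker_subst s y (v : 'rV[R]_n -> \bar R) : 0 < s ->
  measurable_fun setT v -> (forall w, 0 <= v w)%E ->
  (\int[mu]_w (v w * (K s y w)%:E) =
   ((s * ell) ^+ n)%:E * \int[mu]_p (v ((s * ell) *: p + ((1 - s) *: y + s *: a))%R * (eta p)%:E))%E.
Proof.
move=> s0 mv v0; have sl0 : 0 < s * ell by rewrite mulr_gt0.
have E p : K s y ((s * ell) *: p + ((1 - s) *: y + s *: a)) = eta p.
  by rewrite /K /ker -addrA -opprD addrK scalerA mulVf ?scale1r// gt_eqF.
rewrite (integral_affine_rV ((1 - s) *: y + s *: a) sl0).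
- by under eq_integral do rewrite E.
- by apply: emeasurable_funM => //; apply/measurable_EFinP; exact: measurable_ker.
- by move=> w; rewrite mule_ge0// lee_fin ker_ge0.
Qed.

Lemma integral_ker s y : 0 < s <= 1 -> V y -> \int[mu]_(w in V) K s y w = W s.
Proof.
move=> s01 Vy; have /andP[s0 s1] := s01.
rewrite /Rintegral.
rewrite (_ : (\int[mu]_(w in V) (K s y w)%:E = (W s)%:E)%E)//.
rewrite [LHS]integral_mkcond.
rewrite (_ : _ \_ V = (fun w => 1 * (K s y w)%:E)%E); last first.
  apply/funext => w; rewrite patchE mul1e; case: ifPn => // /negP Vw.
  by rewrite /K /ker [X in X%:E](@kernel_support s y w _ s01 Vy)// => h; apply: Vw; rewrite inE.
rewrite integral_ker_subst// /W EFinM EFin_Zeta; congr (_ * _)%E.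
by apply: eq_integral => p _; rewrite mul1e.
Qed.

Lemma integrable_ker s u y : mu.-integrable V (EFin \o u) ->
  mu.-integrable V (EFin \o (fun w => u w * K s y w)).
Proof. by move=> iu; exact: (integrable_mul_ker _ _ _ _ mV iu (@measurable_eta R n) (@bounded_eta R n)). Qed.

Lemma L2_integrableV u : L2 mu V u -> mu.-integrable V (EFin \o u).
Proof. exact: L2_integrable. Qed.

(** Expansion of the weighted integral of (u - t)^2 >= 0, where t is the average and the weight has
    mass [W s]. *)
Lemma avg_jensen s u y : 0 < s <= 1 -> V y -> L2 mu V u ->
  avg s u y ^+ 2 <= KN s (fun w => u w ^+ 2) y / W s.
Proof.
move=> s01 Vy Lu; have /andP[s0 s1] := s01; have W0 := W_gt0 s0.
have iu := L2_integrableV Lu.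
pose t := avg s u y.
have tW : KN s u y = t * W s by rewrite /t /avg divfK ?gt_eqF.
have i1 := integrable_ker s y Lu.2.
have i2 := integrableZl mV (2 * t) (integrable_ker s y iu).
have i3 := integrableZl mV (t ^+ 2) (bounded_mfun_integrable mV Voo (bounded_mfun_ker s y)).
have : 0 <= \int[mu]_(w in V) ((u w ^+ 2 * K s y w - (2 * t) * (u w * K s y w)) + t ^+ 2 * K s y w).
  apply: Rintegral_ge0 => w _.
  rewrite [leRHS](_ : _ = (u w - t) ^+ 2 * K s y w); last by ring.
  by rewrite mulr_ge0 ?sqr_ge0 ?ker_ge0.
rewrite RintegralD//; last exact: (integrableB mV i1 i2).
rewrite RintegralB// RintegralZl//; last exact: integrable_ker.
rewrite RintegralZl//; last exact: bounded_mfun_integrable (bounded_mfun_ker s y).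
rewrite integral_ker// ler_pdivlMr//.
rewrite -[X in _ - _ * X + _]/(KN s u y) tW -/t.
rewrite -[X in X - _ + _]/(KN s (fun w => u w ^+ 2) y).
by move=> h; rewrite -subr_ge0 (le_trans h)// le_eqVlt; apply/orP; left; apply/eqP; ring.
Qed.

Lemma continuous_KN s u : mu.-integrable V (EFin \o u) -> continuous (KN s u).
Proof.
move=> iu; have [M MP] := kerN_taylor (s * ell)^-1 (1 - s) (s *: a) mV iu.
exact: taylor_continuous MP.
Qed.

Lemma continuous_avg s u : L2 mu V u -> continuous (avg s u).
Proof.
move=> Lu; have c := @continuous_KN s _ (L2_integrableV Lu).
by move=> y; exact: (cvgM (c y) (cvg_cst (W s)^-1)).
Qed.

Lemma measurable_avg s u : L2 mu V u -> measurable_fun setT (avg s u).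
Proof. by move=> Lu; apply: continuous_measurable_fun_rV; exact: continuous_avg. Qed.

Lemma bounded_avg s u : 0 < s -> L2 mu V u -> bounded_mfun V (avg s u).
Proof.
move=> s0 Lu; split; first exact: measurable_funTS (measurable_avg s Lu).
have iu := L2_integrableV Lu.
have [B HB] := @bounded_eta R n; have B0 : 0 <= B by exact: le_trans (HB 0).
exists ((B * \int[mu]_(w in V) `|u w|) / W s) => y _.
rewrite normrM (gtr0_norm (x := (W s)^-1)) ?invr_gt0 ?W_gt0// ler_wpM2r ?invr_ge0 ?(ltW (W_gt0 s0))//.
have ik := integrable_ker s y iu.
apply: (le_trans (le_normr_Rintegral mV ik)).
have iau : mu.-integrable V (EFin \o (fun w => `|u w|)) by exact: integrable_norm.
rewrite -RintegralZl//; apply: le_Rintegral => //.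
- exact: (integrable_norm ik).
- exact: (integrableZl mV B iau).
by move=> w _; rewrite normrM mulrC ler_wpM2r//; exact: HB.
Qed.

(** After substitution in w and Tonelli, the variable y enters through (1 - s) y plus a constant,
    whence the factor (1 - s)^-n. *)
Lemma integral_avg_le s (v : 'rV[R]_n -> \bar R) : 0 < s < 1 ->
  measurable_fun setT v -> (forall w, 0 <= v w)%E ->
  (\int[mu]_y \int[mu]_w (v w * (K s y w)%:E) = (W s / (1 - s) ^+ n)%:E * \int[mu]_w v w)%E.
Proof.
move=> /andP[s0 s1] mv v0; have t0 : 0 < 1 - s by rewrite subr_gt0.
pose f (z : 'rV[R]_n * 'rV[R]_n) :=
  (v ((s * ell) *: z.2 + ((1 - s) *: z.1 + s *: a))%R * (eta z.2)%:E)%E.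
have f0 z : (0 <= f z)%E by rewrite mule_ge0// lee_fin eta_ge0.
have mf : measurable_fun setT f.
  apply: emeasurable_funM.
    apply: (@measurableT_comp _ _ _ _ _ _ v) => //; apply: measurable_fun_rV => i.
    rewrite (_ : _ \o _ = fun z : 'rV[R]_n * 'rV[R]_n => ((s * ell) * z.2 ord0 i + ((1 - s) * z.1 ord0 i + (s *: a) ord0 i))%R).
      apply: measurable_funD; last apply: measurable_funD => //.
        apply: measurable_funM => //.
        by apply: (@measurableT_comp _ _ _ _ _ _ (fun x : 'rV[R]_n => x ord0 i)) => //; exact: measurable_coord_rV.
      apply: measurable_funM => //.
      by apply: (@measurableT_comp _ _ _ _ _ _ (fun x : 'rV[R]_n => x ord0 i)) => //; exact: measurable_coord_rV.
    by apply/funext => z; rewrite /rV_coord/= !mxE.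
  apply/measurable_EFinP.
  by apply: (@measurableT_comp _ _ _ _ _ _ (@eta R n)) => //; exact: measurable_eta.
under eq_integral do rewrite integral_ker_subst//.
rewrite ge0_integralZl//=; last 3 first.
- exact: (@measurable_fun_fubini_tonelli_F _ _ _ _ _ mu f mf f0).
- by move=> y _; apply: integral_ge0 => p _; exact: (f0 (y, p)).
- by rewrite lee_fin exprn_ge0// mulr_ge0 ?ltW.
rewrite (fubini_tonelli (m1 := mu) (m2 := mu) f mf f0)//=.
have E (p : 'rV[R]_n) : (\int[mu]_y f (y, p) = (eta p)%:E * (((1 - s) ^+ n)^-1%:E * \int[mu]_w v w))%E.
  rewrite /f/=.
  have mvp : measurable_fun setT (fun y : 'rV[R]_n => v ((s * ell) *: p + ((1 - s) *: y + s *: a))).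
    apply: (@measurableT_comp _ _ _ _ _ _ v) => //.
    under [X in measurable_fun _ X]funext do rewrite addrCA.
    exact: measurable_affine_rV.
  under eq_integral do rewrite muleC.
  rewrite ge0_integralZl//; last by rewrite lee_fin eta_ge0.
  congr (_ * _)%E.
  rewrite [in RHS](integral_affine_rV ((s * ell) *: p + s *: a) t0)//.
  rewrite muleA -EFinM mulVf ?mul1e ?gt_eqF ?exprn_gt0//.
  by apply: eq_integral => y _; congr v; rewrite addrCA.
under eq_integral do rewrite E.
have me : measurable_fun setT (EFin \o @eta R n) by apply/measurable_EFinP; exact: measurable_eta.
rewrite ge0_integralZr//=; last 2 first.
- by move=> p _; rewrite lee_fin eta_ge0.
- by rewrite mule_ge0// ?integral_ge0// lee_fin invr_ge0 exprn_ge0// ltW.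
by rewrite -EFin_Zeta !muleA -!EFinM.
Qed.

(** Jensen's inequality and Tonelli give the factor (1 - s)^-n, which is at most 2 by Bernoulli's
    inequality when n s <= 1/2. *)
Lemma sqi_avg s u : 0 < s < 1 -> n%:R * s <= 2^-1 -> L2 mu V u ->
  L2 mu V (avg s u) /\ sqi mu V (avg s u) <= 2 * sqi mu V u.
Proof.
move=> s01 ns Lu; have /andP[s0 s1] := s01; have W0 := W_gt0 s0.
have t0 : 0 < 1 - s by rewrite subr_gt0.
have s01' : 0 < s <= 1 by rewrite s0 ltW.
apply: sqi_lty => //; first exact: measurable_funTS (measurable_avg s Lu).
pose v : 'rV[R]_n -> \bar R := (fun w => (u w ^+ 2)%:E) \_ V.
have v0 w : (0 <= v w)%E by rewrite /v patchE; case: ifP => // _; rewrite lee_fin sqr_ge0.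
have mv : measurable_fun setT v.
  apply/(measurable_restrictT _ mV)/measurable_EFinP; apply: measurable_funX; exact: Lu.1.
have vK y : (\int[mu]_w (v w * (K s y w)%:E) = (KN s (fun w => u w ^+ 2)%R y)%:E)%E.
  rewrite /KN /kerN EFin_Rintegral//; last exact: integrable_ker Lu.2.
  rewrite [RHS]integral_mkcond; apply: eq_integral => w _.
  by rewrite /v !patchE; case: ifP => // _; rewrite mul0e.
have mKN : measurable_fun setT (KN s (fun w => u w ^+ 2)).
  by apply: continuous_measurable_fun_rV; exact: (@continuous_KN s _ Lu.2).
have KN0 y : 0 <= KN s (fun w => u w ^+ 2) y.
  by apply: Rintegral_ge0 => w _; rewrite mulr_ge0 ?sqr_ge0 ?ker_ge0.
have iv : (\int[mu]_w v w = (sqi mu V u)%:E)%E.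
  by rewrite /sqi EFin_Rintegral//; [rewrite [RHS]integral_mkcond|exact: Lu.2].
have mq D : measurable_fun D (fun y => ((W s)^-1 * KN s (fun w => u w ^+ 2) y)%:E).
  by apply: measurable_funTS; apply/measurable_EFinP; exact: measurable_funM.
apply: (@le_trans _ _ (\int[mu]_(y in V) ((W s)^-1 * KN s (fun w => u w ^+ 2)%R y)%:E)%E).
  apply: ge0_le_integral => //.
  - by move=> y _; rewrite lee_fin sqr_ge0.
  - by apply/measurable_EFinP; apply: measurable_funX; exact: measurable_funTS (measurable_avg s Lu).
  - by move=> y Vy; rewrite lee_fin mulrC; exact: avg_jensen.
apply: (@le_trans _ _ (\int[mu]_y ((W s)^-1 * KN s (fun w => u w ^+ 2)%R y)%:E)%E).
  apply: ge0_subset_integral => // y _; rewrite lee_fin mulr_ge0// invr_ge0; exact: ltW.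
under eq_integral do rewrite EFinM -vK.
rewrite ge0_integralZl//; last 3 first.
- under [X in measurable_fun _ X]funext do rewrite vK; exact/measurable_EFinP.
- by move=> y _; rewrite vK lee_fin.
- by rewrite lee_fin invr_ge0 ltW.
rewrite integral_avg_le// iv -!EFinM lee_fin mulrA mulrA mulVf ?gt_eqF// mul1r.
rewrite ler_wpM2r ?sqi_ge0//.
have h : 2^-1 <= (1 - s) ^+ n.
  by rewrite (le_trans _ (bernoulli_ge n _))// ?(ltW s0) ?(ltW s1)//; lra.
by rewrite -[leRHS]invrK lef_pV2 ?posrE// ?invr_gt0// exprn_gt0.
Qed.

Lemma avgB s u v y : L2 mu V u -> L2 mu V v ->
  avg s (fun x => u x - v x) y = avg s u y - avg s v y.
Proof.
move=> Lu Lv; rewrite /avg -mulrBl; congr (_ * _).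
rewrite /KN /kerN -RintegralB//; try exact: integrable_ker (L2_integrableV _).
by apply: eq_Rintegral => w _; rewrite mulrBl.
Qed.

Lemma avg_lipschitz s phi C M y : 0 < s <= 1 -> V y -> 0 <= C -> bounded_mfun V phi ->
  lip_bound phi C -> (forall x, V x -> `|x| <= M) ->
  `|avg s phi y - phi y| <= C * (s * (M + M)).
Proof.
move=> s01 Vy C0 bphi lphi VM; have /andP[s0 s1] := s01; have W0 := W_gt0 s0.
have Lphi := bounded_mfun_L2 mV Voo bphi.
have iK := bounded_mfun_integrable mV Voo (bounded_mfun_ker s y).
have iu := integrable_ker s y (L2_integrableV Lphi).
have i2 := integrableZl mV (phi y) iK.
have -> : avg s phi y - phi y = (\int[mu]_(w in V) (phi w * K s y w - phi y * K s y w)) / W s.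
  rewrite RintegralB// RintegralZl// integral_ker// mulrBl mulfK ?gt_eqF//.
rewrite normrM (gtr0_norm (x := (W s)^-1)) ?invr_gt0// ler_pdivrMr//.
have i3 := integrableB mV iu i2.
apply: (le_trans (le_normr_Rintegral mV i3)).
rewrite -(integral_ker s01 Vy) -RintegralZl//.
apply: le_Rintegral => //.
- exact: (integrable_norm i3).
- exact: (integrableZl mV _ iK).
move=> w Vw; rewrite -mulrBl normrM (ger0_norm (ker_ge0 _ _ _ _ _)).
set q := (s * ell)^-1 *: (w - (1 - s) *: y - s *: a).
have [q01|nq] := pselect (forall i, 0 <= q ord0 i <= 1); last first.
  have K0 : ker (s * ell)^-1 (1 - s) (s *: a) y w = 0 := eta_out nq.
  by rewrite /K K0 !mulr0.
rewrite ler_wpM2r ?ker_ge0//; apply: (le_trans (lphi w y)); rewrite ler_wpM2l//.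
have -> : w - y = s *: ((a + ell *: q) - y).
  by rewrite {1}(kernel_point y w s0) -/q; apply/rowP => i; rewrite !mxE; ring.
rewrite normrZ (gtr0_norm s0) ler_wpM2l ?(ltW s0)//.
by rewrite (le_trans (ler_normB _ _))// lerD ?VM//; exact: V_cube.
Qed.

(** Averages of a Lipschitz function converge uniformly on the bounded set V; density and the L2
    bound of [sqi_avg], uniform in s, extend this to L2. *)
Lemma avg_cvg u M : L2 mu V u -> (forall x, V x -> `|x| <= M) -> forall e, 0 < e ->
  exists s0, 0 < s0 /\ forall s, 0 < s < 1 -> n%:R * s <= 2^-1 -> s <= s0 ->
    sqi mu V (fun x => u x - avg s u x) <= e.
Proof.
move=> Lu VM e e0; have e16 : 0 < e / 16 by rewrite divr_gt0.
have [phi [C0 [bphi lphi0 sphi]]] := lipschitz_dense mV Voo Lu e16.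
pose C := `|C0|; have lphi : lip_bound phi C.
  by move=> x y; rewrite (le_trans (lphi0 x y))// ler_wpM2r// ler_norm.
have Lphi := bounded_mfun_L2 mV Voo bphi.
pose m := fine (mu V); have m0 : 0 <= m by exact: fine_ge0.
pose A := (C * (M + M)) ^+ 2 * m + 1.
have A0 : 0 < A by rewrite ltr_wpDl// mulr_ge0// sqr_ge0.
exists (e / 16 / A); split; first by rewrite divr_gt0.
move=> s s01 ns sA; have /andP[s0 s1] := s01.
have s01' : 0 < s <= 1 by rewrite s0 ltW.
have LB := L2B mV Lu Lphi.
have [La Sa] := sqi_avg s01 ns LB.
have [Lp _] := sqi_avg s01 ns Lphi.
have S2 : sqi mu V (fun x => avg s phi x - phi x) <= e / 16.
  have [Lp' Sp] := L2_le mV (L2B mV Lp Lphi).1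
    (bounded_mfun_L2 mV Voo (bounded_mfun_cst V (C * (s * (M + M)))))
    (fun x Vx => le_trans (avg_lipschitz s01' Vx (normr_ge0 _) bphi lphi VM) (ler_norm _)).
  apply: (le_trans Sp); rewrite /sqi/= Rintegral_cst// -/m.
  have -> : (C * (s * (M + M))) ^+ 2 * m = (C * (M + M)) ^+ 2 * m * (s * s) by ring.
  apply: (@le_trans _ _ (A * s)); last by rewrite mulrC -ler_pdivlMr.
  apply: ler_pM; [by rewrite mulr_ge0// sqr_ge0|by rewrite mulr_ge0// ltW|by rewrite lerDl|].
  by rewrite ger_pMl// ltW.
rewrite (@eq_sqi _ _ _ mu V _ (fun x => (u x - phi x) +
   (- (avg s phi x - phi x) - avg s (fun x => u x - phi x) x))) => [|x _]; last first.
  by rewrite avgB//; ring.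
have Ln := L2N mV (L2B mV Lp Lphi).
rewrite (le_trans (sqiD mV LB (L2B mV Ln La)))//.
have := sqiD mV Ln (L2N mV La); rewrite !sqiN; lra.
Qed.

(** As a function of w, the kernel is supported in the cube (1 - s) y + s Q, which is compact and
    contained in V. The weak gradient can therefore be tested against it. *)
Lemma ker_test_function Omega s y : 0 < s <= 1 -> V y -> V `<=` Omega ->
  test_function Omega (K s y) /\
  forall j w, partial j (K s y) w =
    (s * ell)^-1 * deta j ((s * ell)^-1 *: (w - (1 - s) *: y - s *: a)).
Proof.
move=> s01 Vy VO; have /andP[s0 s1] := s01.
pose kap := (s * ell)^-1; pose c := (1 - s) *: y + s *: a.
have kap0 : 0 < kap by rewrite invr_gt0 mulr_gt0.
pose F (i : 'I_n) k (t : R) := kap ^+ k * cbump k (kap * (t - c ord0 i)).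
have dF i k (t : R) : is_derive t 1 (F i k) (F i k.+1 t).
  have d1 : is_derive t (1 : R) (fun t => kap * (t - c ord0 i)) kap.
    have d0 : is_derive t (1 : R) (id - cst (c ord0 i)) (1 - 0) by exact: is_deriveB.
    have := @is_deriveZ _ _ _ _ kap _ _ _ d0.
    by rewrite subr0 /GRing.scale/= mulr1.
  have d2 := @is_derive1_comp R (cbump k) _ t _ _ (is_derive_bump k _) d1.
  have -> : F i k.+1 t = kap ^+ k *: (cbump k.+1 (kap * (t - c ord0 i)) * kap).
    by rewrite /F exprS /GRing.scale/=; ring.
  exact: (@is_deriveZ _ _ _ _ (kap ^+ k) _ _ _ d2).
have KE : K s y = coord_prod F (fun=> 0%N).
  apply/funext => w; rewrite /K /ker /eta /coord_prod; apply: eq_bigr => i _.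
  by rewrite /F expr0 mul1r !mxE -/kap opprD addrA.
split; last first.
  move=> j w; rewrite /partial KE; have [_ ->] := is_derive_coord_prod dF (fun=> 0%N) j w.
  rewrite /coord_prod /deta /coord_prod /F big_split/=; congr (_ * _).
    rewrite (bigD1 j)//= eqxx expr1 big1 ?mulr1// => i /negbTE ->.
    by rewrite expr0.
  by apply: eq_bigr => i _; rewrite !mxE -/kap opprD addrA.
split; first by rewrite KE; exact: smooth_on_coord_prod.
exists [set w : 'rV[R]_n | forall i, `[c ord0 i, c ord0 i + s * ell]%classic (w ord0 i)]; split.
- by apply: (@rV_compact R n (fun i => `[c ord0 i, c ord0 i + s * ell]%classic)) => i; exact: segment_compact.
- move=> w wc; apply: VO; rewrite (kernel_point y w s0); apply: V_convex => //; first by rewrite ltW.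
  apply: V_cube => i; rewrite !mxE -/kap -addrA -opprD.
  have := wc i; rewrite /= in_itv/= !mxE => /andP[w1 w2].
  rewrite mulr_ge0 ?(ltW kap0) ?subr_ge0//= mulrC ler_pdivrMr ?mulr_gt0// mul1r.
  by rewrite lerBlDl.
- move=> w wc; apply: eta_out => q01; apply: wc => i /=; rewrite in_itv/=.
  have := q01 i; rewrite !mxE -/kap -addrA -opprD => /andP[w1 w2].
  rewrite -subr_ge0 -(pmulr_rge0 _ kap0) w1/= -lerBlDl.
  by move: w2; rewrite mulrC ler_pdivrMr ?mulr_gt0// mul1r.
Qed.

(** The kernel depends on w - (1 - s) y, so its derivative in y is - (1 - s) times its derivative in
    w, which the weak gradient moves onto [u]. The constant [M] may blow up as s tends to 0: it is
    absent from the conclusion of [poincare_taylor]. *)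
Lemma avg_taylor Omega s u g : open Omega -> V `<=` Omega -> 0 < s <= 1 -> H1 Omega u g ->
  exists M, forall y y', V y -> V y' ->
    avg s u y + \sum_j ((1 - s) * avg s (g j) y) * (y' - y) ord0 j - M * sqn (y' - y) <= avg s u y'.
Proof.
move=> oO VO s01 [Lu Lg wg]; have /andP[s0 s1] := s01; have W0 := W_gt0 s0.
have mO := open_measurable_rV oO.
have LuV : L2 mu V u by apply: (L2_subset mV mO VO); exact/L2_onP.
have [M MP] := kerN_taylor (s * ell)^-1 (1 - s) (s *: a) mV (L2_integrableV LuV).
have sub (f h : 'rV[R]_n -> R) : (forall w, ~ V w -> h w = 0) ->
    \int[mu]_(w in Omega) (f w * h w) = \int[mu]_(w in V) (f w * h w).
  move=> h0; rewrite [LHS]Rintegral_mkcond [RHS]Rintegral_mkcond; apply: eq_Rintegral => w _.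
  rewrite !patchE; case: (boolP (w \in V)) => wV.
    by rewrite ifT//; move: wV; rewrite !inE; exact: VO.
  by rewrite h0 ?mulr0 ?if_same// => /mem_set; exact/negP.
exists (M / W s) => y y' Vy Vy'.
have [tf pE] := ker_test_function s01 Vy VO.
have G j : - (s * ell)^-1 * (1 - s) *
     \int[mu]_(w in V) (u w * deta j ((s * ell)^-1 *: (w - (1 - s) *: y - s *: a))) =
    (1 - s) * KN s (g j) y.
  have := wg j _ tf; under eq_Rintegral do rewrite pE.
  rewrite (sub (g j)); last by move=> w Vw; exact: kernel_support.
  rewrite sub; last by move=> w Vw; rewrite [deta _ _](kernel_support _ s01 Vy Vw) mulr0.
  under eq_Rintegral do rewrite mulrCA.
  rewrite RintegralZl//; last first.
    exact: (integrable_mul_ker (s * ell)^-1 (1 - s) (s *: a) y mV (L2_integrableV LuV) (measurable_deta j) (@bounded_deta R n j)).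
  rewrite /KN /kerN => h; rewrite -[X in _ = _ * X]opprK -h; ring.
have := MP y y'; under eq_bigr do rewrite G.
rewrite -/(KN s u y) -/(KN s u y') ler_norml => /andP[h _].
rewrite /avg -subr_ge0.
have E : \sum_j (1 - s) * (KN s (g j) y / W s) * (y' - y) ord0 j =
   (\sum_j (1 - s) * KN s (g j) y * (y' - y) ord0 j) / W s.
  by rewrite mulr_suml; apply: eq_bigr => j _; ring.
rewrite E; move: h W0; set S := \sum_j _; move: (W s) (KN s u y') (KN s u y) S (sqn _) => w k' k S q h W0.
rewrite (_ : _ - _ = (k' - k - S + M * q) / w); last by field; rewrite gt_eqF.
by apply: divr_ge0; [by rewrite -lerBlDr sub0r|exact: ltW].
Qed.

(** [poincare_taylor] for the averages of [u], as s tends to 0. The factor 32 is 8 times 2, from the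
    L2 bound of averaged gradients, times 2, from splitting u - c into u minus its average and the
    average minus c. *)
Theorem poincare_convex Omega D u g : open Omega -> V `<=` Omega -> bounded_set V ->
  (0 < mu V)%E -> 0 < D -> (forall x y, V x -> V y -> sqn (x - y) <= D ^+ 2) ->
  H1 Omega u g ->
  sqi mu V u <= 32 * expR 1 ^+ 2 * D ^+ 2 * \sum_i sqi mu V (g i) +
    (\int[mu]_(x in V) u x) ^+ 2 / fine (mu V).
Proof.
move=> oO VO bV V0 D0 VD Hu; have [Lu' Lg' wg] := Hu.
have mO := open_measurable_rV oO.
have Lu : L2 mu V u by apply: (L2_subset mV mO VO); exact/L2_onP.
have Lg j : L2 mu V (g j) by apply: (L2_subset mV mO VO); exact/L2_onP.
have [M _ VM'] := bounded_set_ball bV.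
have VM x : V x -> `|x| <= M.
  by move=> /VM'; rewrite -ball_normE /ball_/= sub0r normrN => /ltW.
set m := fine (mu V); have m0 : 0 < m by rewrite fine_gt0// V0 Voo.
have iu := L2_integrableV Lu.
(* The difference of the two sides is (c m - I)^2/m, where I is the integral of u, so the constant
   given by [poincare_taylor] need not be identified with a mean. *)
have minc c : sqi mu V u <= sqi mu V (fun x => u x - c) + (\int[mu]_(x in V) u x) ^+ 2 / m.
  have i1 : mu.-integrable V (EFin \o cst (c ^+ 2)).
    exact: bounded_mfun_integrable (bounded_mfun_cst V _).
  have i2 := integrableZl mV (2 * c) iu.
  have -> : sqi mu V (fun x => u x - c) = sqi mu V u - 2 * c * (\int[mu]_(x in V) u x) + c ^+ 2 * m.
    rewrite -[c ^+ 2 * m](Rintegral_cst mu mV) /sqi -RintegralZl// -RintegralB//; last exact: Lu.2.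
    rewrite -RintegralD//; last by exact: (integrableB mV Lu.2 i2).
    by apply: eq_Rintegral => x _ /=; ring.
  move: (\int[mu]_(x in V) u x) => I.
  rewrite -subr_ge0 (_ : _ - _ = (c * m - I) ^+ 2 / m); last by field; rewrite gt_eqF.
  by rewrite divr_ge0 ?sqr_ge0 ?ltW.
apply/ler_addgt0Pl => e e0; have e2 : 0 < e / 2 by rewrite divr_gt0.
have [s0 [s00 sP]] := avg_cvg Lu VM e2.
(* The bound 1/(2 (n + 1)) ensures n s <= 1/2 and s < 1, including for n = 0. *)
pose s := Num.min s0 (2 * n.+1%:R)^-1.
have nn : 0 < n.+1%:R :> R by [].
have r0 : 0 < (2 * n.+1%:R : R)^-1 by rewrite invr_gt0 mulr_gt0.
have sgt : 0 < s by rewrite lt_min s00.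
have sr : s <= (2 * n.+1%:R)^-1 by rewrite ge_min lexx orbT.
have ns : n%:R * s <= 2^-1.
  apply: (@le_trans _ _ (n.+1%:R * (2 * n.+1%:R)^-1)).
    by rewrite ler_pM ?(ltW sgt)// ler_nat.
  by rewrite invfM mulrCA divff ?mulr1// gt_eqF.
have s1 : s < 1.
  apply: (le_lt_trans sr); rewrite invf_lt1 ?mulr_gt0//.
  by rewrite -natrM ltr1n mulnS.
have s01 : 0 < s < 1 by rewrite sgt.
have s01' : 0 < s <= 1 by rewrite sgt ltW.
have s1' : 0 <= 1 - s <= 1 by rewrite subr_ge0 (ltW s1)/= gerBl ltW.
have Sa : sqi mu V (fun x => u x - avg s u x) <= e / 2.
  by apply: sP => //; rewrite ge_min lexx.
have [T TP] := avg_taylor oO VO s01' Hu.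
have mid x y : V x -> V y -> V (2^-1 *: (x + y)).
  move=> Vx Vy; have h01 : 0 <= (2^-1 : R) <= 1 by rewrite invr_ge0 ler0n/= invf_le1// ler1n.
  have := V_convex h01 Vx Vy; congr V.
  by rewrite scalerDr; congr (_ *: _ + _); lra.
have bG j : bounded_mfun V (fun x => (1 - s) * avg s (g j) x).
  by apply: bounded_mfunZ; exact: bounded_avg.
have [c cP] := poincare_taylor mV bV V0 mid D0 VD (bounded_avg sgt Lu) bG TP.
have [La _] := sqi_avg s01 ns Lu.
have Lc : L2 mu V (fun x => avg s u x - c).
  by apply: L2B => //; exact: bounded_mfun_L2 (bounded_mfun_cst _ _).
have P2 : sqi mu V (fun x => avg s u x - c) <= 8 * expR 1 ^+ 2 * D ^+ 2 * (2 * \sum_i sqi mu V (g i)).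
  apply: (le_trans cP); rewrite ler_wpM2l//.
    by rewrite mulr_ge0 ?sqr_ge0// mulr_ge0// sqr_ge0.
  have [_ ->] := @Rintegral_sum _ _ _ mu V _ (index_enum 'I_n) (fun i x => ((1 - s) * avg s (g i) x) ^+ 2) mV
    (fun i => (bounded_mfun_L2 mV Voo (bG i)).2).
  rewrite mulr_sumr; apply: ler_sum => i _.
  rewrite -/(sqi mu V (fun x => (1 - s) * avg s (g i) x)).
  have [Lgi Sgi] := sqi_avg s01 ns (Lg i).
  rewrite sqiZ//; apply: le_trans Sgi; rewrite ler_piMl ?sqi_ge0//.
  by have /andP[t0 t1] := s1'; rewrite expr_le1.
apply: (le_trans (minc c)); rewrite addrA lerD2r.
rewrite (@eq_sqi _ _ _ mu V _ (fun x => (u x - avg s u x) + (avg s u x - c))) => [|x _]; last by ring.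
rewrite (le_trans (sqiD mV (L2B mV Lu La) Lc))//; lra.
Qed.

End average.

(** * Voronoi cells and separated points *)

Lemma convex_setP (R : realType) n (A : set 'rV[R]_n) :
  convex_set (A : set (convex_lmodType 'rV[R]_n)) ->
  convex_rV A.
Proof.
move=> cA s x y /andP[s0 s1] Ax Ay.
by have := cA y x (Itv01 s0 s1) (mem_set Ay) (mem_set Ax); rewrite inE addrC.
Qed.

Section voronoi.
Context (R : realType) (n m : nat) (Omega : set 'rV[R]_n) (x : 'I_m -> 'rV[R]_n).
Local Notation mu := (@lebesgue_rV R n).
Implicit Types (y z w : 'rV[R]_n) (i j : 'I_m).

(* Ties between nearest points are broken by index, so that the cells partition [Omega]. *)
Definition cell i : set 'rV[R]_n := Omega `&` [set z | forall j,
  sqn (z - x i) <= sqn (z - x j) /\ ((j < i)%N -> sqn (z - x i) < sqn (z - x j))].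

Lemma cell_sub i : cell i `<=` Omega.
Proof. by move=> z []. Qed.

Lemma cell_cover z : (0 < m)%N -> Omega z -> exists i, cell i z.
Proof.
move=> m0 Oz; pose i0 := [arg min_(i < Ordinal m0) sqn (z - x i)]%O.
have i0P i : sqn (z - x i0) <= sqn (z - x i).
  by rewrite /i0; case: arg_minP => // j _ h; exact: h.
pose P k := [exists i : 'I_m, (i == k :> nat) && (sqn (z - x i) == sqn (z - x i0))].
have exP : exists k, P k by exists i0; apply/existsP; exists i0; rewrite !eqxx.
have [k /existsP[i /andP[/eqP ik /eqP xi]] kmin] := ex_minnP exP.
exists i; split=> // j; rewrite xi; split => // ji.
rewrite lt_neqAle i0P andbT; apply/eqP => e.
have : P j by apply/existsP; exists j; rewrite e !eqxx.
by move=> /kmin; rewrite leqNgt -ik ji.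
Qed.

Lemma cell_disjoint i j z : cell i z -> cell j z -> i = j.
Proof.
move=> [_ Hi] [_ Hj]; have [le1 lt1] := Hi j; have [le2 lt2] := Hj i.
have [ij|ij|ij] := ltngtP i j; last exact: val_inj.
- by have := lt2 ij; rewrite ltNge le1.
- by have := lt1 ij; rewrite ltNge le2.
Qed.

(** The quadratic terms cancel: a difference of squared distances to two fixed points is affine,
    which makes Voronoi cells convex. *)
Lemma sqn_sub_affine (s : R) (p q : 'rV[R]_n) i j :
  sqn ((1 - s) *: p + s *: q - x j) - sqn ((1 - s) *: p + s *: q - x i) =
  (1 - s) * (sqn (p - x j) - sqn (p - x i)) + s * (sqn (q - x j) - sqn (q - x i)).
Proof.
rewrite /sqn -!sumrB !mulr_sumr -big_split/=; apply: eq_bigr => k _.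
by rewrite !mxE; ring.
Qed.

Lemma cell_convex i :
  convex_rV Omega -> convex_rV (cell i).
Proof.
move=> cO s y z s01 [Oy Hy] [Oz Hz]; split; first exact: cO.
have /andP[s0 s1] := s01; move=> j.
have [ly sy] := Hy j; have [lz sz] := Hz j.
split; first by rewrite -subr_ge0 sqn_sub_affine addr_ge0// mulr_ge0// ?subr_ge0.
move=> ji; rewrite -subr_gt0 sqn_sub_affine.
have : 0 < sqn (y - x j) - sqn (y - x i) by rewrite subr_gt0; exact: sy.
have : 0 < sqn (z - x j) - sqn (z - x i) by rewrite subr_gt0; exact: sz.
have [->|s0'] := eqVneq s 0; first by rewrite subr0 mul1r mul0r addr0.
move=> p1 p2; apply: ltr_wpDl; first by apply: mulr_ge0; [rewrite subr_ge0|exact: ltW].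
by rewrite mulr_gt0// lt_neqAle eq_sym s0'.
Qed.

Lemma measurable_cell i : measurable Omega -> measurable (cell i).
Proof.
move=> mO; apply: measurableI => //.
rewrite (_ : [set z | _] = \bigcap_(j in [set: 'I_m])
   ([set z | sqn (z - x i) <= sqn (z - x j)] `&`
    [set z | (j < i)%N -> sqn (z - x i) < sqn (z - x j)])); last first.
  by apply/seteqP; split => [z h j _|z h j]; [exact: h|exact: (h j)].
have mle k l : measurable [set z | sqn (z - x k) <= sqn (z - x l)].
  have := measurable_fun_le measurableT (measurable_sqn (x k)) (measurable_sqn (x l)).
  by rewrite setTI.
apply: fin_bigcap_measurable => // j _; apply: measurableI.
  exact: mle.
case: (j < i)%N; last by rewrite (_ : [set z | _] = setT)//; apply/seteqP; split.
rewrite (_ : [set z | _] = [set z | sqn (z - x i) < sqn (z - x j)]); last first.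
  by apply/seteqP; split => [z /(_ isT)|z h _].
rewrite (_ : [set z | _] = ~` [set z | sqn (z - x j) <= sqn (z - x i)]); first by apply: measurableC; exact: mle.
by apply/seteqP; split => z /=; rewrite ltNge => /negP.
Qed.

Lemma continuous_sqn (z : 'rV[R]_n) : continuous (fun y : 'rV[R]_n => sqn (y - z)).
Proof.
have := @taylor_continuous R n (fun y => sqn (y - z)) (fun k y => 2 * (y - z) ord0 k) 1.
apply => y y'.
rewrite mul1r (_ : _ - _ = sqn (y' - y)) ?ger0_norm ?sqn_ge0//.
by rewrite /sqn -!sumrB; apply: eq_bigr => k _; rewrite !mxE; ring.
Qed.

Lemma sqn_gt0 (z : 'rV[R]_n) : z != 0 -> 0 < sqn z.
Proof.
move=> z0; rewrite lt_neqAle sqn_ge0 andbT eq_sym; apply: contra z0 => /eqP s0.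
apply/eqP/rowP => k; rewrite mxE; apply/eqP; rewrite -sqrf_eq0 -(rwP eqP).
by apply: le_anti; rewrite sqr_ge0 -s0 ler_sqn.
Qed.

(** At the site [x i] the comparisons with the other sites are strict. The ball gives the cell
    positive measure and contains the cube needed for averaging. *)
Lemma cell_ball i : open Omega -> Omega (x i) -> injective x ->
  exists2 e : R, 0 < e & ball (x i) e `<=` cell i.
Proof.
move=> oO Oi xI.
have : nbhs (x i) (cell i).
  apply: filterI; first exact: open_nbhs_nbhs.
  apply: (@filterS _ _ _ [set z | forall j, j \in enum 'I_m -> j != i -> sqn (z - x i) < sqn (z - x j)]).
    move=> z h j; have [->|ji] := eqVneq j i; first by rewrite ltnn.
    by have := h j (mem_enum _ _) ji; split => //; exact: ltW.
  elim: (enum 'I_m) => [|j s IHs]; first exact: filterE.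
  have : nbhs (x i) [set z | j != i -> sqn (z - x i) < sqn (z - x j)].
    have [->|ji] := eqVneq j i; first exact: filterE.
    apply: (@filterS _ _ _ [set z | 0 < sqn (z - x j) - sqn (z - x i)]); first by move=> z; rewrite /= subr_gt0.
    have c : (fun z => sqn (z - x j) - sqn (z - x i)) z @[z --> x i] -->
        sqn (x i - x j) - sqn (x i - x i).
      exact: (cvgB (@continuous_sqn (x j) (x i)) (@continuous_sqn (x i) (x i))).
    apply: (cvgr_gt _ c); rewrite subrr sqn0 subr0; apply: sqn_gt0.
    by rewrite subr_eq0; apply: contra ji => /eqP /xI ->.
  move: IHs; apply: filterS2 => z h1 h2 k; rewrite inE => /orP[/eqP ->|]; first exact: h2.
  exact: h1.
by move=> /nbhs_ballP[e /= e0 eV]; exists e.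
Qed.

Lemma Rintegral_cells (f : 'rV[R]_n -> R) : (0 < m)%N -> measurable Omega ->
  mu.-integrable Omega (EFin \o f) ->
  \int[mu]_(z in Omega) f z = \sum_i \int[mu]_(z in cell i) f z.
Proof.
move=> m0 mO fi.
have iF i : mu.-integrable setT (EFin \o (f \_ (cell i))).
  rewrite -restrict_EFin; apply/(integrable_mkcond _ (measurable_cell i mO)).
  exact: (integrableS mO (measurable_cell i mO) (@cell_sub i) fi).
have [_] := @Rintegral_sum _ _ _ mu setT _ (index_enum 'I_m) (fun i => f \_ (cell i)) measurableT iF.
under [X in _ = X -> _]eq_bigr do rewrite -Rintegral_mkcond.
move=> <-; rewrite Rintegral_mkcond; apply: eq_Rintegral => z _; rewrite !patchE.
case: (boolP (z \in Omega)) => [/set_mem Oz|zO].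
  have [i iz] := cell_cover m0 Oz; rewrite (bigD1 i)//= patchE mem_set// big1 ?addr0// => j ji.
  rewrite patchE memNset// => jz; move: ji; rewrite (cell_disjoint iz jz) eqxx//.
rewrite big1// => i _; rewrite patchE memNset// => /cell_sub zO'; move: zO.
by rewrite mem_set.
Qed.

End voronoi.

Lemma sqnD_le (R : realType) n (x y : 'rV[R]_n) : sqn (x + y) <= 2 * sqn x + 2 * sqn y.
Proof.
rewrite /sqn !mulr_sumr -big_split/=; apply: ler_sum => i _; rewrite mxE.
by have := sqr_ge0 (x ord0 i - y ord0 i); rewrite -subr_ge0 => h; rewrite -subr_ge0; lra.
Qed.

(* The constant is 32 e^2 D^2, the cells having diameter at most D = 2 r. *)
Lemma poincare_cover (R : realType) n m (Omega : set 'rV[R]_n) (x : 'I_m -> 'rV[R]_n) (r : R) u g :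
  open Omega -> bounded_set Omega ->
  convex_rV Omega ->
  (0 < m)%N -> (forall i, Omega (x i)) -> injective x -> 0 < r ->
  (forall z, Omega z -> exists i, sqn (z - x i) <= r ^+ 2) ->
  H1 Omega u g ->
  sqi (lebesgue_rV n) Omega u <=
    128 * expR 1 ^+ 2 * r ^+ 2 * \sum_i sqi (lebesgue_rV n) Omega (g i) +
    \sum_i (\int[lebesgue_rV n]_(z in cell Omega x i) u z) ^+ 2 /
       fine (lebesgue_rV n (cell Omega x i)).
Proof.
set mu := lebesgue_rV n.
move=> oO bO cO m0 Ox xI r0 rP Hu; have [Lu' Lg' wg] := Hu.
have mO := open_measurable_rV oO.
have Lu : L2 mu Omega u by exact/L2_onP.
have Lg j : L2 mu Omega (g j) by exact/L2_onP.
have mC i := measurable_cell x i mO.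
have bC i : bounded_set (cell Omega x i) 
  by have [M [Mr HM]] := bO; exists M; split => // N MN z /cell_sub; exact: HM.
rewrite /sqi (Rintegral_cells x m0 mO Lu.2).
under [X in _ <= _ * X + _]eq_bigr do rewrite (Rintegral_cells x m0 mO (Lg _).2).
rewrite exchange_big/= mulr_sumr -big_split/=; apply: ler_sum => i _.
have [e e0 eC] := cell_ball oO (Ox i) xI.
have V0 : (0 < mu (cell Omega x i))%E.
  apply: (lt_le_trans (lebesgue_rV_ball_gt0 (x i) e0)); apply: le_measure => //; rewrite inE//.
  exact: measurable_ball_rV.
have e2 : 0 < e / 2 by rewrite divr_gt0.
have Q (p : 'rV[R]_n) : (forall k, 0 <= p ord0 k <= 1) -> cell Omega x i (x i + (e / 2) *: p).
  move=> p01; apply: eC; split => // j k; rewrite ord1 /ball/= !mxE opprD addrA subrr sub0r normrN.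
  have /andP[p0 p1] := p01 k; rewrite ger0_norm; last exact: mulr_ge0 (ltW e2) p0.
  apply: (@le_lt_trans _ _ (e / 2)); first by rewrite ler_piMr// ltW.
  by rewrite ltr_pdivrMr// ltr_pMr// ltr1n.
have D0 : 0 < 2 * r by rewrite mulr_gt0.
have near z : cell Omega x i z -> sqn (z - x i) <= r ^+ 2.
  by move=> [Oz zi]; have [k zk] := rP z Oz; exact: le_trans (zi k).1 zk.
have diam y z : cell Omega x i y -> cell Omega x i z -> sqn (y - z) <= (2 * r) ^+ 2.
  move=> /near ny /near nz; rewrite (_ : y - z = (y - x i) + (x i - z)); last by rewrite addrA subrK.
  rewrite (le_trans (sqnD_le _ _))// [sqn (x i - z)]sqn_sub_sym exprMn; lra.
have := poincare_convex (mC i) (bounded_lebesgue_rV_lty (mC i) (bC i)) (cell_convex cO) e2 Q oO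
  (@cell_sub _ _ _ Omega x i) (bC i) V0 D0 diam Hu.
rewrite (_ : 32 * expR 1 ^+ 2 * (2 * r) ^+ 2 = 128 * expR 1 ^+ 2 * r ^+ 2)//.
by ring.
Qed.

(** * Separated families of points *)

Section separated.
Context (R : realType) (n : nat) (Omega : set 'rV[R]_n).
Implicit Types (r : R) (m k : nat).

Definition spread r m (x : 'I_m -> 'rV[R]_n) :=
  (forall i, Omega (x i)) /\ forall i j, i != j -> r ^+ 2 <= sqn (x i - x j).

Lemma separated_inj r m (x : 'I_m -> 'rV[R]_n) : 0 < r -> spread r x -> injective x.
Proof.
move=> r0 [_ sx] i j xij; apply/eqP; apply: contraT => /sx.
by rewrite xij subrr sqn0 leNgt exprn_gt0.
Qed.

Lemma separatedS r r' m m' : 0 <= r' <= r -> (m' <= m)%N ->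
  (exists x : 'I_m -> 'rV[R]_n, spread r x) -> exists x : 'I_m' -> 'rV[R]_n, spread r' x.
Proof.
move=> /andP[r0 rr] mm [x [Ox sx]]; exists (x \o widen_ord mm); split => [i|i j ij]; first exact: Ox.
apply: le_trans (sx _ _ _); first by rewrite ler_sqr ?nnegrE// (le_trans r0).
by apply: contra ij => /eqP/(congr1 val)/= ij; exact/eqP/val_inj.
Qed.

(** Pigeonhole on a grid of step h = r/(n + 1): two points in the same box are at squared distance
    at most n h^2 < r^2. *)
Lemma separated_bounded r : bounded_set Omega -> 0 < r ->
  exists N, forall m (x : 'I_m -> 'rV[R]_n), spread r x -> (m <= N)%N.
Proof.
move=> /bounded_set_ball[M M0 OM] r0.
pose h := r / n.+1%:R; have h0 : 0 < h by rewrite divr_gt0.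
pose N := Num.truncn ((M + M) / h).
exists #|{ffun 'I_n -> 'I_N.+1}| => m x [Ox sx].
have b i (k : 'I_n) : 0 <= (x i ord0 k + M) / h <= (M + M) / h.
  have /= [_ /(_ ord0 k)] := OM _ (Ox i); rewrite /ball/= mxE sub0r normrN => /ltr_normlP[h1 h2].
  by rewrite divr_ge0 ?(ltW h0)//= ?ler_pM2r ?invr_gt0//; lra.
pose f i : {ffun 'I_n -> 'I_N.+1} := [ffun k => inord (Num.truncn ((x i ord0 k + M) / h))].
suff fI : injective f by rewrite -[X in (X <= _)%N]card_ord; exact: leq_card fI.
move=> i j fij; apply/eqP; apply: contraT => /sx; rewrite leNgt => /negP h'; exfalso; apply: h'.
have d (k : 'I_n) : (x i - x j) ord0 k ^+ 2 <= h ^+ 2.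
  have := congr1 (fun F : {ffun 'I_n -> 'I_N.+1} => nat_of_ord (F k)) fij.
  have /andP[i0 i1] := b i k; have /andP[j0 j1] := b j k.
  rewrite /f !ffunE !inordK ?ltnS ?le_truncn// => e.
  have := truncn_itv i0; have := truncn_itv j0; rewrite e.
  set t := Num.truncn _; rewrite -natr1 !ler_pdivlMr// !ltr_pdivrMr// => /andP[a1 a2] /andP[a3 a4].
  rewrite !mxE -(ger0_norm (sqr_ge0 _)) -[leRHS]ger0_norm ?sqr_ge0// !normrX.
  rewrite ler_sqr ?nnegrE// (ger0_norm (ltW h0)) ler_norml; lra.
apply: (@le_lt_trans _ _ (n%:R * h ^+ 2)).
  by rewrite mulr_natl -[X in _ *+ X]card_ord -sumr_const; apply: ler_sum => k _; exact: d.
rewrite /h expr_div_n mulrCA gtr_pMr ?exprn_gt0//.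
rewrite ltr_pdivrMr ?exprn_gt0// mul1r -natrX ltr_nat.
by rewrite (@leq_trans (n.+1 ^ 1))// leq_pexp2l.
Qed.

Lemma maximal_separated r : bounded_set Omega -> 0 < r ->
  exists m (x : 'I_m -> 'rV[R]_n), spread r x /\
    forall z, Omega z -> exists i, sqn (z - x i) <= r ^+ 2.
Proof.
move=> bO r0; have [N NP] := separated_bounded bO r0.
pose P m := `[< exists x : 'I_m -> 'rV[R]_n, spread r x >].
have P0 : exists m, P m.
  by exists 0%N; apply/asboolP; exists (fun=> 0); split => -[].
have PN m : P m -> (m <= N)%N by move=> /asboolP[x /NP].
have [m /asboolP[x sx] mmax] := ex_maxnP P0 PN.
exists m, x; split => // z Oz; apply: contrapT => nz.
suff /mmax : P m.+1 by rewrite ltnn.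
have far i : r ^+ 2 <= sqn (z - x i).
  by rewrite leNgt; apply/negP => h; apply: nz; exists i; exact: ltW.
apply/asboolP; exists (fun i => if unlift ord0 i is Some j then x j else z).
split => [i|i j]; first by case: unlift => // j; exact: sx.1.
case: (unliftP ord0 i) => [i'|] ->; case: (unliftP ord0 j) => [j'|] -> //.
- by rewrite (inj_eq lift_inj); exact: sx.2.
- by move=> _; rewrite sqn_sub_sym.
Qed.

(* The additional point is the midpoint of a closest pair. *)
Lemma separated_midpoint r k :
  convex_rV Omega ->
  0 <= r -> (2 <= k)%N -> (exists x : 'I_k -> 'rV[R]_n, spread r x) ->
  exists x : 'I_k.+1 -> 'rV[R]_n, spread (r / 2) x.
Proof.
move=> cO r0 k2 [x [Ox sx]]; have k0 : (0 < k)%N by exact: leq_trans k2.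
pose d (p : 'I_k * 'I_k) := sqn (x p.1 - x p.2).
pose p0 := (Ordinal k0, Ordinal k2).
have [[a b] /= ab dmin] := @arg_minP _ _ _ p0 (fun p => p.1 != p.2) d isT.
pose z := 2^-1 *: (x a + x b).
have Oz : Omega z.
  have h01 : 0 <= (2^-1 : R) <= 1 by rewrite invr_ge0 ler0n/= invf_le1// ler1n.
  have := cO _ _ _ h01 (Ox a) (Ox b); congr Omega.
  by rewrite /z scalerDr; congr (_ *: _ + _); lra.
(* With d the minimal squared distance, the parallelogram identity gives d/4 for an endpoint of the
   closest pair and at least 3 d/4 for any other point. *)
have far l : (r / 2) ^+ 2 <= sqn (z - x l).
  rewrite /z sqn_midpoint exprMn exprVn.
  have rab := sx _ _ ab; have rr := sqr_ge0 r.
  have la : l != a -> sqn (x a - x b) <= sqn (x a - x l) by move=> la; apply: (dmin (a, l)); rewrite eq_sym.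
  have lb : l != b -> sqn (x a - x b) <= sqn (x b - x l) by move=> lb; apply: (dmin (b, l)); rewrite eq_sym.
  have [la'|/la da] := eqVneq l a.
    by rewrite la' subrr sqn0 [sqn (x b - _)]sqn_sub_sym; lra.
  have [lb'|/lb db] := eqVneq l b; last by lra.
  by rewrite lb' subrr sqn0; lra.
exists (fun i => if unlift ord0 i is Some j then x j else z).
split => [i|i j]; first by case: unlift => // j; exact: sx.1.
have rr : (r / 2) ^+ 2 <= r ^+ 2 by rewrite ler_sqr ?nnegrE ?divr_ge0//; lra.
case: (unliftP ord0 i) => [i'|] ->; case: (unliftP ord0 j) => [j'|] -> //.
- by rewrite (inj_eq lift_inj) => /sx; exact: le_trans.
- by move=> _; rewrite sqn_sub_sym.
Qed.

(** A small radius admits k points, and repeated doubling fails at some stage because [Omega] is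
    bounded; r is the last radius that succeeds. *)
Lemma separated_doubling k : (0 < n)%N -> (2 <= k)%N -> open Omega -> bounded_set Omega ->
  Omega !=set0 -> exists r, [/\ 0 < r, exists x : 'I_k -> 'rV[R]_n, spread r x &
    ~ exists x : 'I_k -> 'rV[R]_n, spread (2 * r) x].
Proof.
move=> n0 k2 oO bO [p Op].
have /nbhs_ballP[e /= e0 eO] : nbhs p Omega by exact: open_nbhs_nbhs.
have kk : 0 < k%:R :> R by rewrite ltr0n (leq_trans _ k2).
(* The k points are p + i r0 along the first coordinate axis, for i < k; they stay in the ball of
   radius e. *)
pose r0 := e / k%:R; have r00 : 0 < r0 by rewrite divr_gt0.
have s0 : exists x : 'I_k -> 'rV[R]_n, spread r0 x.
  exists (fun i => p + (r0 * i%:R) *: delta_mx 0 (Ordinal n0)); split => [i|i j ij].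
    apply: eO; split => // a b; rewrite ord1 /ball/= !mxE opprD addrA subrr sub0r normrN.
    rewrite eqxx/= ger0_norm; last by rewrite !mulr_ge0// ltW.
    apply: (@le_lt_trans _ _ (r0 * i%:R)); first by apply: ler_piMr; [rewrite mulr_ge0 ?(ltW r00)|case: eqP].
    by rewrite /r0 -mulrA gtr_pMr// mulrC ltr_pdivrMr// mul1r ltr_nat.
  apply: le_trans (ler_sqn _ (Ordinal n0)); rewrite !mxE !eqxx !mulr1.
  rewrite (_ : _ - _ = r0 * (i%:R - j%:R)); last by ring.
  rewrite [leRHS]exprMn ler_peMr ?sqr_ge0//.
  rewrite -(@ger0_norm _ (_ ^+ 2)) ?sqr_ge0// normrX exprn_ege1//.
  have key (a b : nat) : (a < b)%N -> 1 <= `|b%:R - a%:R| :> R.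
    by move=> ab; rewrite -natrB ?(ltnW ab)// normr_nat ler1n subn_gt0.
  by move: ij; rewrite -val_eqE neq_ltn => /orP[/key|/key//]; rewrite distrC.
have [M M0 OM] := bounded_set_ball bO.
pose C : R := \sum_(i < n) (M + M) ^+ 2.
have dC x y : Omega x -> Omega y -> sqn (x - y) <= C.
  move=> Ox Oy; apply: ler_sum => i _; rewrite mxE.
  have /= [_ /(_ ord0 i)] := OM _ Ox; have /= [_ /(_ ord0 i)] := OM _ Oy.
  rewrite /ball/= !mxE !sub0r !normrN => /ltr_normlP[h1 h2] /ltr_normlP[h3 h4].
  rewrite -(ger0_norm (sqr_ge0 _)) -[leRHS]ger0_norm ?sqr_ge0// !normrX.
  by rewrite ler_sqr ?nnegrE// (ger0_norm (addr_ge0 (ltW M0) (ltW M0))) ler_norml; lra.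
pose P t := `[< ~ exists x : 'I_k -> 'rV[R]_n, spread (2 ^+ t * r0) x >].
have exP : exists t, P t.
  (* Then 2^(t+1) r0 > C + 1, and (C + 1)^2 exceeds the bound C on squared distances. *)
  pose t := Num.truncn ((C + 1) / r0).
  have C0 : 0 <= C by apply: sumr_ge0 => i _; exact: sqr_ge0.
  exists t.+1; apply/asboolP => -[x [Ox sx]].
  have := le_trans (sx (Ordinal (leq_trans (isT : (0 < 2)%N) k2)) (Ordinal k2) isT) (dC _ _ (Ox _) (Ox _)).
  apply/negP; rewrite -ltNge.
  have big : C + 1 < 2 ^+ t.+1 * r0.
    rewrite -ltr_pdivrMr//.
    have /truncn_itv/andP[_ h] : 0 <= (C + 1) / r0 by rewrite divr_ge0 ?addr_ge0 ?(ltW r00).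
    by rewrite (lt_le_trans h)// -natrX ler_nat ltnW// ltn_expl.
  have : (C + 1) ^+ 2 < (2 ^+ t.+1 * r0) ^+ 2 by rewrite ltr_sqr ?nnegrE ?addr_ge0// ltW// (le_lt_trans _ big)// addr_ge0.
  apply: le_lt_trans; have := sqr_ge0 C; lra.
have [t /asboolP Pt tmin] := ex_minnP exP.
case: t Pt tmin => [|t]; first by rewrite expr0 mul1r.
rewrite exprS -mulrA => Pt tmin; exists (2 ^+ t * r0); split => //.
  by rewrite mulr_gt0// exprn_gt0.
apply: contrapT => nt; have /tmin : P t by apply/asboolP.
by rewrite ltnn.
Qed.

End separated.

(** * The Neumann spectrum *)

Section test_functions.
Context (R : realType) (n : nat).
Implicit Types (Omega : set 'rV[R]_n) (phi : 'rV[R]_n -> R).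

Lemma test_function_partial_out Omega phi : test_function Omega phi ->
  exists K : set 'rV[R]_n, [/\ compact K, K `<=` Omega,
    forall x, ~ K x -> phi x = 0 & forall i x, ~ K x -> partial i phi x = 0].
Proof.
move=> [sphi [K [cK KO phiK]]]; exists K; split => // i x Kx.
have : nbhs x (~` K).
  by apply: open_nbhs_nbhs; split => //; apply: closed_openC; apply: compact_closed => //; exact: norm_hausdorff.
move=> nK; have [_ <-] : is_derive x (delta_mx 0 i) phi 0; last by [].
apply: near_eq_is_derive (is_derive_cst (0 : R) x (delta_mx 0 i)).
by move: nK; apply: filterS => y Ky; rewrite phiK.
Qed.

Lemma test_function_bounded Omega phi : test_function Omega phi ->
  (continuous phi /\ exists B : R, forall x, `|phi x| <= B) /\
  forall i, (continuous (partial i phi) /\ exists B : R, forall x, `|partial i phi x| <= B).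
Proof.
move=> tphi; have [K [cK KO phiK dphiK]] := test_function_partial_out tphi.
have bounded (f : 'rV[R]_n -> R) : continuous f -> (forall x, ~ K x -> f x = 0) ->
    exists B : R, forall x, `|f x| <= B.
  move=> cf fK.
  have /compact_bounded : compact (f @` K) by apply: continuous_compact => //; exact: continuous_subspaceT.
  move=> /pinfty_ex_gt0[B B0 HB]; exists B => x.
  have [Kx|Kx] := pselect (K x); first by apply: HB; exists x.
  by rewrite fK// normr0 ltW.
have [sphi _] := tphi.
split; last move=> i.
  have c : continuous phi by move=> x; have [] := sphi [::] x I.
  by split => //; exact: bounded.
have c : continuous (partial i phi) by move=> x; have [] := sphi [:: i] x I.
by split => //; apply: bounded => // x Kx; exact: dphiK.
Qed.

Lemma test_function_bounded_mfun Omega phi : measurable Omega -> test_function Omega phi ->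
  bounded_mfun Omega phi /\ forall i, bounded_mfun Omega (partial i phi).
Proof.
move=> mO /test_function_bounded[[cphi [B HB]] H]; split; last move=> i.
  by split; [apply: measurable_funTS; exact: continuous_measurable_fun_rV|exists B].
have [c [C HC]] := H i.
by split; [apply: measurable_funTS; exact: continuous_measurable_fun_rV|exists C].
Qed.

End test_functions.

Section inner_product.
Context d (T : measurableType d) (R : realType) (mu : {measure set T -> \bar R}).
Context (D : set T) (mD : measurable D).
Implicit Types (u v w : T -> R).

Definition ip u v : R := \int[mu]_(x in D) (u x * v x).

Lemma ipC u v : ip u v = ip v u.
Proof. by apply: eq_Rintegral => x _; rewrite mulrC. Qed.

Lemma ip_sqi u : ip u u = sqi mu D u.
Proof. by apply: eq_Rintegral => x _; rewrite expr2. Qed.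

Lemma eq_ip u u' v v' : (forall x, D x -> u x = u' x) -> (forall x, D x -> v x = v' x) ->
  ip u v = ip u' v'.
Proof. by move=> uu vv; apply: eq_Rintegral => x /set_mem Dx; rewrite uu ?vv. Qed.

Lemma ip_linear t u v w : L2 mu D u -> L2 mu D v -> L2 mu D w ->
  ip (fun x => t * u x + v x) w = t * ip u w + ip v w.
Proof.
move=> Lu Lv Lw; have i1 := L2M mD Lu Lw; have i2 := L2M mD Lv Lw.
rewrite /ip -RintegralZl// -RintegralD//; last exact: (integrableZl mD t i1).
by apply: eq_Rintegral => x _; ring.
Qed.

Lemma sqi_linear t u v : L2 mu D u -> L2 mu D v ->
  sqi mu D (fun x => t * u x + v x) = t ^+ 2 * sqi mu D u + 2 * t * ip u v + sqi mu D v.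
Proof.
move=> Lu Lv; have Ltu := L2Z mD t Lu; have L1 := L2D mD Ltu Lv.
rewrite -ip_sqi ip_linear// [ip u _]ipC [ip v _]ipC !ip_linear//.
by rewrite !ip_sqi [ip v u]ipC; ring.
Qed.

Lemma cauchy_schwarz u v : L2 mu D u -> L2 mu D v -> ip u v ^+ 2 <= sqi mu D u * sqi mu D v.
Proof.
move=> Lu Lv.
have H t : 0 <= t ^+ 2 * sqi mu D u + 2 * t * ip u v + sqi mu D v.
  by rewrite -sqi_linear// sqi_ge0.
have := sqi_ge0 mu D u; rewrite le_eqVlt => /orP[/eqP A0|A0].
  have [->|B0] := eqVneq (ip u v) 0; first by rewrite expr0n/= mulr_ge0 ?sqi_ge0.
  (* When the leading coefficient vanishes, this t gives the trinomial the value -1. *)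
  have := H (- (sqi mu D v + 1) / (2 * ip u v)); rewrite -A0 mulr0 add0r.
  rewrite (_ : 2 * _ * _ + _ = -1); first by rewrite ler0N1.
  by field.
have := H (- ip u v / sqi mu D u); rewrite -(pmulr_rge0 _ A0) => h.
rewrite -subr_ge0; apply: le_trans h _.
by rewrite le_eqVlt; apply/orP; left; apply/eqP; field; rewrite gt_eqF.
Qed.

Lemma ip_sum (I : Type) (s : seq I) (c : I -> R) (F : I -> T -> R) w :
  (forall i, L2 mu D (F i)) -> L2 mu D w ->
  ip (fun x => \sum_(i <- s) c i * F i x) w = \sum_(i <- s) c i * ip (F i) w.
Proof.
move=> LF Lw; elim: s => [|i s IHs].
  rewrite big_nil -[RHS](mul0r (fine (mu D))) -Rintegral_cst//; apply: eq_Rintegral => x _.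
  by rewrite big_nil mul0r.
rewrite big_cons -IHs -ip_linear//; last by apply: L2_sum => // j; exact: L2Z.
by apply: eq_ip => // x _; rewrite big_cons.
Qed.

End inner_product.

(** * The space H1 and its closedness *)

Section H1.
Context (R : realType) (n : nat) (Omega : set 'rV[R]_n).
Hypothesis oO : open Omega.
Hypothesis bO : bounded_set Omega.
Local Notation mu := (@lebesgue_rV R n).
Implicit Types (u v : 'rV[R]_n -> R) (g h : 'I_n -> 'rV[R]_n -> R).

Let mO : measurable Omega := open_measurable_rV oO.
Let Ooo : (mu Omega < +oo)%E := bounded_lebesgue_rV_lty mO bO.

Lemma H1_L2 u g : H1 Omega u g -> L2 mu Omega u /\ forall i, L2 mu Omega (g i).
Proof. by move=> [Lu Lg _]; split => [|i]; [exact/L2_onP|exact/L2_onP]. Qed.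

Let L2_test phi : test_function Omega phi ->
  L2 mu Omega phi /\ forall i, L2 mu Omega (partial i phi).
Proof.
move=> /(test_function_bounded_mfun mO)[b1 b2].
by split => [|i]; exact: bounded_mfun_L2.
Qed.

Lemma H1P u g : H1 Omega u g <-> [/\ L2 mu Omega u, forall i, L2 mu Omega (g i) &
  forall i phi, test_function Omega phi ->
    ip mu Omega u (partial i phi) = - ip mu Omega (g i) phi].
Proof.
split=> [Hu|[Lu Lg wg]].
  by have [Lu Lg] := H1_L2 Hu; have [_ _ wg] := Hu.
by split => [|i|//]; exact/L2_onP.
Qed.

Lemma H1_linear t u g v h : H1 Omega u g -> H1 Omega v h ->
  H1 Omega (fun x => t * u x + v x) (fun i x => t * g i x + h i x).
Proof.
move=> /H1P[Lu Lg wg] /H1P[Lv Lh wh]; apply/H1P; split.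
- by apply: L2D => //; exact: L2Z.
- by move=> i; apply: L2D => //; exact: L2Z.
- move=> i phi tphi; have [Lp Ldp] := L2_test tphi.
  by rewrite !ip_linear// wg// wh//; ring.
Qed.

Lemma H1_0 : H1 Omega (fun=> 0) (fun _ _ => 0).
Proof.
have L0 : L2 mu Omega (fun=> 0) by exact: bounded_mfun_L2 (bounded_mfun_cst _ _).
apply/H1P; split => // i phi tphi; have [Lp Ldp] := L2_test tphi.
have ip0 w : ip mu Omega (fun=> 0) w = 0.
  by rewrite /ip; under eq_Rintegral do rewrite mul0r; rewrite Rintegral_cst// mul0r.
by rewrite !ip0 oppr0.
Qed.

Lemma H1_sum (I : Type) (s : seq I) (c : I -> R) (u : I -> 'rV[R]_n -> R)
    (g : I -> 'I_n -> 'rV[R]_n -> R) :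
  (forall j, H1 Omega (u j) (g j)) ->
  H1 Omega (fun x => \sum_(j <- s) c j * u j x) (fun i x => \sum_(j <- s) c j * g j i x).
Proof.
move=> Hu; elim: s => [|j s IHs].
  under [X in H1 _ X]funext do rewrite big_nil.
  rewrite (_ : (fun i x => \sum_(j <- [::]) c j * g j i x) = (fun _ _ => 0)); first exact: H1_0.
  by apply/funext => i; apply/funext => x; rewrite big_nil.
under [X in H1 _ X]funext do rewrite big_cons.
rewrite (_ : (fun i x => \sum_(j <- j :: s) c j * g j i x) = (fun i x => c j * g j i x + \sum_(j <- s) c j * g j i x)); first exact: H1_linear.
by apply/funext => i; apply/funext => x; rewrite big_cons.
Qed.

(** For a fixed test function, both sides of the weak gradient identity are continuous in L2, by
    Cauchy-Schwarz. *)
Lemma H1_closed (u : nat -> 'rV[R]_n -> R) (g : nat -> 'I_n -> 'rV[R]_n -> R) v h :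
  (forall k, H1 Omega (u k) (g k)) -> L2 mu Omega v -> (forall i, L2 mu Omega (h i)) ->
  (forall e, 0 < e -> exists k, sqi mu Omega (fun x => u k x - v x) <= e /\
     forall i, sqi mu Omega (fun x => g k i x - h i x) <= e) ->
  H1 Omega v h.
Proof.
move=> Hu Lv Lh cvg; apply/H1P; split => // i phi tphi.
have [Lp Ldp] := L2_test tphi.
apply/eqP; rewrite -subr_eq0 opprK -normr_le0; apply/ler_addgt0Pl => e e0; rewrite addr0.
pose C := sqi mu Omega (partial i phi) + sqi mu Omega phi + 1.
have C0 : 0 < C by rewrite ltr_wpDl// addr_ge0// sqi_ge0.
have d0 : 0 < (e / 2) ^+ 2 / C by rewrite divr_gt0 ?exprn_gt0 ?divr_gt0.
have [k [uk gk]] := cvg _ d0; have /H1P[Lu Lg wg] := Hu k.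
have small f p : L2 mu Omega f -> L2 mu Omega p -> sqi mu Omega p <= C ->
    sqi mu Omega f <= (e / 2) ^+ 2 / C -> `|ip mu Omega f p| <= e / 2.
  move=> Lf Lp' pC fe; rewrite -ler_sqr ?nnegrE ?divr_ge0 ?(ltW e0)// real_normK ?num_real//.
  apply: (le_trans (cauchy_schwarz mO Lf Lp')).
  rewrite -[leRHS](@divfK _ C) ?gt_eqF//; apply: ler_pM => //; exact: sqi_ge0.
have s1 : `|ip mu Omega (fun x => u k x - v x) (partial i phi)| <= e / 2.
  apply: small => //; first exact: L2B.
  by rewrite /C -addrA lerDl addr_ge0// sqi_ge0.
have s2 : `|ip mu Omega (fun x => g k i x - h i x) phi| <= e / 2.
  apply: small => //; first exact: L2B.
  by rewrite /C addrAC lerDr addr_ge0// sqi_ge0.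
have ipB f f' p : L2 mu Omega f -> L2 mu Omega f' -> L2 mu Omega p ->
    ip mu Omega (fun x => f x - f' x) p = ip mu Omega f p - ip mu Omega f' p.
  move=> Lf Lf' Lp'; have := ip_linear mO (-1) Lf' Lf Lp'; rewrite mulN1r addrC => <-.
  by apply: eq_ip => // x _; rewrite mulN1r addrC.
move: s1 s2; rewrite !ipB// wg// !ler_norml; lra.
Qed.

(* The unused proofs let canonical structure inference find the closure properties. *)
Definition H1_pred (_ : open Omega) (_ : bounded_set Omega) :
    {pred (('rV[R]_n -> R^o) * ('I_n -> 'rV[R]_n -> R^o))%type} :=
  fun w => `[< H1 Omega w.1 w.2 >].

Lemma H1_submod_closed : GRing.submod_closed (H1_pred oO bO).
Proof.
split; first by apply/asboolP; exact: H1_0.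
by move=> t u v /asboolP Hu /asboolP Hv; apply/asboolP; exact: (H1_linear t Hu Hv).
Qed.

HB.instance Definition _ := GRing.isSubmodClosed.Build _ _ (H1_pred oO bO) H1_submod_closed.

(** Pairs of a function and a weak gradient, without passing to classes modulo null sets: the module
    laws then hold pointwise, at the price of semidefinite forms. *)
Definition energy := {w : ('rV[R]_n -> R^o) * ('I_n -> 'rV[R]_n -> R^o) | w \in H1_pred oO bO}.

HB.instance Definition _ := SubChoice.on energy.
HB.instance Definition _ := [SubChoice_isSubLmodule of energy by <:].

Definition en_fun (w : energy) : 'rV[R]_n -> R := (val w).1.
Definition en_grad (w : energy) : 'I_n -> 'rV[R]_n -> R := (val w).2.

Lemma en_H1 w : H1 Omega (en_fun w) (en_grad w).
Proof. by have /asboolP := valP w. Qed.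

Definition en_mk u g (Hu : H1 Omega u g) : energy :=
  exist (fun w => w \in H1_pred oO bO) ((u : 'rV[R]_n -> R^o), (g : 'I_n -> 'rV[R]_n -> R^o)) (asboolT Hu).

Lemma en_funP t w w' x : en_fun (t *: w + w') x = t * en_fun w x + en_fun w' x.
Proof. by []. Qed.

Lemma en_gradP t w w' i x : en_grad (t *: w + w') i x = t * en_grad w i x + en_grad w' i x.
Proof. by []. Qed.

End H1.

(** * Existence of eigenvalues, and bounds in both directions *)

Section neumann_spectrum.
Context (R : realType) (n : nat) (Omega : set 'rV[R]_n).
Hypothesis oO : open Omega.
Hypothesis bO : bounded_set Omega.
Hypothesis cO : convex_rV Omega.
Hypothesis Omega_neq0 : Omega !=set0.
Local Notation mu := (@lebesgue_rV R n).
Local Notation E := (energy oO bO).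

Let mO : measurable Omega := open_measurable_rV oO.
Let Ooo : (mu Omega < +oo)%E := bounded_lebesgue_rV_lty mO bO.

Let a (v w : E) : R := \sum_i ip mu Omega (en_grad v i) (en_grad w i).
Let b (v w : E) : R := ip mu Omega (en_fun v) (en_fun w).

Let Lf (w : E) : L2 mu Omega (en_fun w) := (H1_L2 oO (en_H1 w)).1.
Let Lg (w : E) i : L2 mu Omega (en_grad w i) := (H1_L2 oO (en_H1 w)).2 i.

Let aP t u v w : a (t *: u + v) w = t * a u w + a v w.
Proof.
rewrite /a mulr_sumr -big_split/=; apply: eq_bigr => i _.
by rewrite -ip_linear//; apply: eq_ip => // x _; rewrite en_gradP.
Qed.

Let bP t u v w : b (t *: u + v) w = t * b u w + b v w.
Proof. by rewrite /b -ip_linear//; apply: eq_ip => // x _; rewrite en_funP. Qed.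

Let aC u v : a u v = a v u.
Proof. by apply: eq_bigr => i _; exact: ipC. Qed.

Let bC u v : b u v = b v u.
Proof. exact: ipC. Qed.

Let a_ge0 u : 0 <= a u u.
Proof. by apply: sumr_ge0 => i _; rewrite ip_sqi sqi_ge0. Qed.

Let b_ge0 u : 0 <= b u u.
Proof. by rewrite /b ip_sqi sqi_ge0. Qed.

Let en_funB (u v : E) x : en_fun (u - v) x = en_fun u x - en_fun v x.
Proof. by []. Qed.

Let en_gradB (u v : E) i x : en_grad (u - v) i x = en_grad u i x - en_grad v i x.
Proof. by []. Qed.

Let form_complete (u : nat -> E) :
  (forall e, 0 < e -> exists N : nat, forall i j, (N <= i)%N -> (N <= j)%N ->
     a (u i - u j) (u i - u j) + b (u i - u j) (u i - u j) <= e) ->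
  exists v, forall e, 0 < e -> exists N : nat, forall i, (N <= i)%N ->
     a (u i - v) (u i - v) + b (u i - v) (u i - v) <= e.
Proof.
move=> Cu.
have bE (v w : E) : b (v - w) (v - w) = sqi mu Omega (fun x => en_fun v x - en_fun w x).
  by rewrite /b ip_sqi; apply: eq_sqi => x _; rewrite en_funB.
have aE (v w : E) : a (v - w) (v - w) = \sum_i sqi mu Omega (fun x => en_grad v i x - en_grad w i x).
  by apply: eq_bigr => i _; rewrite ip_sqi; apply: eq_sqi => x _; rewrite en_gradB.
have le_a (v w : E) i : sqi mu Omega (fun x => en_grad v i x - en_grad w i x) <= a (v - w) (v - w).
  rewrite aE (bigD1 i)//= lerDl; apply: sumr_ge0 => j _; exact: sqi_ge0.
have [|v [Lv vP]] := L2_complete mO Ooo (fun k => Lf (u k)).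
  move=> e /Cu[N NP]; exists N => i j Ni Nj; apply: le_trans (NP i j Ni Nj).
  by rewrite bE lerDr.
have /choice[h hP] : forall i, exists h, L2 mu Omega h /\ forall e, 0 < e ->
    exists N : nat, forall k, (N <= k)%N -> sqi mu Omega (fun x => en_grad (u k) i x - h x) <= e.
  move=> i; apply: (L2_complete mO Ooo (fun k => Lg (u k) i)).
  move=> e /Cu[N NP]; exists N => k l Nk Nl; apply: le_trans (NP k l Nk Nl).
  by rewrite (le_trans (le_a _ _ i))// lerDl.
have unif e : 0 < e -> exists N : nat, forall k, (N <= k)%N ->
    sqi mu Omega (fun x => en_fun (u k) x - v x) <= e /\
    forall i, sqi mu Omega (fun x => en_grad (u k) i x - h i x) <= e.
  move=> e0; have [N0 N0P] := vP e e0.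
  have /choice[N NP] : forall i, exists N : nat, forall k, (N <= k)%N ->
      sqi mu Omega (fun x => en_grad (u k) i x - h i x) <= e by move=> i; exact: (hP i).2.
  exists (maxn N0 (\max_i N i)) => k; rewrite geq_max => /andP[k0 k1]; split; first exact: N0P.
  by move=> i; apply: NP; apply: leq_trans k1; exact: leq_bigmax.
have HV : H1 Omega v h.
  apply: (H1_closed oO bO (fun k => en_H1 (u k)) Lv (fun i => (hP i).1)).
  by move=> e /unif[N NP]; exists N; exact: NP.
exists (en_mk oO bO HV) => e e0.
have d0 : 0 < e / n.+1%:R by rewrite divr_gt0.
have [N NP] := unif _ d0; exists N => k /NP[h1 h2].
rewrite bE aE.
apply: (@le_trans _ _ (\sum_(i < n) (e / n.+1%:R) + e / n.+1%:R)).
  by apply: lerD => //; apply: ler_sum => i _; exact: h2.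
by rewrite sumr_const card_ord -mulrSr -[_ *+ n.+1]mulr_natr divfK.
Qed.

(** The Poincare inequality on Voronoi cells of radius r with 128 exp(1)^2 r^2 = e. The functionals
    are the integrals over the cells divided by the square root of the measures; they are bounded by
    Cauchy-Schwarz. *)
Let form_compact e : 0 < e -> exists (N : nat) (L : 'I_N -> E -> R),
  [/\ forall i t u v, L i (t *: u + v) = t * L i u + L i v,
      forall i, exists C, forall u, L i u ^+ 2 <= C * b u u &
      forall u, b u u <= e * a u u + \sum_i L i u ^+ 2].
Proof.
move=> e0.
have K0 : 0 < 128 * expR 1 ^+ 2 :> R by rewrite mulr_gt0// exprn_gt0// expR_gt0.
pose r := Num.sqrt (e / (128 * expR 1 ^+ 2)).
have r0 : 0 < r by rewrite sqrtr_gt0 divr_gt0.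
have rE : 128 * expR 1 ^+ 2 * r ^+ 2 = e.
  by rewrite sqr_sqrtr ?divr_ge0 ?ltW// mulrC divfK// gt_eqF.
have [m [x [sx cx]]] := maximal_separated bO r0.
have [Ox _] := sx; have xI := separated_inj r0 sx.
have m0 : (0 < m)%N by have [z Oz] := Omega_neq0; have [i _] := cx z Oz; exact: leq_ltn_trans (ltn_ord i).
pose C i := cell Omega x i.
have mC i : measurable (C i) := measurable_cell x i mO.
have CO i : C i `<=` Omega by exact: cell_sub.
have Coo i : (mu (C i) < +oo)%E by apply: le_lt_trans Ooo; apply: le_measure => //; rewrite inE.
have C0 i : 0 < fine (mu (C i)).
  rewrite fine_gt0// Coo andbT.
  have [d d0 dC] := cell_ball oO (Ox i) xI.
  apply: (lt_le_trans (lebesgue_rV_ball_gt0 (x i) d0)); apply: le_measure => //; rewrite inE//.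
  exact: measurable_ball_rV.
have LC i (w : E) : L2 mu (C i) (en_fun w) by apply: (L2_subset (mC i) mO) => //; exact: Lf.
have L1 i : L2 mu (C i) (cst 1) := bounded_mfun_L2 (mC i) (Coo i) (bounded_mfun_cst _ 1).
pose L i (w : E) := ip mu (C i) (en_fun w) (cst 1) / Num.sqrt (fine (mu (C i))).
have sq0 i : Num.sqrt (fine (mu (C i))) != 0 by rewrite gt_eqF// sqrtr_gt0.
have L2E i w : L i w ^+ 2 = (\int[mu]_(z in C i) en_fun w z) ^+ 2 / fine (mu (C i)).
  rewrite /L expr_div_n sqr_sqrtr ?ltW//; congr (_ ^+ 2 / _).
  by apply: eq_Rintegral => z _; rewrite mulr1.
exists m, L; split.
- move=> i t u v; rewrite /L mulrA -mulrDl; congr (_ / _).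
  by rewrite -ip_linear//; apply: eq_ip => // z _; rewrite en_funP.
- move=> i; exists 1 => u; rewrite mul1r.
  apply: (@le_trans _ _ (sqi mu (C i) (en_fun u))).
    rewrite /L expr_div_n sqr_sqrtr ?(ltW (C0 i))// ler_pdivrMr//.
    apply: (le_trans (cauchy_schwarz (mC i) (LC i u) (L1 i))).
    rewrite ler_wpM2l ?sqi_ge0// /sqi/= expr1n Rintegral_cst// mul1r//.
  rewrite /b ip_sqi -lee_fin /sqi !EFin_Rintegral//; [|exact: (Lf u).2|exact: (LC i u).2].
  apply: ge0_subset_integral => //; last by move=> z _; rewrite lee_fin sqr_ge0.
  by apply/measurable_EFinP; apply: measurable_funX; exact: (Lf u).1.
move=> u.
have := poincare_cover oO bO cO m0 Ox xI r0 cx (en_H1 u).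
rewrite rE /b ip_sqi => h; apply: (le_trans h); apply: lerD.
  by rewrite ler_wpM2l ?(ltW e0).
by apply: ler_sum => i _; rewrite L2E.
Qed.

Lemma sqi_eq0_ae u : L2 mu Omega u -> sqi mu Omega u = 0 <-> {ae mu, forall x, Omega x -> u x = 0}.
Proof.
move=> Lu; have mu2 : measurable_fun Omega (fun x => (u x ^+ 2)%:E).
  by apply/measurable_EFinP; apply: measurable_funX; exact: Lu.1.
have aeE := @ae_eq_integral_abs _ _ _ mu _ mO _ mu2.
have absE : (\int[mu]_(x in Omega) `|(u x ^+ 2)%:E| = (sqi mu Omega u)%:E)%E.
  rewrite /sqi EFin_Rintegral//; last exact: Lu.2.
  by apply: eq_integral => x _; rewrite gee0_abs// lee_fin sqr_ge0.
rewrite absE in aeE; split => [u0|aeu].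
  have /aeE : ((sqi mu Omega u)%:E = 0)%E by rewrite u0.
  by apply: filterS => x h Ox; have [/eqP] := h Ox; rewrite sqrf_eq0 => /eqP.
suff /aeE[] : ae_eq mu Omega (fun x => (u x ^+ 2)%:E) (cst 0%E) by [].
by move: aeu; apply: filterS => x h Ox; rewrite h//= expr0n.
Qed.

(** Min-max: k + 1 functions whose span has Rayleigh quotients at most [Lam] yield k + 1 orthonormal
    eigenfunctions with eigenvalues at most [Lam], and orthonormality makes them free. *)
Lemma neumann_lambda_le (k : nat) (Lam : R) (w : 'I_k.+1 -> 'rV[R]_n -> R)
    (dw : 'I_k.+1 -> 'I_n -> 'rV[R]_n -> R) :
  (forall j, H1 Omega (w j) (dw j)) ->
  (forall c : 'I_k.+1 -> R, (exists j, c j != 0) ->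
     0 < sqi mu Omega (fun x => \sum_j c j * w j x) /\
     \sum_i sqi mu Omega (fun x => \sum_j c j * dw j i x) <=
       Lam * sqi mu Omega (fun x => \sum_j c j * w j x)) ->
  (neumann_lambda Omega k <= Lam%:E)%E.
Proof.
move=> Hw wP; pose W j : E := en_mk oO bO (Hw j).
have sumE (c : 'I_k.+1 -> R) : (forall z, en_fun (\sum_j c j *: W j) z = \sum_j c j * w j z) /\
    forall i z, en_grad (\sum_j c j *: W j) i z = \sum_j c j * dw j i z.
  elim: (index_enum _) => [|j s [IH1 IH2]]; first by split => [z|i z]; rewrite !big_nil.
  by split => [z|i z]; rewrite !big_cons -?IH1 -?IH2.
have [|x [l [xx lL xl]]] := @spectral_eigenvectors R E a b aP bP aC bC a_ge0 b_ge0
    form_complete form_compact k.+1 W Lam.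
  move=> c /wP; have [s1 s2] := sumE c.
  have -> : sqi mu Omega (fun z => \sum_j c j * w j z) = b (\sum_j c j *: W j) (\sum_j c j *: W j).
    by rewrite /b ip_sqi; apply: eq_sqi => z _; rewrite s1.
  suff -> : \sum_i sqi mu Omega (fun z => \sum_j c j * dw j i z) = a (\sum_j c j *: W j) (\sum_j c j *: W j) by [].
  by apply: eq_bigr => i _; rewrite ip_sqi; apply: eq_sqi => z _; rewrite s2.
have sol j : neumann_solution Omega (l j) (en_fun (x j)).
  exists (en_grad (x j)); split; first exact: en_H1.
  move=> v h Hv; have := xl j (en_mk oO bO Hv); rewrite {1}/b {1}/ip => <-.
  have [_ ->] := @Rintegral_sum _ _ _ mu Omega _ (index_enum 'I_n) (fun i z => en_grad (x j) i z * h i z) mO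
     (fun i => L2M mO (Lg (x j) i) ((H1_L2 oO Hv).2 i)).
  by [].
(* The infimum ranges over eigenvalues only, so the competitor is the largest [l j] rather than
   [Lam]. *)
pose j0 := [arg max_(j > ord0) l j]%O.
have j0P j : l j <= l j0 by rewrite /j0; case: arg_maxP => // i _ h; exact: h.
apply: (@le_trans _ _ (l j0)%:E); last by rewrite lee_fin.
apply: ereal_inf_lbound; exists (l j0) => //; split.
  exists (en_fun (x j0)); split; first exact: sol.
  move=> /(sqi_eq0_ae (Lf (x j0))); rewrite -ip_sqi -/(b _ _) xx eqxx => /eqP.
  by rewrite oner_eq0.
exists l, (fun j => en_fun (x j)); split; first by move=> j; split.
move=> c cae j.
have Lc : L2 mu Omega (fun z => \sum_j c j * en_fun (x j) z).
  by apply: L2_sum => // i; exact: L2Z.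
have /(sqi_eq0_ae Lc) s0 := cae.
have : ip mu Omega (fun z => \sum_j c j * en_fun (x j) z) (en_fun (x j)) = c j.
  rewrite ip_sum// (bigD1 j)//= -/(b _ _) xx eqxx mulr1 big1 ?addr0// => i /negbTE ij.
  by rewrite -/(b _ _) xx ij mulr0.
have := cauchy_schwarz mO Lc (Lf (x j)); rewrite s0 mul0r => h cj; move: h.
by rewrite cj => h; apply/eqP; rewrite -sqrf_eq0; apply/eqP/le_anti; rewrite h sqr_ge0.
Qed.

(* Since <u_j, u_l> = 0 unless l_j = l_l, (lam - l_j) <u_j, u_l> = d_j d_l <u_j, u_l>
   with d_j = sqrt (lam - l_j), which bounds the energy of a combination of the u_j. *)
Lemma neumann_count_poincare (k m : nat) (lam r : R) (x : 'I_m -> 'rV[R]_n) :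
  neumann_count_ge Omega lam k -> (0 < m)%N -> (m < k)%N -> (forall i, Omega (x i)) -> injective x ->
  0 < r -> (forall z, Omega z -> exists i, sqn (z - x i) <= r ^+ 2) ->
  1 <= 128 * expR 1 ^+ 2 * r ^+ 2 * lam.
Proof.
move=> [l [u [lu fu]]] m0 mk Ox xI r0 cx.
have /choice[g gP] : forall j, exists g, H1 Omega (u j) g /\
  forall v h, H1 Omega v h ->
    \int[mu]_(x in Omega) (\sum_(i < n) g i x * h i x) =
    l j * \int[mu]_(x in Omega) (u j x * v x) by move=> j; exact: (lu j).2.
have Hu j : H1 Omega (u j) (g j) by have [] := gP j.
have Lu j : L2 mu Omega (u j) := (H1_L2 oO (Hu j)).1.
have Lgj j i : L2 mu Omega (g j i) := (H1_L2 oO (Hu j)).2 i.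
have weak j j' : \sum_i ip mu Omega (g j i) (g j' i) = l j * ip mu Omega (u j) (u j').
  have [_ /(_ _ _ (Hu j'))] := gP j; rewrite -/(ip _ _ _ _) => <-.
  by have [_ ->] := @Rintegral_sum _ _ _ mu Omega _ (index_enum 'I_n) (fun i z => g j i z * g j' i z) mO
     (fun i => L2M mO (Lgj j i) (Lgj j' i)).
have orth j j' : l j != l j' -> ip mu Omega (u j) (u j') = 0.
  move=> ll; have := weak j j'; under eq_bigr do rewrite ipC; rewrite weak ipC => /eqP.
  by rewrite -subr_eq0 -mulrBl mulf_eq0 subr_eq0 eq_sym (negbTE ll) => /eqP.
pose A := \matrix_(j < k, i < m) (\int[mu]_(z in cell Omega x i) u j z).
have [c c0 cA] := left_kernel_neq0 A mk.
pose v z := \sum_j c ord0 j * u j z; pose G i z := \sum_j c ord0 j * g j i z.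
have Hv : H1 Omega v G by exact: H1_sum.
have Lv : L2 mu Omega v := (H1_L2 oO Hv).1.
have mean i : \int[mu]_(z in cell Omega x i) v z = 0.
  have mC := measurable_cell x i mO.
  have iu j : mu.-integrable (cell Omega x i) (EFin \o u j).
    by apply: (integrableS mO mC (@cell_sub _ _ _ Omega x i)); exact: L2_integrable (Lu j).
  have [_ ->] := @Rintegral_sum _ _ _ mu _ _ (index_enum 'I_k) (fun j z => c ord0 j * u j z) mC
     (fun j => integrableZl mC (c ord0 j) (iu j)).
  have := congr1 (fun B : 'rV_m => B ord0 i) cA; rewrite !mxE => h; rewrite -[RHS]h.
  by apply: eq_bigr => j _; rewrite mxE RintegralZl.
have := poincare_cover oO bO cO m0 Ox xI r0 cx Hv.
under [X in _ <= _ + X]eq_bigr do rewrite mean expr0n mul0r.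
rewrite [X in _ <= _ + X]big1 ?addr0// => P.
have quad (e : 'I_k -> R) : sqi mu Omega (fun z => \sum_j e j * u j z) =
    \sum_j \sum_j' e j * e j' * ip mu Omega (u j) (u j').
  have Le : L2 mu Omega (fun z => \sum_j e j * u j z) by apply: L2_sum => // j; exact: L2Z.
  rewrite -ip_sqi ip_sum//; apply: eq_bigr => j _.
  by rewrite ipC ip_sum// mulr_sumr; apply: eq_bigr => j' _; rewrite ipC mulrA.
have energy_le : \sum_i sqi mu Omega (G i) <= lam * sqi mu Omega v.
  have -> : \sum_i sqi mu Omega (G i) = \sum_j \sum_j' c ord0 j * c ord0 j' * (l j * ip mu Omega (u j) (u j')).
    under eq_bigr => i _.
      rewrite -ip_sqi ip_sum//; last by apply: L2_sum => // j; exact: L2Z.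
      under eq_bigr => j _ do rewrite ipC ip_sum// mulr_sumr.
      over.
    rewrite exchange_big/=; apply: eq_bigr => j _; rewrite exchange_big/=; apply: eq_bigr => j' _.
    rewrite -weak mulr_sumr; apply: eq_bigr => i _; by rewrite ipC mulrA.
  rewrite quad mulr_sumr -subr_ge0 -sumrB.
  under eq_bigr do rewrite mulr_sumr -sumrB.
  have := sqi_ge0 mu Omega (fun z => \sum_j (c ord0 j * Num.sqrt (lam - l j)) * u j z).
  rewrite quad; congr (_ <= _); apply: eq_bigr => j _; apply: eq_bigr => j' _.
  have [ll|ll] := eqVneq (l j) (l j'); last by rewrite orth// !mulr0 subr0.
  have : 0 <= lam - l j by rewrite subr_ge0; exact: (lu j).1.
  rewrite -ll => /sqr_sqrtr; move: (Num.sqrt _) (ip _ _ _ _) => t p h.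
  rewrite (_ : lam * _ - _ = c ord0 j * c ord0 j' * (lam - l j) * p); last by ring.
  by rewrite -h; ring.
have v0 : 0 < sqi mu Omega v.
  rewrite lt_neqAle sqi_ge0 andbT eq_sym; apply: contra c0 => /eqP /(sqi_eq0_ae Lv) /fu cz.
  by apply/eqP/rowP => j; rewrite mxE cz.
have K0 : 0 <= 128 * expR 1 ^+ 2 * r ^+ 2 :> R by rewrite mulr_ge0 ?sqr_ge0// mulr_ge0// sqr_ge0.
rewrite -(ler_pM2r v0) mul1r (le_trans P)// -[leRHS]mulrA.
by rewrite ler_wpM2l.
Qed.

End neumann_spectrum.

(** * Trial functions *)

Section integral_of_derivative.
Context (R : realType) (n : nat).
Local Notation mu := (@lebesgue_rV R n).

Lemma integral_translate (f : 'rV[R]_n -> \bar R) (b : 'rV[R]_n) : measurable_fun setT f ->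
  (\int[mu]_x f (x + b)%R = \int[mu]_x f x)%E.
Proof.
move=> mf; rewrite [LHS]integralE [RHS]integralE; congr (_ - _)%E.
- rewrite [RHS](@integral_affine_rV R n 1 b)//; last exact: measurable_funepos.
  by rewrite expr1n mul1e; apply: eq_integral => x _; rewrite !funeposE scale1r.
- rewrite [RHS](@integral_affine_rV R n 1 b)//; last exact: measurable_funeneg.
  by rewrite expr1n mul1e; apply: eq_integral => x _; rewrite !funenegE scale1r.
Qed.

Lemma is_derive_line (h Dh : 'rV[R]_n -> R) (v x : 'rV[R]_n) (s : R) :
  (forall y, is_derive y v h (Dh y)) ->
  is_derive s 1 (fun t : R => h (t *: v + x)) (Dh (s *: v + x)).
Proof.
move=> dh; have [d1 d2] := dh (s *: v + x).
have E : (fun t : R => t^-1 *: (((fun t : R => h (t *: v + x)) \o shift s) (t *: (1 : R)) - h (s *: v + x))) =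
    (fun t : R => t^-1 *: ((h \o shift (s *: v + x)) (t *: v) - h (s *: v + x))).
  apply/funext => t /=; congr (_ *: (h _ - _)).
  by rewrite /GRing.scale/= mulr1 -/(GRing.scale _ _) scalerDl addrA.
by apply: DeriveDef; [rewrite /derivable E|rewrite /derive E].
Qed.

(** Difference quotients have integral 0 by translation invariance. They are bounded by B and vanish
    outside a common ball, so dominated convergence applies. *)
Lemma Rintegral_derive0 (h Dh : 'rV[R]_n -> R) (v : 'rV[R]_n) (B C M : R) :
  (forall y, is_derive y v h (Dh y)) -> (forall y, `|Dh y| <= B) -> (forall y, `|h y| <= C) ->
  measurable_fun setT h -> measurable_fun setT Dh ->
  0 < M -> (forall y, ~ ball 0 M y -> h y = 0) -> \int[mu]_x Dh x = 0.
Proof.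
move=> dh DB hC mh mDh M0 h0.
have B0 : 0 <= B by exact: le_trans (DB 0).
pose t (k : nat) : R := k.+1%:R^-1.
have t0 k : 0 < t k by rewrite invr_gt0.
have t1 k : t k <= 1 by rewrite invf_le1// ler1n.
pose q k (x : 'rV[R]_n) : R := (t k)^-1 * (h (t k *: v + x) - h x).
have qB k x : `|q k x| <= B.
  rewrite normrM gtr0_norm ?invr_gt0// mulrC ler_pdivrMr//.
  have := @derive_bounded_lip R (fun s : R => h (s *: v + x)) (fun s => Dh (s *: v + x)) B
    (fun s => is_derive_line x s dh) (fun s => DB _) 0 (t k).
  by rewrite scale0r !add0r (gtr0_norm (t0 k)).
pose N := M + `|v| + 1; pose Q : set 'rV[R]_n := ball 0 N.
have mQ : measurable Q by exact: measurable_ball_rV.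
have inball y r : ball (0 : 'rV[R]_n) r y <-> `|y| < r.
  by rewrite -ball_normE /ball_/= sub0r normrN.
have q0 k x : ~ Q x -> q k x = 0.
  move=> Qx; rewrite /q !h0 ?subrr ?mulr0// => /inball hx; apply: Qx; apply/inball.
    rewrite /N (lt_le_trans hx)// -addrA lerDl addr_ge0//.
  rewrite (_ : x = (t k *: v + x) - t k *: v); last by rewrite addrAC subrr add0r.
  rewrite (le_lt_trans (ler_normB _ _))// /N -addrA ltr_leD// normrZ (gtr0_norm (t0 k)).
  by rewrite (@le_trans _ _ `|v|)// ?lerDl// ler_piMl.
have mq k : measurable_fun setT (q k).
  apply: measurable_funM => //; apply: measurable_funB => //.
  apply: (@measurableT_comp _ _ _ _ _ _ h) => //.
  under [X in measurable_fun _ X]funext do rewrite addrC -[X in X + _]scale1r.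
  exact: measurable_affine_rV.
have Qoo : (mu Q < +oo)%E by apply: lebesgue_rV_ball_lty; rewrite /N ltr_wpDl// addr_ge0// ltW.
have iQ : mu.-integrable setT (fun x => (B * \1_Q x)%:E).
  have := bounded_mfun_integrable mQ Qoo (bounded_mfun_cst Q B).
  move=> /(integrable_mkcond _ mQ); apply: eq_integrable => // x _.
  rewrite patchE indicE; case: (x \in Q) => /=; by rewrite ?mulr1 ?mulr0.
have ih : mu.-integrable setT (EFin \o h).
  have bh : bounded_mfun Q h by split; [exact: measurable_funTS|exists C].
  have := bounded_mfun_integrable mQ Qoo bh.
  move=> /(integrable_mkcond _ mQ); apply: eq_integrable => // x _ /=.
  rewrite patchE; case: (boolP (x \in Q)) => //= /negP xQ; rewrite h0// => /inball hx; apply: xQ.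
  by rewrite inE; apply/inball; rewrite (lt_le_trans hx)// /N -addrA lerDl addr_ge0.
have iht k : mu.-integrable setT (EFin \o (fun x => h (t k *: v + x))).
  have bq : mu.-integrable setT (EFin \o q k).
    apply: (le_integrable measurableT _ _ iQ); first exact/measurable_EFinP.
    move=> x _; rewrite /= lee_fin indicE; case: (boolP (x \in Q)) => xQ.
      by rewrite mulr1 (ger0_norm B0).
    by rewrite q0 ?normr0// => /mem_set; exact/negP.
  have := integrableD measurableT (integrableZl measurableT (t k) bq) ih.
  apply: eq_integrable => // x _ /=; rewrite -EFinM -EFinD /q mulrA divff ?mul1r ?subrK//.
  by rewrite gt_eqF.
have iq k : (\int[mu]_x (q k x)%:E = 0)%E.
  have hE : \int[mu]_x h (t k *: v + x) = \int[mu]_x h x.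
    rewrite /Rintegral; congr fine.
    rewrite -[RHS](@integral_translate (EFin \o h) (t k *: v)); last exact/measurable_EFinP.
    by apply: eq_integral => x _; rewrite /= addrC.
  rewrite -EFin_Rintegral//; last first.
    have := integrableZl measurableT (t k)^-1 (integrableB measurableT (iht k) ih).
    exact: eq_integrable.
  by rewrite RintegralZl//; [rewrite RintegralB// hE subrr mulr0|exact: (integrableB measurableT (iht k) ih)].
have cq x : q ^~ x @ \oo --> Dh x.
  have [d1 d2] := dh x.
  have tc : t @ \oo --> 0^'.
    move=> A [e /= e0 eA].
    have : \forall k \near \oo, t k < e by exact: near_infty_natSinv_lt (PosNum e0).
    apply: filterS => k ke; apply: eA => /=; last by rewrite gt_eqF.
    by rewrite sub0r normrN gtr0_norm.
  have c : (fun s => s^-1 *: ((h \o shift x) (s *: v) - h x)) s @[s --> 0^'] --> Dh x.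
    by rewrite -d2; exact: d1.
  exact: (cvg_comp _ _ tc c).
have := @dominated_cvg _ _ _ mu setT measurableT (fun k => EFin \o q k) (EFin \o Dh) (fun x => (B * \1_Q x)%:E).
have c1 k : measurable_fun setT (EFin \o q k) by exact/measurable_EFinP.
have c2 x : [set: 'rV[R]_n] x -> (EFin \o q k) x @[k --> \oo] --> (EFin \o Dh) x.
  by move=> _; apply: cvg_EFin; [exact: nearW|exact: cq].
have c3 x : [set: 'rV[R]_n] x -> (B * \1_Q x)%:E \is a fin_num by [].
have c4 k x : [set: 'rV[R]_n] x -> (`|(EFin \o q k) x| <= (B * \1_Q x)%:E)%E.
  move=> _; rewrite /= lee_fin indicE; case: (boolP (x \in Q)) => xQ; first by rewrite mulr1.
  by rewrite q0 ?normr0 ?mulr0// => /mem_set; exact/negP.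
move=> /(_ c1 c2 c3 iQ c4).
rewrite (_ : (fun k => (\int[mu]_x (EFin \o q k) x)%E) = cst 0%E); last by apply/funext => k; exact: iq.
move=> c; have := cvg_unique _ c (@cvg_cst _ _ _ _ _).
by rewrite /Rintegral => ->.
Qed.

End integral_of_derivative.

(** * Radial bumps and their Rayleigh quotients *)

Section trial.
Context (R : realType) (n : nat) (p : 'rV[R]_n) (rho : R).
Hypothesis rho0 : 0 < rho.
Local Notation mu := (@lebesgue_rV R n).
Implicit Types (x : 'rV[R]_n) (t : R).

Definition cut t : R := Num.max 0 (1 - t).

Let y x := sqn (x - p) / rho ^+ 2.

(** The bump (1 - |x - p|^2/rho^2)_+^2: squaring the positive part makes it differentiable across
    the sphere, with a quadratic remainder. *)
Definition trial x : R := cut (y x) ^+ 2.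

Definition dtrial (i : 'I_n) x : R := - 4 * cut (y x) * (x - p) ord0 i / rho ^+ 2.

Lemma cut_ge0 t : 0 <= cut t.
Proof. by rewrite /cut le_max lexx. Qed.

Lemma cut_le1 t : 0 <= t -> cut t <= 1.
Proof. by move=> t0; rewrite /cut ge_max ler01/= gerBl. Qed.

Lemma cut_eq0 t : 1 <= t -> cut t = 0.
Proof. by move=> t1; rewrite /cut max_l// subr_le0. Qed.

Lemma cut_lt1 t : cut t != 0 -> t < 1 /\ cut t = 1 - t.
Proof.
move=> c; have t1 : t < 1 by rewrite ltNge; apply: contra c => /cut_eq0 ->.
by split => //; rewrite /cut max_r// subr_ge0 ltW.
Qed.

Lemma cut_taylor t t' : `|cut t' ^+ 2 - cut t ^+ 2 + 2 * cut t * (t' - t)| <= (t' - t) ^+ 2.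
Proof.
have s0 := sqr_ge0 (1 - t); have s1 := sqr_ge0 (1 - t'); have s2 := sqr_ge0 (t' - t).
rewrite /cut; have [h|h] := leP 0 (1 - t); have [h'|h'] := leP 0 (1 - t'); rewrite ler_norml.
- lra.
- have := mulr_ge0_le0 h (ltW h'); lra.
- have := mulr_le0_ge0 (ltW h) h'; lra.
- lra.
Qed.

Let rho2 : 0 < rho ^+ 2. Proof. by rewrite exprn_gt0. Qed.

Let y_ge0 x : 0 <= y x.
Proof. by rewrite divr_ge0 ?sqn_ge0 ?(ltW rho2). Qed.

Lemma sqn_line x (h : R) i : sqn (h *: delta_mx 0 i + x - p) =
  sqn (x - p) + 2 * h * (x - p) ord0 i + h ^+ 2.
Proof.
rewrite /sqn (bigD1 i)//= [in RHS](bigD1 i)//= !mxE !eqxx/= mulr1.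
under eq_bigr => j /negbTE ji do rewrite !mxE ji andbF mulr0 add0r.
under [in RHS]eq_bigr => j _ do rewrite !mxE.
move: (\sum_(_ | _) _) => S; ring.
Qed.

Lemma is_derive_trial i x : is_derive x (delta_mx 0 i) trial (dtrial i x).
Proof.
pose d := (x - p) ord0 i; pose D := (2 * `|d| + 1) / rho ^+ 2.
apply: (@is_derive_quadratic _ _ _ _ _ _ (D ^+ 2 + 2 * cut (y x) / rho ^+ 2)) => h h1.
have yE : y (h *: delta_mx 0 i + x) - y x = h * (2 * d + h) / rho ^+ 2.
  rewrite /y sqn_line -/d; move: (sqn _) => s; field.
  by rewrite gt_eqF.
have := cut_taylor (y x) (y (h *: delta_mx 0 i + x)).
rewrite yE /trial /dtrial -/d; move: (cut_ge0 (y x)).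
move: (cut (y (h *: _ + x)) ^+ 2) (cut (y x)) => c' c c0 T.
rewrite (_ : _ - _ = (c' - c ^+ 2 + 2 * c * (h * (2 * d + h) / rho ^+ 2)) - 2 * c / rho ^+ 2 * h ^+ 2); last first.
  by field; rewrite gt_eqF.
rewrite (le_trans (ler_normB _ _))// [leRHS]mulrDl; apply: lerD; last first.
  by rewrite ger0_norm// mulr_ge0 ?sqr_ge0// divr_ge0 ?(ltW rho2)// mulr_ge0.
apply: (le_trans T); rewrite -mulrA exprMn mulrC ler_wpM2r ?sqr_ge0//.
rewrite -(ger0_norm (sqr_ge0 _)) -[leRHS]ger0_norm ?sqr_ge0// !normrX ler_sqr ?nnegrE//.
rewrite /D !normrM ler_wpM2r// ?normr_ge0//.
rewrite (@ger0_norm _ (2 * `|d| + 1)) ?addr_ge0 ?mulr_ge0//.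
by rewrite (le_trans (ler_normD _ _))// normrM normr_nat lerD2l.
Qed.

Let measurable_y : measurable_fun setT y.
Proof. by apply: measurable_funM => //; exact: measurable_sqn. Qed.

Let measurable_cut : measurable_fun setT (cut \o y).
Proof. by apply: measurable_maxr => //; exact: measurable_funB. Qed.

Lemma measurable_trial : measurable_fun setT trial.
Proof. exact: measurable_funX. Qed.

Lemma measurable_dtrial i : measurable_fun setT (dtrial i).
Proof.
apply: measurable_funM => //; apply: measurable_funM; first exact: measurable_funM.
under [X in measurable_fun _ X]funext do rewrite !mxE.
by apply: measurable_funB => //; exact: measurable_coord_rV.
Qed.

Lemma trial_bounded x : `|trial x| <= 1.
Proof. by rewrite ger0_norm ?sqr_ge0// expr_le1 ?cut_ge0 ?cut_le1. Qed.

Lemma dtrial_bounded i x : `|dtrial i x| <= 4 / rho.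
Proof.
rewrite /dtrial; have [->|/cut_lt1[y1 _]] := eqVneq (cut (y x)) 0.
  by rewrite mulr0 !mul0r normr0 divr_ge0 ?ltW.
have d1 : `|(x - p) ord0 i| <= rho.
  rewrite -ler_sqr ?nnegrE ?(ltW rho0)// real_normK ?num_real//.
  rewrite (le_trans (ler_sqn _ _))// ltW//.
  by move: y1; rewrite ltr_pdivrMr// mul1r.
rewrite !normrM normrN normr_nat (ger0_norm (cut_ge0 _)) normfV (gtr0_norm rho2).
rewrite ler_pdivrMr// (_ : 4 / rho * rho ^+ 2 = 4 * 1 * rho); last by field; rewrite gt_eqF.
apply: ler_pM => //; first by rewrite mulr_ge0 ?cut_ge0.
by rewrite ler_wpM2l// cut_le1.
Qed.

Context (Omega : set 'rV[R]_n).
Hypothesis oO : open Omega.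
Hypothesis bO : bounded_set Omega.
Let mO : measurable Omega := open_measurable_rV oO.
Let Ooo : (mu Omega < +oo)%E := bounded_lebesgue_rV_lty mO bO.

Let bounded_trial : bounded_mfun Omega trial.
Proof. by split; [exact: measurable_funTS measurable_trial|exists 1 => x _; exact: trial_bounded]. Qed.

Let bounded_dtrial i : bounded_mfun Omega (dtrial i).
Proof. by split; [exact: measurable_funTS (measurable_dtrial i)|exists (4 / rho) => x _; exact: dtrial_bounded]. Qed.

(** The Neumann problem imposes no boundary condition, so the bump may cross the boundary of
    [Omega]. Integration by parts concerns [trial * phi], which vanishes outside the compact support
    of [phi], and can be done in the whole space. *)
Lemma H1_trial : H1 Omega trial dtrial.
Proof.
apply/(H1P oO); split.
- exact: bounded_mfun_L2.
- by move=> i; exact: bounded_mfun_L2.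
move=> i phi tphi.
have [bphi bdphi] := test_function_bounded_mfun mO tphi.
have [[cphi [B HB]] /(_ i)[cdphi [C HC]]] := test_function_bounded tphi.
have [K [cK KO phiK dphiK]] := test_function_partial_out tphi.
have [M M0 KM] := bounded_set_ball (compact_bounded cK).
pose Dh x := trial x * partial i phi x + phi x * dtrial i x.
have dphi x : is_derive x (delta_mx 0 i) phi (partial i phi x).
  have [sphi _] := tphi; have [_ /(_ i) d] := sphi [::] x I.
  exact: (derivableP d).
have dh x : is_derive x (delta_mx 0 i) (trial * phi) (Dh x).
  exact: (is_deriveM (is_derive_trial i x) (dphi x)).
have mphi := continuous_measurable_fun_rV cphi.
have mdphi := continuous_measurable_fun_rV cdphi.
have B0 : 0 <= B by exact: le_trans (HB 0).
have Dh0 : \int[mu]_x Dh x = 0.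
  apply: (@Rintegral_derive0 _ _ (trial * phi) Dh (delta_mx 0 i) (1 * C + B * (4 / rho)) (1 * B) M) => //.
  - move=> x; rewrite /Dh (le_trans (ler_normD _ _))// (normrM (trial x)) (normrM (phi x)) lerD//.
      by apply: ler_pM => //; exact: trial_bounded.
    by apply: ler_pM => //; exact: dtrial_bounded.
  - by move=> x; rewrite [X in `|X|]/(trial x * phi x) normrM ler_pM// trial_bounded.
  - by apply: measurable_funM => //; exact: measurable_trial.
  - apply: measurable_funD; apply: measurable_funM => //; first exact: measurable_trial.
    exact: measurable_dtrial.
  - move=> x Mx; transitivity (trial x * phi x) => //.
    by rewrite phiK ?mulr0// => /KM; exact: Mx.
have : \int[mu]_(x in Omega) Dh x = 0.
  rewrite -Dh0 [LHS]Rintegral_mkcond; apply: eq_Rintegral => x _; rewrite patchE.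
  case: (boolP (x \in Omega)) => // /negP xO.
  have Kx : ~ K x by move=> /KO; rewrite -in_setE.
  by rewrite /Dh phiK// dphiK// mulr0 mul0r addr0.
have i1 := bounded_mfun_integrable mO Ooo (bounded_mfunM bounded_trial (bdphi i)).
have i2 := bounded_mfun_integrable mO Ooo (bounded_mfunM bphi (bounded_dtrial i)).
rewrite RintegralD// -/(ip _ _ _ _) -/(ip _ _ _ _) [X in _ + X = _ -> _]ipC => /eqP.
by rewrite addr_eq0 => /eqP.
Qed.

Hypothesis cO : convex_rV Omega.
Hypothesis Op : Omega p.

Lemma sqi_trial_gt0 : 0 < sqi mu Omega trial.
Proof.
have : nbhs p (Omega `&` [set x | sqn (x - p) < rho ^+ 2 / 2]).
  apply: filterI; first exact: open_nbhs_nbhs.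
  apply: (cvgr_lt _ (@continuous_sqn R n p p)); rewrite subrr sqn0 divr_gt0//.
move=> /nbhs_ballP[e /= e0 eO].
have mB : measurable (ball p e) by exact: measurable_ball_rV.
have mt : measurable_fun setT (fun x => (trial x ^+ 2)%:E).
  by apply/measurable_EFinP; apply: measurable_funX; exact: measurable_trial.
rewrite -lte_fin /sqi EFin_Rintegral//; last exact: (bounded_mfun_L2 mO Ooo bounded_trial).2.
apply: (@lt_le_trans _ _ (\int[mu]_(x in ball p e) ((4^-1 ^+ 2)%:E))%E).
  by rewrite integral_cst// mule_gt0 ?lte_fin ?exprn_gt0 ?invr_gt0//; exact: lebesgue_rV_ball_gt0.
apply: (@le_trans _ _ (\int[mu]_(x in ball p e) (trial x ^+ 2)%:E)%E).
  apply: ge0_le_integral => //; first exact: measurable_funTS.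
  - move=> x /eO[_ /= xp]; rewrite lee_fin lerXn2r ?nnegrE ?invr_ge0 ?sqr_ge0//.
    have y2 : y x <= 2^-1 by rewrite /y ler_pdivrMr// mulrC ltW.
    rewrite /trial (_ : 4^-1 = 2^-1 ^+ 2 :> R); last by field.
    by rewrite lerXn2r ?nnegrE ?invr_ge0 ?cut_ge0// /cut le_max; apply/orP; right; lra.
apply: ge0_subset_integral => //.
- exact: measurable_funTS.
- by move=> x _; rewrite lee_fin sqr_ge0.
- by move=> x /eO[].
Qed.

(* Contracting towards [p] by the factor 1 - d, d = 1/(2 n), maps [Omega] into itself and
   gives d^2 cut (y x)^2 <= cut (y ((1 - d) x + d p))^4. *)
Lemma trial_energy : (0 < n)%N ->
  \sum_i sqi mu Omega (dtrial i) <= 128 * n%:R ^+ 2 / rho ^+ 2 * sqi mu Omega trial.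
Proof.
move=> n0; have nn : 0 < n%:R :> R by rewrite ltr0n.
pose d : R := (2 * n%:R)^-1; have d0 : 0 < d by rewrite invr_gt0 mulr_gt0.
have d1 : d <= 1 by rewrite invf_le1 ?mulr_gt0// -natrM ler1n muln_gt0.
have nd : n%:R * d = 2^-1 by rewrite /d; field; rewrite gt_eqF.
have d1' : d <= 2^-1 by rewrite -nd ler_peMl ?(ltW d0)// ler1n.
have t0 : 0 < 1 - d by lra.
pose F x : \bar R := ((fun x => (trial x ^+ 2)%:E) \_ Omega) x.
have F0 x : (0 <= F x)%E by rewrite /F patchE; case: ifP => // _; rewrite lee_fin sqr_ge0.
have mF : measurable_fun setT F.
  apply/(measurable_restrictT _ mO)/measurable_EFinP; apply: measurable_funX.
  exact: measurable_funTS measurable_trial.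
have bcut : bounded_mfun Omega (cut \o y).
  split; first exact: measurable_funTS.
  by exists 1 => x _; rewrite /= ger0_norm ?cut_ge0// cut_le1.
have Lcut := bounded_mfun_L2 mO Ooo bcut.
have Ltr := bounded_mfun_L2 mO Ooo bounded_trial.
(* The squared gradient is at most 16 cut^2/rho^2, while trial^2 = cut^4, so the integrals of cut^2
   and cut^4 are to be compared. The factor 8 n^2 is d^-2 = 4 n^2 times (1 - d)^-n <= 2, and 128 =
   16 * 8. *)
have key : sqi mu Omega (cut \o y) <= 8 * n%:R ^+ 2 * sqi mu Omega trial.
  rewrite -lee_fin EFinM /sqi !EFin_Rintegral//; [|exact: Ltr.2|exact: Lcut.2].
  have -> : (\int[mu]_(x in Omega) (trial x ^+ 2)%:E = \int[mu]_x F x)%E.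
    by rewrite [LHS]integral_mkcond.
  rewrite (integral_affine_rV (d *: p) t0 mF F0) muleA -EFinM.
  have mFd : measurable_fun setT (fun x => F ((1 - d) *: x + d *: p)).
    by apply: (@measurableT_comp _ _ _ _ _ _ F) => //; exact: measurable_affine_rV.
  apply: (@le_trans _ _ (\int[mu]_x ((d ^- 2)%:E * F ((1 - d) *: x + d *: p)%R))%E); last first.
    rewrite ge0_integralZl//; last by rewrite lee_fin invr_ge0 sqr_ge0.
    apply: lee_wpmul2r; first by apply: integral_ge0.
    rewrite lee_fin (_ : d ^- 2 = 4 * n%:R ^+ 2); last by rewrite /d; field; rewrite gt_eqF.
    have : 2^-1 <= (1 - d) ^+ n.
      by rewrite (le_trans _ (bernoulli_ge n _))// ?(ltW d0)// nd; lra.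
    have := sqr_ge0 (n%:R : R); nra.
  rewrite integral_mkcond; apply: ge0_le_integral => //.
  - by move=> x _; rewrite patchE; case: ifP => // _; rewrite lee_fin sqr_ge0.
  - apply/(measurable_restrictT _ mO)/measurable_EFinP; apply: measurable_funX.
    exact: measurable_funTS.
  - by apply: emeasurable_funM.
  move=> x _; rewrite patchE; case: (boolP (x \in Omega)) => [/set_mem xO|_]; last first.
    by rewrite mule_ge0// lee_fin invr_ge0 sqr_ge0.
  have xO' : Omega ((1 - d) *: x + d *: p) by apply: cO => //; rewrite (ltW d0).
  rewrite /F patchE mem_set// -EFinM lee_fin mulrC ler_pdivlMr ?exprn_gt0//=.
  have yE : y ((1 - d) *: x + d *: p) = (1 - d) ^+ 2 * y x.
    rewrite /y mulrA; congr (_ / _); rewrite -sqnZ; congr sqn.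
    by apply/rowP => j; rewrite !mxE; ring.
  have [->|/cut_lt1[y1 ->]] := eqVneq (cut (y x)) 0.
    by rewrite expr0n mul0r sqr_ge0.
  rewrite /trial yE; have yx0 := y_ge0 x.
  have e1 : (1 - d) ^+ 2 * y x <= y x by rewrite ler_piMl// expr_le1//; lra.
  have e2 : (1 - d) ^+ 2 * y x <= 1 - d.
    apply: (@le_trans _ _ ((1 - d) ^+ 2 * 1)); first by rewrite ler_wpM2l ?sqr_ge0// ltW.
    by rewrite mulr1 expr2 ler_piMr//; lra.
  have -> : cut ((1 - d) ^+ 2 * y x) = 1 - (1 - d) ^+ 2 * y x by rewrite /cut max_r//; lra.
  move: ((1 - d) ^+ 2 * y x) e1 e2 => z e1 e2.
  rewrite -exprMn lerXn2r ?nnegrE ?sqr_ge0//; first by rewrite mulr_ge0 ?(ltW d0)//; lra.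
  rewrite expr2; apply: ler_pM; lra.
have -> : 128 * n%:R ^+ 2 / rho ^+ 2 * sqi mu Omega trial =
    16 / rho ^+ 2 * (8 * n%:R ^+ 2 * sqi mu Omega trial) by ring.
have c0 : 0 <= 16 / rho ^+ 2 by rewrite divr_ge0// ltW.
apply: le_trans (ler_wpM2l c0 key).
have [iS <-] := @Rintegral_sum _ _ _ mu Omega _ (index_enum 'I_n) (fun i x => dtrial i x ^+ 2) mO
  (fun i => (bounded_mfun_L2 mO Ooo (bounded_dtrial i)).2).
have iC := integrableZl mO (16 / rho ^+ 2) Lcut.2.
rewrite /sqi -RintegralZl//; last exact: Lcut.2.
apply: le_Rintegral => // x _ /=.
have -> : \sum_i dtrial i x ^+ 2 = 16 / rho ^+ 2 * (cut (y x) ^+ 2 * y x).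
  rewrite /dtrial; move: (cut (y x)) => c; rewrite /y /sqn mulr_suml !mulr_sumr.
  by apply: eq_bigr => i _; field; rewrite gt_eqF.
rewrite ler_wpM2l//; have [->|/cut_lt1[y1 _]] := eqVneq (cut (y x)) 0.
  by rewrite expr0n mul0r.
by rewrite ler_piMr ?sqr_ge0// ltW.
Qed.

End trial.

Lemma cut_disjoint (R : realType) n (p q x : 'rV[R]_n) (rho : R) : 0 < rho ->
  (2 * rho) ^+ 2 <= sqn (p - q) ->
  cut (sqn (x - p) / rho ^+ 2) * cut (sqn (x - q) / rho ^+ 2) = 0.
Proof.
move=> r0 pq; apply/eqP; rewrite mulf_eq0; apply: contraT; rewrite negb_or => /andP[/cut_lt1[h1 _] /cut_lt1[h2 _]].
move: h1 h2; rewrite !ltr_pdivrMr ?exprn_gt0// !mul1r => h1 h2.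
have := sqnD_le (p - x) (x - q); rewrite addrA subrK [sqn (p - x)]sqn_sub_sym.
move: pq; rewrite exprMn; lra.
Qed.

Lemma sqi_orthogonal d (T : measurableType d) (R : realType) (mu : {measure set T -> \bar R})
    (D : set T) (I : finType) (c : I -> R) (F : I -> T -> R) : measurable D ->
  (forall j, L2 mu D (F j)) -> (forall j l x, j != l -> F j x * F l x = 0) ->
  sqi mu D (fun x => \sum_j c j * F j x) = \sum_j c j ^+ 2 * sqi mu D (F j).
Proof.
move=> mD LF F0.
under [RHS]eq_bigr => j _ do rewrite -sqiZ//.
have [_ <-] := @Rintegral_sum _ _ _ mu D _ (index_enum I) (fun j x => (c j * F j x) ^+ 2) mD
  (fun j => (L2Z mD (c j) (LF j)).2).
apply: eq_Rintegral => x _; rewrite expr2 mulr_suml; apply: eq_bigr => j _.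
rewrite mulr_sumr (bigD1 j)//= -expr2 big1 ?addr0// => l lj.
by rewrite mulrACA F0 ?mulr0// eq_sym.
Qed.

(** Centres at distance 2 rho give bumps with disjoint supports. Both quadratic forms are then
    diagonal on their span, so the bound for a single bump holds for every combination. *)
Lemma neumann_lambda_separated (R : realType) n (Omega : set 'rV[R]_n) (k : nat) (rho : R)
    (x : 'I_k.+1 -> 'rV[R]_n) : (0 < n)%N -> open Omega -> bounded_set Omega ->
  convex_rV Omega ->
  0 < rho -> spread Omega (2 * rho) x ->
  (neumann_lambda Omega k <= (128 * n%:R ^+ 2 / rho ^+ 2)%:E)%E.
Proof.
move=> n0 oO bO cO rho0 [Ox sx]; have mO := open_measurable_rV oO.
have HH j := H1_trial (x j) rho0 oO bO.
have O0 : Omega !=set0 by exists (x ord0).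
apply: (neumann_lambda_le oO bO cO O0 (w := fun j => trial (x j) rho) (dw := fun j => dtrial (x j) rho)) => // c [j0 cj0].
have LL j := H1_L2 oO (HH j).
have s0 j := sqi_trial_gt0 rho0 oO bO (Ox j).
have dis j l z : j != l -> cut (sqn (z - x j) / rho ^+ 2) * cut (sqn (z - x l) / rho ^+ 2) = 0.
  by move=> /sx; exact: cut_disjoint.
rewrite (sqi_orthogonal _ mO (fun j => (LL j).1)); last first.
  by move=> j l z /(dis _ _ z) h; rewrite /trial -exprMn h expr0n.
split.
  apply: (@lt_le_trans _ _ (c j0 ^+ 2 * sqi (lebesgue_rV n) Omega (trial (x j0) rho))).
    by rewrite mulr_gt0// lt_neqAle sqr_ge0 eq_sym sqrf_eq0 cj0.
  rewrite (bigD1 j0)//= lerDl; apply: sumr_ge0 => j _.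
  by rewrite mulr_ge0 ?sqr_ge0 ?sqi_ge0.
under eq_bigr => i _.
  rewrite (sqi_orthogonal _ mO (fun j => (LL j).2 i)); last first.
    move=> j l z /(dis _ _ z) h; rewrite /dtrial.
    rewrite (_ : _ * _ = 16 * (cut (sqn (z - x j) / rho ^+ 2) * cut (sqn (z - x l) / rho ^+ 2)) *
      (z - x j) ord0 i * (z - x l) ord0 i / rho ^+ 2 / rho ^+ 2); last by ring.
    by rewrite h mulr0 !mul0r.
  over.
rewrite exchange_big/= mulr_sumr; apply: ler_sum => j _.
rewrite -mulr_sumr mulrCA ler_wpM2l ?sqr_ge0//.
exact: trial_energy.
Qed.

Theorem theorem1p3 (R : realType) :
  exists c : R, 0 < c /\
  forall (n : nat), (1 <= n)%N ->
  forall (k : nat), (2 <= k)%N ->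
  forall Omega Omega' : set 'rV[R]_n,
    domain Omega -> bounded_set Omega ->
    convex_set (Omega : set (convex_lmodType 'rV[R]_n)) ->
    piecewise_smooth_boundary Omega ->
    domain Omega' -> bounded_set Omega' ->
    convex_set (Omega' : set (convex_lmodType 'rV[R]_n)) ->
    piecewise_smooth_boundary Omega' ->
    Omega `<=` Omega' ->
    (neumann_lambda Omega' k <=
       (c * (n%:R * ln (k%:R : R)) ^+ 2)%:E * neumann_lambda Omega k.-1)%E.
Proof.
have ln2 : 0 < ln 2 :> R by rewrite ln_gt0// ltr1n.
have e0 : 0 < expR 1 ^+ 2 :> R by rewrite exprn_gt0// expR_gt0.
(* 2^20 e^2 = (128 * 16) * (128 e^2 * 4), from the radii rho = r/4 of the bumps in [Omega']
   and 2 r of the cells in [Omega]. *)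
exists (2 ^+ 20 * expR 1 ^+ 2 / ln 2 ^+ 2); split.
  by rewrite divr_gt0 ?exprn_gt0// mulr_gt0// exprn_gt0.
move=> n n1 k k2 Omega Omega' [oO O0 _] bO /convex_setP cO _ [oO' O0' _] bO' /convex_setP cO' _ OO'.
have [r [r0 [xs sx] n2r]] := separated_doubling n1 k2 oO bO O0.
have [z sz] : exists z : 'I_k.+1 -> 'rV[R]_n, spread Omega' (2 * (r / 4)) z.
  have [z [Oz sz]] := separated_midpoint cO (ltW r0) k2 (ex_intro _ xs sx).
  exists z; split => [i|]; first exact/OO'/Oz.
  by rewrite (_ : 2 * (r / 4) = r / 2)//; lra.
have rho0 : 0 < r / 4 by rewrite divr_gt0.
have up := neumann_lambda_separated n1 oO' bO' cO' rho0 sz.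
have r20 : 0 < 2 * r by rewrite mulr_gt0.
have [m [x [sm cx]]] := maximal_separated bO r20.
have [Ox _] := sm; have xI := separated_inj r20 sm.
(* Otherwise k of these points would be at mutual distance at least 2 r, against the choice of r. *)
have mk : (m < k)%N.
  rewrite ltnNge; apply/negP => km; apply: n2r.
  by apply: (separatedS (r := 2 * r) _ km); [rewrite lexx (ltW r20)|exists x].
have m0 : (0 < m)%N by have [y Oy] := O0; have [i _] := cx y Oy; exact: leq_ltn_trans (ltn_ord i).
set Lam := 128 * n%:R ^+ 2 / (r / 4) ^+ 2 in up.
set C := _ * (n%:R * ln k%:R) ^+ 2.
have lnk : ln 2 <= ln k%:R :> R by rewrite ler_ln ?posrE ?ltr0n ?(ltn_trans _ k2)// ler_nat.
have n0 : 0 < n%:R :> R by rewrite ltr0n.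
have CE : 2 ^+ 20 * expR 1 ^+ 2 * n%:R ^+ 2 <= C.
  rewrite /C exprMn mulrA -subr_ge0.
  rewrite (_ : _ - _ = 2 ^+ 20 * expR 1 ^+ 2 * n%:R ^+ 2 / ln 2 ^+ 2 * (ln k%:R ^+ 2 - ln 2 ^+ 2)); last by field; rewrite gt_eqF.
  apply: mulr_ge0; last by rewrite subr_ge0 lerXn2r ?nnegrE ?(ltW ln2)// (le_trans (ltW ln2)).
  by rewrite divr_ge0 ?sqr_ge0// mulr_ge0 ?sqr_ge0// mulr_ge0 ?(ltW e0)// exprn_ge0.
have C0 : 0 < C.
  by apply: lt_le_trans CE; rewrite !mulr_gt0 ?exprn_gt0// expR_gt0.
(* Bounding the infimum below by Lam/C, admissible value by admissible value, also covers the case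
   where it is infinite. *)
have low : ((Lam / C)%:E <= neumann_lambda Omega k.-1)%E.
  apply/ereal_infP => _ [lam [_ cnt] <-]; rewrite lee_fin ler_pdivrMr// mulrC.
  (* Index k - 1 counts from 0, so [cnt] provides k independent eigenfunctions, more than the m
     cells. *)
  rewrite prednK ?(ltn_trans _ k2)// in cnt.
  have P := neumann_count_poincare oO bO cO cnt m0 mk Ox xI r20 cx.
  have lam0 : 0 <= lam.
    rewrite leNgt; apply/negP => l0; move: P; rewrite leNgt => /negP; apply.
    apply: (@le_lt_trans _ _ 0) => //; rewrite mulr_ge0_le0 ?(ltW l0)//.
    by rewrite mulr_ge0 ?sqr_ge0// mulr_ge0// ltW.
  apply: (@le_trans _ _ (2 ^+ 20 * expR 1 ^+ 2 * n%:R ^+ 2 * lam)); last by rewrite ler_wpM2r.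
  have Lam0 : 0 <= Lam by rewrite divr_ge0 ?sqr_ge0// mulr_ge0// sqr_ge0.
  rewrite -[leLHS]mulr1; apply: (le_trans (ler_wpM2l Lam0 P)).
  rewrite /Lam le_eqVlt; apply/orP; left; apply/eqP; field.
  by rewrite gt_eqF.
apply: (le_trans up); rewrite -[Lam](@divfK _ C) ?gt_eqF// mulrC EFinM.
by rewrite lee_pmul2l// ?lte_fin.
Qed.
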